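(* Let $T_h$ be a regular rectangular partition of $\Omega$ and $u\in W^{3,p}(\Omega)$, $2\le p\le\infty$, and let $1/p+1/q=1$. Then $$|a_h(u-\Pi_hu,\Pi_h^*v)|\le Ch^2\|u\|_{3,p}\|v\|_{1,q}\qquad\forall\,v\in U_h,$$ with $C$ independent of $h$, $u$ and $v$.
   Context: $\Omega\subset\mathbb{R}^2$ is an open rectangle. $A=(a_{ij})_{2\times2}\in[W^{1,\infty}(\Omega)]^{2\times2}$ satisfies $C_1\xi^T\xi\le\xi^TA\xi\le C_2\xi^T\xi$ for all $\xi\in\mathbb{R}^2$ on $\Omega$, with constants $C_1,C_2>0$; $c\in L^\infty(\Omega)$, $c\ge0$. $T_h$ is a conforming partition of $\overline\Omega$ into closed rectangles with sides parallel to the axes; $h_K$ is the diameter of $K$, $h=\max_Kh_K$, $\rho_K$ the diameter of the largest ball in $K$; regular means $h_K/\rho_K\le\gamma$ for all $K$ with fixed $\gamma$. $N_h$ is the set of nodes. The dual partition $T_h^*$ is obtained by connecting the center of each element to the midpoints of its edges; the control volume $K_P^*$ of a node $P$ is the union of the resulting sub-rectangles having $P$ as a vertex. $U_h=\{v\in C^0(\overline\Omega): v|_K\in Q_1(K)\ \forall K,\ v|_{\partial\Omega}=0\}$ ($Q_1$ = bilinear polynomials). $\Pi_h^*v=\sum_{P\in N_h}v(P)\chi_P$, $\chi_P$ the characteristic function of $K_P^*$. $\Pi_hu$ is the piecewise bilinear nodal interpolant of $u$. For $w\in H^1(\Omega)$ (with traces of $A\nabla w$ defined) and $z$ piecewise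 constant on $T_h^*$ vanishing on control volumes of boundary nodes, $a_h(w,z)=\sum_{K_P^*\in T_h^*}\big(-\int_{\partial K_P^*}n\cdot(A\nabla w)z\,ds+\int_{K_P^*}cwz\big)$, $n$ the outward unit normal. $\|\cdot\|_{m,p}$ denotes the $W^{m,p}(\Omega)$ norm. *)

(* Defs.v *)
From mathcomp Require Import all_boot all_order all_algebra.
From mathcomp Require Import all_classical all_reals all_analysis.
Import Order.TTheory GRing.Theory Num.Theory numFieldNormedType.Exports.

Set Implicit Arguments.
Unset Strict Implicit.
Unset Printing Implicit Defensive.

Local Open Scope ring_scope.
Local Open Scope classical_set_scope.

Section FVM.
Variable R : realType.

Notation pt := (R * R)%type.

Definition mu2 := ((@lebesgue_measure R) \x (@lebesgue_measure R))%E.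

Definition box (P Q : pt) : set pt :=
  [set z | Num.min P.1 Q.1 <= z.1 <= Num.max P.1 Q.1 /\ Num.min P.2 Q.2 <= z.2 <= Num.max P.2 Q.2].

Definition Omega (a1 b1 a2 b2 : R) : set pt :=
  [set z | a1 < z.1 < b1 /\ a2 < z.2 < b2].
Definition Omegabar (a1 b1 a2 b2 : R) : set pt :=
  [set z | a1 <= z.1 <= b1 /\ a2 <= z.2 <= b2].
Definition bdOmega (a1 b1 a2 b2 : R) : set pt :=
  Omegabar a1 b1 a2 b2 `\` Omega a1 b1 a2 b2.

(* A closed rectangle K = [x0,x1] x [y0,y1] is encoded by its lower-left
   corner K.1 = (x0,y0) and upper-right corner K.2 = (x1,y1). *)
Definition rect := (pt * pt)%type.
Definition rect_ok (K : rect) : Prop := K.1.1 < K.2.1 /\ K.1.2 < K.2.2.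
Definition rset (K : rect) : set pt := box K.1 K.2.
Definition verts (K : rect) : seq pt :=
  [:: (K.1.1, K.1.2); (K.2.1, K.1.2); (K.1.1, K.2.2); (K.2.1, K.2.2)].
Definition edges (K : rect) : seq (pt * pt) :=
  [:: ((K.1.1, K.1.2), (K.2.1, K.1.2)); ((K.1.1, K.2.2), (K.2.1, K.2.2));
      ((K.1.1, K.1.2), (K.1.1, K.2.2)); ((K.2.1, K.1.2), (K.2.1, K.2.2))].
Definition center (K : rect) : pt := ((K.1.1 + K.2.1) / 2, (K.1.2 + K.2.2) / 2).

(* h_K (diameter of K) and rho_K (diameter of the largest ball in K) *)
Definition diam (K : rect) : R :=
  Num.sqrt ((K.2.1 - K.1.1) ^+ 2 + (K.2.2 - K.1.2) ^+ 2).
Definition rho (K : rect) : R := Num.min (K.2.1 - K.1.1) (K.2.2 - K.1.2).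

Definition conforming_partition (a1 b1 a2 b2 : R) (T : seq rect) : Prop :=
  [/\ uniq T,
      (forall K, K \in T -> rect_ok K),
      [set z | exists2 K, K \in T & rset K z] = Omegabar a1 b1 a2 b2 &
      (forall K K', K \in T -> K' \in T -> K != K' ->
         rset K `&` rset K' = set0
         \/ (exists P, [/\ P \in verts K, P \in verts K' &
                           rset K `&` rset K' = [set P]])
         \/ (exists E, [/\ E \in edges K, E \in edges K' &
                           rset K `&` rset K' = box E.1 E.2]))].

Definition regular (gamma : R) (T : seq rect) : Prop :=
  forall K, K \in T -> diam K / rho K <= gamma.

Definition hmax (T : seq rect) : R := \big[Num.max/0]_(K <- T) diam K.

Definition nodes (T : seq rect) : seq pt := undup (flatten (map verts T)).

Definition interior_node (a1 b1 a2 b2 : R) (P : pt) : bool :=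
  (a1 < P.1 < b1) && (a2 < P.2 < b2).

(* K /\ K_P^* : the sub-rectangle of K (P a vertex of K) cut out by the dual
   partition, namely the box between P and the center of K. *)
Definition quarter (K : rect) (P : pt) : set pt := box P (center K).

Definition pd (b : bool) (f : pt -> R) : pt -> R := fun z =>
  if b then derive1 (fun t => f (t, z.2)) z.1
  else derive1 (fun t => f (z.1, t)) z.2.

Definition iterpd (ds : seq bool) (f : pt -> R) : pt -> R := foldr pd f ds.

Definition smooth (f : pt -> R) : Prop :=
  forall ds : seq bool,
    continuous (iterpd ds f) /\
    (forall z : pt, derivable (fun t => iterpd ds f (t, z.2)) z.1 1 /\
                    derivable (fun t => iterpd ds f (z.1, t)) z.2 1).

Definition test_fun (D : set pt) (phi : pt -> R) : Prop :=
  smooth phi /\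
  exists Kc : set pt, [/\ compact Kc, Kc `<=` D & forall z, ~ Kc z -> phi z = 0].

Definition Dalpha (i j : nat) (phi : pt -> R) : pt -> R :=
  iterpd (nseq i true ++ nseq j false) phi.

Definition LpnormD (D : set pt) (p : \bar R) (f : pt -> R) : \bar R :=
  Lnorm mu2 p (fun z => ((\1_D z : R) * f z)%:E).

Definition weak_derivs (D : set pt) (m : nat) (p : \bar R) (u : pt -> R)
    (g : nat -> nat -> pt -> R) : Prop :=
  [/\ measurable_fun D u, (LpnormD D p u < +oo)%E &
      forall i j, (i + j <= m)%N ->
        [/\ measurable_fun D (g i j), (LpnormD D p (g i j) < +oo)%E &
            forall phi, test_fun D phi ->
              (\int[mu2]_(z in D) (u z * Dalpha i j phi z)%:E =
               ((-1) ^+ (i + j))%:E * \int[mu2]_(z in D) (g i j z * phi z)%:E)%E]].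

(* || u ||_{m,p} computed from the weak derivatives g (sum of the L^p norms
   of D^alpha u, |alpha| <= m; an equivalent form of the W^{m,p} norm) *)
Definition sobnorm (D : set pt) (m : nat) (p : \bar R) (g : nat -> nat -> pt -> R)
    : \bar R :=
  (\sum_(i < m.+1) \sum_(j < m.+1 | (i + j <= m)%N) LpnormD D p (g i j))%E.

Definition conj_exp (p q : \bar R) : Prop :=
  (p = +oo%E /\ q = 1%:E) \/ (p = 1%:E /\ q = +oo%E) \/
  (exists r s : R, [/\ p = r%:E, q = s%:E, 0 < r, 0 < s & r^-1 + s^-1 = 1]).

Definition in_Uh (a1 b1 a2 b2 : R) (T : seq rect) (v : pt -> R) : Prop :=
  [/\ {within Omegabar a1 b1 a2 b2, continuous v},
      (forall K, K \in T -> exists a b c d : R,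
         forall z, rset K z -> v z = a + b * z.1 + c * z.2 + d * z.1 * z.2) &
      (forall z, bdOmega a1 b1 a2 b2 z -> v z = 0)].

Definition interpK (K : rect) (u : pt -> R) : pt -> R := fun z =>
  let t := (z.1 - K.1.1) / (K.2.1 - K.1.1) in
  let s := (z.2 - K.1.2) / (K.2.2 - K.1.2) in
  u (K.1.1, K.1.2) * (1 - t) * (1 - s) + u (K.2.1, K.1.2) * t * (1 - s)
  + u (K.1.1, K.2.2) * (1 - t) * s + u (K.2.1, K.2.2) * t * s.

Definition matvec (A : 'I_2 -> 'I_2 -> pt -> R) (z : pt) (F : pt) : pt :=
  (A ord0 ord0 z * F.1 + A ord0 (lift ord0 ord0) z * F.2,
   A (lift ord0 ord0) ord0 z * F.1 + A (lift ord0 ord0) (lift ord0 ord0) z * F.2).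

(* int_{dK_P^* inside K} n . F ds : the part of the boundary of the control
   volume K_P^* lying in K consists of the segment from the center of K to
   the midpoint of the horizontal edge of K through P (outward normal
   sg(cx - Px) e_x) and the segment from the center to the midpoint of the
   vertical edge of K through P (outward normal sg(cy - Py) e_y). *)
Definition fluxK (K : rect) (P : pt) (F : pt -> pt) : R :=
  let c := center K in
  Num.sg (c.1 - P.1) *
    Rintegral (@lebesgue_measure R) `[Num.min P.2 c.2, Num.max P.2 c.2]
      (fun y => (F (c.1, y)).1)
  + Num.sg (c.2 - P.2) *
    Rintegral (@lebesgue_measure R) `[Num.min P.1 c.1, Num.max P.1 c.1]
      (fun x => (F (x, c.2)).2).

(* a_h(w, z) for z = sum_P zc(P) chi_P piecewise constant on T_h^* vanishing
   on control volumes of boundary nodes (so only interior nodes contribute),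
   and w given elementwise: wK K = w|_K, gwK K = (grad w)|_K (w may be
   discontinuous in its gradient across element edges). Since z = zc(P) on
   K_P^*:
   a_h(w,z) = sum_{P interior} zc(P) * ( - int_{dK_P^*} n.(A grad w) ds
                                         + int_{K_P^*} c w ). *)
Definition ah (a1 b1 a2 b2 : R) (T : seq rect) (A : 'I_2 -> 'I_2 -> pt -> R)
    (c : pt -> R) (wK : rect -> pt -> R) (gwK : rect -> pt -> pt)
    (zc : pt -> R) : R :=
  \sum_(P <- nodes T | interior_node a1 b1 a2 b2 P)
     zc P * (\sum_(K <- T | P \in verts K)
               (- fluxK K P (fun x => matvec A x (gwK K x))
                + Rintegral mu2 (quarter K P) (fun x => c x * wK K x))).

(* w = u - Pi_h u elementwise, with grad u given by the (continuous
   representatives of the) weak derivatives gx = D^(1,0) u, gy = D^(0,1) u *)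
Definition err_interp (u : pt -> R) : rect -> pt -> R :=
  fun K z => u z - interpK K u z.
Definition grad_err_interp (u gx gy : pt -> R) : rect -> pt -> pt :=
  fun K z => (gx z - pd true (interpK K u) z, gy z - pd false (interpK K u) z).

(* Pi_h^* v : its value on K_P^* is v(P) *)
Definition Pistar (v : pt -> R) : pt -> R := fun P => v P.

End FVM.

(* Main.v *)
Require Import Defs.
From mathcomp Require Import all_boot all_order all_algebra.
From mathcomp Require Import all_classical all_reals all_analysis.
From mathcomp Require Import measurable_realfun ess_sup_inf.
From mathcomp Require Import ring lra zify.
Import Order.TTheory GRing.Theory Num.Theory numFieldNormedType.Exports.
Local Open Scope ring_scope.
Local Open Scope classical_set_scope.

Set Implicit Arguments.
Unset Strict Implicit.
Unset Printing Implicit Defensive.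

(* On a cell K the error w = u - Pi_h u enters only through functionals that are tensor products of
   one-dimensional ones. Mollifying such a functional and integrating it i times in x and j times in y
   gives a compactly supported test function, provided it kills polynomials of degree < i in x and < j
   in y; the definition of weak derivatives then bounds it by the L^1(K) norm of D^(i,j) u, and letting
   the mollification width tend to 0 requires only continuity of u and grad u. The flux of the diagonal
   part of A is superconvergent at the midlines. The off-diagonal part is not: after freezing A it
   leaves, on each edge, the jump of v times a second difference of u, which is the same for the two
   cells sharing the edge (and 0 on the boundary), so it telescopes. What remains is bounded on K by
   h^2 |K|^-1 |u|_(3,1,K) |v|_(1,1,K), and the sum over K by the Hoelder inequality. *)

(** About u one knows its action on compactly supported test functions and the values of continuous
    representatives. Pointwise quantities are therefore limits of pairings, and the mollifiers must
    stay strictly inside the cell even for points on its boundary. The kernels are third derivatives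
    of a smoothed truncated power [t^2/2]. Their primitives are exact polynomials beyond the
    transition zone, so polynomials are annihilated exactly at every positive width, not only in the
    limit. The price is a mollifier that changes sign: limits are controlled by its sup norm times
    the area of its support, and the constant [tpM] runs through all bounds. The cell estimates live
    in L^1 because, on the unit square, derivatives up to order three in L^1 already control point
    values of the gradient. A product of an L^1 norm from u and one from v then bounds the cell
    without any power of h. The factor h^2 comes only from |K| <= h^2, and |K|^-1 is the weight that
    makes the Hoelder inequality sum over cells for every p. *)

Section SmoothStep.
Context {R : realType}.
Implicit Types (f g : R -> R) (x t : R) (n : nat).

(** * Smooth steps on the line and their iterated derivatives *)

Lemma drvD f g x a b : is_derive x 1 f a -> is_derive x 1 g b ->
  is_derive x 1 (fun t => f t + g t) (a + b).
Proof. exact: is_deriveD. Qed.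

Lemma drvM f g x a b : is_derive x 1 f a -> is_derive x 1 g b ->
  is_derive x 1 (fun t => f t * g t) (a * g x + f x * b).
Proof.
move=> fa gb; apply: (is_derive_eq (is_deriveM fa gb)).
by rewrite /GRing.scale /= addrC (mulrC (g x)).
Qed.

Lemma drv_cst (c x : R) : is_derive x 1 (fun=> c) 0.
Proof. exact: is_derive_cst. Qed.

Lemma drv_id x : is_derive x 1 id 1.
Proof. exact: is_derive_id. Qed.

Lemma drvZ (c : R) f x a : is_derive x 1 f a -> is_derive x 1 (fun t => c * f t) (c * a).
Proof.
move=> fa; apply: (is_derive_eq (drvM (drv_cst c x) fa)).
by rewrite mul0r add0r.
Qed.

Lemma drv_affine f x a (k d : R) : is_derive (k * x + d) 1 f a ->
  is_derive x 1 (fun t => f (k * t + d)) (k * a).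
Proof.
move=> fa; rewrite mulrC.
have h : is_derive x 1 (fun t => k * t + d) k.
  apply: (is_derive_eq (drvD (drvZ k (drv_id x)) (drv_cst d x))).
  by rewrite mulr1 addr0.
exact: (@is_derive1_comp R f (fun t => k * t + d) x a k fa h).
Qed.

Lemma drvV f x a : f x != 0 -> is_derive x 1 f a ->
  is_derive x 1 (fun t => (f t)^-1) (- a * ((f x)^-1 * (f x)^-1)).
Proof.
move=> fx fa; apply: (is_derive_eq (is_deriveV fx fa)).
by rewrite /GRing.scale /= expr2 invfM !mulNr mulrC.
Qed.

Lemma drv_near f g x a : (\forall t \near x, f t = g t) ->
  is_derive x 1 f a -> is_derive x 1 g a.
Proof.
exact: near_eq_is_derive.
Qed.

Lemma drv_unique f x a b : is_derive x 1 f a -> is_derive x 1 f b -> a = b.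
Proof. by move=> [_ <-] [_ <-]. Qed.

Lemma drv_continuous f x a : is_derive x 1 f a -> {for x, continuous f}.
Proof. by move=> [fa _]; apply: differentiable_continuous; apply/derivable1_diffP. Qed.

(** The derivative is existential, so that sums, products and inverses go through by induction on
    [n] without a formula for iterated derivatives; [ndiff_jet] recovers these afterwards. *)
Fixpoint ndiff n f : Prop :=
  if n is m.+1 then
    exists2 f', (forall x, is_derive x 1 f (f' x)) & ndiff m f'
  else True.

Lemma ndiffW n f : ndiff n.+1 f -> ndiff n f.
Proof.
elim: n f => [//|n ih] f [f' ff' h]; exists f' => //; exact: ih.
Qed.

Lemma ndiffD n f g : ndiff n f -> ndiff n g -> ndiff n (fun t => f t + g t).
Proof.
elim: n f g => [//|n ih] f g [f' ff' hf] [g' gg' hg].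
by exists (fun t => f' t + g' t); [move=> x; exact: drvD|exact: ih].
Qed.

Lemma ndiffM n f g : ndiff n f -> ndiff n g -> ndiff n (fun t => f t * g t).
Proof.
elim: n f g => [//|n ih] f g nf ng.
move: (nf) (ng) => [f' ff' hf] [g' gg' hg].
exists (fun t => f' t * g t + f t * g' t); first by move=> x; exact: drvM.
by apply: ndiffD; apply: ih => //; exact: ndiffW.
Qed.

Lemma ndiff_cst n (c : R) : ndiff n (fun=> c).
Proof.
elim: n c => [//|n ih] c; exists (fun=> 0); [move=> x; exact: drv_cst|exact: ih].
Qed.

Lemma ndiff_id n : ndiff n id.
Proof.
case: n => [//|n]; exists (fun=> 1); [move=> x; exact: drv_id|exact: ndiff_cst].
Qed.

Lemma ndiffV n f : (forall x, f x != 0) -> ndiff n f -> ndiff n (fun t => (f t)^-1).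
Proof.
move=> f0; elim: n f f0 => [//|n ih] f f0 nf.
move: (nf) => [f' ff' hf].
exists (fun t => - f' t * ((f t)^-1 * (f t)^-1)); first by move=> x; exact: drvV.
apply: ndiffM.
  rewrite (_ : (fun _ => _) = (fun t => (-1) * f' t)); last first.
    by apply/funext => t; rewrite mulN1r.
  by apply: ndiffM => //; exact: ndiff_cst.
by apply: ndiffM; apply: ih => //; exact: ndiffW.
Qed.

Lemma ndiff_affine n f (k d : R) : ndiff n f -> ndiff n (fun t => f (k * t + d)).
Proof.
elim: n f => [//|n ih] f [f' ff' h].
exists (fun t => k * f' (k * t + d)); first by move=> x; exact: drv_affine.
by apply: ndiffM; [exact: ndiff_cst|exact: ih].
Qed.

Definition jet (J : nat -> R -> R) := forall n t, is_derive t 1 (J n) (J n.+1 t).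

Lemma ndiff_jet f : (forall n, ndiff n f) -> exists2 J, jet J & J 0%N = f.
Proof.
move=> nf; exists (fun n => iter n (@derive1 R R) f); last by [].
have h n : forall m, ndiff m (iter n (@derive1 R R) f).
  elim: n => [//|n ih] m; have [f' ff' h] := ih m.+1.
  rewrite iterS (_ : derive1 _ = f')//.
  by apply/funext => x; rewrite derive1E; have [_ ->] := ff' x.
move=> n t; have [f' ff' _] := h n 1%N; rewrite iterS derive1E.
by have [d ->] := ff' t; apply: DeriveDef => //; have [_ ->] := ff' t.
Qed.

(** The family [t^-n exp(-1/t)] is closed under differentiation up to linear combinations, which
    gives smoothness without computing polynomials in [1/t]. *)
Definition flat n t : R := if 0 < t then (t^-1) ^+ n * expR (- t^-1) else 0.

(** The exponential dominates the term of degree [n+1] of its series; the power of [t] to spare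
    gives continuity at 0. *)
Lemma flat_le n t : `|flat n t| <= (n.+1)`!%:R * `|t|.
Proof.
rewrite /flat; case: ltP => t0; last by rewrite normr0 mulr_ge0.
have ti0 : 0 < t^-1 by rewrite invr_gt0.
rewrite (gtr0_norm t0) ger0_norm; last by rewrite mulr_ge0 ?expR_ge0// exprn_ge0 ?ltW.
rewrite expRN ler_pdivrMr ?expR_gt0// -mulrA.
rewrite -ler_pdivrMl ?ltr0n ?fact_gt0//.
rewrite -ler_pdivrMl//.
have := @expR_ge1Dxn R (t^-1) n (ltW ti0); apply: le_trans.
by rewrite (_ : t^-1 * _ = t^-1 ^+ n.+1 / (n.+1)`!%:R) ?lerDr// exprS mulrA mulrC mulrA mulrAC; ring.
Qed.

Lemma flat_derive n t :
  is_derive t 1 (flat n) (flat n.+2 t - n%:R * flat n.+1 t).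
Proof.
have [t0|t0|<-] := ltgtP 0 t; last 1 first.
(* At 0 the difference quotient of [flat n] is [flat n.+1], so differentiability reduces to
   continuity of the next member. *)
- apply/is_derive1_caratheodory; exists (fun z => flat n.+1 z); split.
  + move=> z; rewrite /flat ltxx !subr0; case: ltP => z0; last by rewrite mul0r.
    by rewrite exprSr -!mulrA [expR _ * z]mulrC mulKf// gt_eqF.
  + suff h : flat n.+1 z @[z --> 0] --> flat n.+1 0 by exact: h.
    rewrite (_ : flat n.+1 0 = 0); last by rewrite /flat ltxx.
    apply/cvgr0Pnorm_le => e e0.
    near=> z; apply: (le_trans (flat_le _ _)).
    rewrite -ler_pdivlMl ?ltr0n ?fact_gt0//.
    near: z.
    have := @nbhs0_le R R ((n.+2)`!%:R^-1 * e); apply.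
    by rewrite mulr_gt0// invr_gt0 ltr0n fact_gt0.
  + by rewrite /flat ltxx mulr0 subr0.
- rewrite /flat t0.
  apply: (@drv_near (fun z => (z^-1) ^+ n * expR (- z^-1))).
    near=> z; rewrite ifT//; near: z; exact: lt_nbhsr.
  have tn0 : t != 0 by rewrite gt_eqF.
  have hi : is_derive t 1 (fun z : R => z^-1) (- (t^-1 * t^-1)).
    by apply: (is_derive_eq (drvV tn0 (drv_id t))); rewrite mulN1r.
  have hn : is_derive t 1 (fun z : R => (z^-1) ^+ n) (- n%:R * t^-1 ^+ n.+1).
    elim: n => [|n ih].
      by apply: is_derive_eq (drv_cst 1 t) _; rewrite mulNr mul0r oppr0.
    rewrite (_ : (fun _ => _) = (fun z => z^-1 * z^-1 ^+ n)); last first.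
      by apply/funext => z; rewrite exprS.
    apply: (is_derive_eq (drvM hi ih)).
    by rewrite -(natr1 n) !exprS; ring.
  have he : is_derive t 1 (fun z : R => expR (- z^-1)) (expR (- t^-1) * (t^-1 * t^-1)).
    apply: (@is_derive1_comp R expR (fun z => - z^-1) t (expR (- t^-1)) (t^-1 * t^-1)).
    rewrite -(opprK (t^-1 * t^-1)).
    exact: is_deriveN.
  apply: (is_derive_eq (drvM hn he)).
  by rewrite !exprS; ring.
- rewrite /flat ltNge (ltW t0)/= mulr0 subr0.
  apply: (@drv_near (fun=> 0)).
  near=> z; rewrite ltNge ltW//=; near: z; exact: lt_nbhsl.
Unshelve. all: by end_near. Qed.

Lemma ndiff_flat m n : ndiff m (flat n).
Proof.
elim: m n => [//|m ih] n.
exists (fun t => flat n.+2 t - n%:R * flat n.+1 t); first exact: flat_derive.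
apply: ndiffD; first exact: ih.
rewrite (_ : (fun _ => _) = (fun t => (- n%:R) * flat n.+1 t)); last first.
  by apply/funext => t; rewrite mulNr.
by apply: ndiffM; [exact: ndiff_cst|exact: ih].
Qed.

(** Derivatives are local, so agreement on an open set propagates from order 0 to all orders. *)
Lemma jet_near0 J : jet J -> forall (D : set R) (h : nat -> R -> R), open D ->
  (forall n t, D t -> is_derive t 1 (h n) (h n.+1 t)) ->
  (forall t, D t -> J 0%N t = h 0%N t) -> forall n t, D t -> J n t = h n t.
Proof.
move=> jJ D h oD hh J0; elim=> [//|n ih] t Dt.
apply: (@drv_unique (J n) t); first exact: jJ.
apply: (@drv_near (h n)); last exact: hh.
have := oD; rewrite openE => /(_ t Dt); apply: filterS => z Dz.
by rewrite ih.
Qed.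

(* Third-order antiderivatives of a mollifier: [F 3] is a bump on [0, 1] with unit mass, and its
   iterated primitives agree with the truncated powers outside [0, 1]. *)
Lemma smooth_truncated_power : exists F : nat -> R -> R,
  [/\ jet F, (forall n t, t < 0 -> F n t = 0) &
   forall n t, 1 < t -> F n t = [:: t ^+ 2 / 2; t; 1]`_n].
Proof.
(* The quotient [S] below is a smooth step, 0 for [t <= 0] and 1 for [t >= 1]; the denominator is
   positive because [t] or [1 - t] is. *)
pose D t := flat 0 t + flat 0 (-1 * t + 1).
have D0 t : D t != 0.
  rewrite gt_eqF// /D /flat !expr0 !mul1r.
  case: (ltP 0 t) => t0; case: (ltP 0 (-1 * t + 1)) => t1; rewrite ?addr0 ?add0r ?addr_gt0 ?expR_gt0//.
  by exfalso; move: t0 t1; lra.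
pose S t := flat 0 t * (D t)^-1.
pose f t := t * t * 2^-1 * S t.
have nf n : ndiff n f.
  apply: ndiffM.
    apply: ndiffM; last exact: ndiff_cst.
    by apply: ndiffM; exact: ndiff_id.
  apply: ndiffM; first exact: ndiff_flat.
  apply: ndiffV => //; apply: ndiffD; first exact: ndiff_flat.
  by apply: ndiff_affine; exact: ndiff_flat.
have [F jF F0] := ndiff_jet nf.
exists F; split=> // n t.
- have oD : open [set t : R | t < 0] := @open_lt R 0.
  have := @jet_near0 F jF [set t | t < 0] (fun _ _ => 0) oD; apply.
  by move=> {}t /= t0; rewrite F0 /f /S /flat [0 < t]ltNge (ltW t0)/= !(mul0r,mulr0).
- have oD : open [set t : R | 1 < t] := @open_gt R 1.
  have := @jet_near0 F jF [set t | 1 < t] (fun n t => [:: t ^+ 2 / 2; t; 1]`_n) oD; apply.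
  + move=> [|[|[|m]]] {}t _ /=.
    * have h := drvM (drvM (drv_id t) (drv_id t)) (drv_cst 2^-1 t).
      apply: (is_derive_eq h); rewrite /=; lra.
    * exact: drv_id.
    * exact: drv_cst.
    * by rewrite nth_nil; apply: drv_cst.
  + move=> {}t /= t1; rewrite F0 /f /S /D /flat.
    have -> : (0 < -1 * t + 1) = false by apply/negbTE; rewrite -leNgt; lra.
    rewrite (lt_trans ltr01 t1) addr0 divff ?mulr1 ?expr2//.
    by rewrite expr0 mul1r gt_eqF ?expR_gt0.
Qed.

End SmoothStep.

(** * One-dimensional mollifying kernels and their primitives *)

Section Kernels.
Context {R : realType}.
Implicit Types (w X Y t s e : R) (n m i j o : nat).

(** Derivatives of [s^2/2]; orders [n >= 3] fall on the default value 0 of [nth]. *)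
Definition tpow n s : R := [:: s ^+ 2 / 2; s; 1]`_n.

Definition tp : nat -> R -> R := projT1 (cid (@smooth_truncated_power R)).

Lemma tp_jet : jet tp.
Proof. by rewrite /tp; case: cid => F []. Qed.

Lemma tp_lt0 n s : s < 0 -> tp n s = 0.
Proof. by rewrite /tp; case: cid => F [_ + _] /=; exact. Qed.

Lemma tp_gt1 n s : 1 < s -> tp n s = tpow n s.
Proof. by rewrite /tp; case: cid => F [_ _ +] /=; exact. Qed.

Lemma jet_continuous (J : nat -> R -> R) n : jet J -> continuous (J n).
Proof. by move=> jJ t; exact: drv_continuous (jJ n t). Qed.

Lemma continuous_bounded01 (f : R -> R) : continuous f ->
  exists M, forall s, 0 <= s <= 1 -> `|f s| <= M.
Proof.
move=> cf.
have : compact (f @` `[0, 1]%classic).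
  apply: continuous_compact; last exact: segment_compact.
  exact: continuous_subspaceT.
move/compact_bounded => [M [_ HM]]; exists (M + 1) => s s01.
apply: (HM (M + 1)); first by rewrite ltrDl.
by exists s => //=; rewrite in_itv.
Qed.

(** Outside [0, 1] the function [tp n] is 0 or [tpow n], on [0, 1] it is bounded by compactness, and
    finitely many orders share one constant. *)
Lemma tp_bounded_ex N : exists M, 0 <= M /\
  forall n, (n <= N)%N -> forall s, `|tp n s| <= M + `|tpow n s|.
Proof.
have one n : exists M, forall s, `|tp n s| <= M + `|tpow n s|.
  have [M HM] := continuous_bounded01 (jet_continuous (n := n) tp_jet).
  have M0 : 0 <= M by apply: le_trans (HM 0 _); rewrite ?normr_ge0// lexx ler01.
  exists M => s.
  have [s0|s0] := ltP s 0; first by rewrite tp_lt0// normr0 addr_ge0.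
  have [s1|s1] := ltP 1 s; first by rewrite tp_gt1// lerDr.
  by apply: (le_trans (HM _ _)); rewrite ?s0 ?s1// lerDl.
elim: N => [|N [M [M0 ih]]].
  have [M HM] := one 0%N; exists `|M|; split=> // -[|//] _ s.
  by apply: (le_trans (HM s)); rewrite lerD2r ler_norm.
have [M' HM] := one N.+1; exists (M + `|M'|); split; first by rewrite addr_ge0.
move=> n; rewrite leq_eqVlt => /predU1P[->|nN] s.
  by apply: (le_trans (HM s)); rewrite lerD2r (le_trans (ler_norm _))// lerDr.
by apply: (le_trans (ih _ nN s)); rewrite lerD2r lerDl.
Qed.

(** The added 1 absorbs [|tpow n s| <= 1], so that [tpM] alone is the bound in [kap_le]. *)
Definition tpM : R := 1 + projT1 (cid (tp_bounded_ex 4)).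

Lemma tpM_ge1 : 1 <= tpM.
Proof. by rewrite /tpM; case: cid => M [M0 _] /=; rewrite lerDl. Qed.

Lemma tpM_ge0 : 0 <= tpM. Proof. exact: le_trans ler01 tpM_ge1. Qed.

Lemma tp_le n s : (n <= 4)%N -> `|tp n s| <= (tpM - 1) + `|tpow n s|.
Proof.
by rewrite /tpM; case: cid => M [M0 h] /= n4; rewrite [1 + M]addrC addrK; exact: h.
Qed.

(** Scaled so that differentiation in [t] raises [n], up to sign. [kap w X 3] is a mollifier of mass
    1 supported on [X - w, X], [kap w X 2] a smoothed indicator of [t < X], [kap w X 0] a smoothed
    [(X - t)_+^2/2]. *)
Definition kap w X n t : R := w ^+ 2 * w^-1 ^+ n * tp n ((X - t) / w).

Lemma kap_drv w X n t : 0 < w -> is_derive t 1 (kap w X n) (- kap w X n.+1 t).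
Proof.
move=> w0.
have h : is_derive (- w^-1 * t + X / w) 1 (tp n) (tp n.+1 ((X - t) / w)).
  by rewrite (_ : (X - t) / w = - w^-1 * t + X / w); [exact: tp_jet|rewrite mulrBl addrC mulNr mulrC].
have := drvZ (w ^+ 2 * w^-1 ^+ n) (drv_affine h).
rewrite (_ : (fun _ => _) = kap w X n); last first.
  by apply/funext => x; rewrite /kap mulrBl [_ * x]mulrC mulrN addrC.
by move=> /is_derive_eq; apply; rewrite /kap [w^-1 ^+ n.+1]exprSr mulNr mulrN !mulrA.
Qed.

Lemma kap_right w X n t : 0 < w -> X < t -> kap w X n t = 0.
Proof.
by move=> w0 Xt; rewrite /kap tp_lt0 ?mulr0// pmulr_llt0 ?invr_gt0// subr_lt0.
Qed.

Lemma kap_left w X n t : 0 < w -> t < X - w -> kap w X n t = tpow n (X - t).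
Proof.
move=> w0 Xt; rewrite /kap tp_gt1; last by rewrite ltr_pdivlMr// mul1r; lra.
have wn : w != 0 by rewrite gt_eqF.
rewrite /tpow; case: n => [|[|[|n]]] /=.
- by rewrite expr0; field.
- by rewrite expr1; field.
- by field.
- by rewrite nth_nil mulr0.
Qed.

Lemma tpow_le1 n s : `|s| <= 1 -> `|tpow n s| <= 1.
Proof.
rewrite /tpow; case: n => [|[|[|n]]] /=; rewrite ?normr1 ?nth_nil ?normr0 ?ler01//.
move=> s1; rewrite normrM normrX (ger0_norm (_ : 0 <= 2^-1)) ?invr_ge0//.
by rewrite ler_pdivrMr// mul1r (le_trans (exprn_ile1 _ (normr_ge0 _) s1))// ler1n.
Qed.

(** Uniform in the width: for [n <= 2] the prefactor is [w^(2-n) <= 1], and it turns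
    [tpow n ((X - t)/w)] into [tpow n (X - t)]. *)
Lemma kap_le w X n t : 0 < w -> w <= 1 -> (n <= 2)%N -> 0 <= X <= 1 -> 0 <= t <= 1 ->
  `|kap w X n t| <= tpM.
Proof.
move=> w0 w1 n2 /andP[X0 X1] /andP[t0 t1].
rewrite /kap; set s := (X - t) / w.
have wn : w != 0 by rewrite gt_eqF.
have s1 : `|X - t| <= 1 by rewrite ler_norml; lra.
rewrite normrM.
have pw : w ^+ 2 * w^-1 ^+ n = w ^+ (2 - n).
  by rewrite exprVn -expfB_cond// (negbTE wn) add0n.
rewrite pw ger0_norm; last by rewrite exprn_ge0// ltW.
have pw0 : 0 <= w ^+ (2 - n) by rewrite exprn_ge0// ltW.
apply: (@le_trans _ _ (w ^+ (2 - n) * ((tpM - 1) + `|tpow n s|))).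
  by rewrite ler_wpM2l// tp_le// (leq_trans n2).
rewrite mulrDr -[leRHS](subrK 1) lerD//.
  by rewrite ler_piMl ?subr_ge0 ?tpM_ge1// exprn_ile1// ltW.
rewrite -(ger0_norm pw0) -normrM -pw.
rewrite (_ : _ * tpow n s = tpow n (X - t)); first exact: tpow_le1.
rewrite /tpow /s; case: n {pw0 pw n2} => [|[|[|n]]] /=.
- by rewrite expr0; field.
- by rewrite expr1; field.
- by field.
- by rewrite nth_nil mulr0.
Qed.

(* An atom (c, w, X, o) stands for c times the o-th derivative at X of the width-w mollifier. *)
Definition atom : Type := (R * R * R * nat)%type.
Definition comb (l : seq atom) n t : R :=
  \sum_(a <- l) a.1.1.1 * kap a.1.1.2 a.1.2 (n + a.2) t.

Definition supp01 (a : R -> R) :=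
  exists lo hi, [/\ 0 < lo, hi < 1 & forall t, (t < lo) || (hi < t) -> a t = 0].

(** Exactly what permits moving [j] derivatives onto u at the cost of a factor [M]. *)
Definition dtest (l : R -> R) j M := exists J : nat -> R -> R,
  [/\ jet J, supp01 (J 0%N),
      (forall t, `|J 0%N t| <= M) & (forall t, l t = J j t)].

Lemma comb_drv l n t : (forall a, a \in l -> 0 < a.1.1.2) ->
  is_derive t 1 (comb l n) (- comb l n.+1 t).
Proof.
elim: l => [|a l ih] hl.
  rewrite /comb big_nil oppr0 (_ : (fun _ => _) = (fun=> 0)); first exact: drv_cst.
  by apply/funext => x; rewrite big_nil.
rewrite {2}/comb big_cons -/(comb l n.+1 t) opprD -mulrN.
rewrite (_ : comb _ _ = (fun t => a.1.1.1 * kap a.1.1.2 a.1.2 (n + a.2) t + comb l n t)).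
  apply: drvD; first by apply/drvZ/kap_drv/hl; rewrite mem_head.
  by apply: ih => b bl; apply: hl; rewrite in_cons bl orbT.
by apply/funext => x; rewrite /comb big_cons.
Qed.

(** The [j]-fold primitive of the kernel is the same combination with all orders lowered by [j]. It
    vanishes to the right of the atoms; to their left it is a polynomial, which the hypothesis on
    [tpow] makes zero. As [a.2 < j], the lowered orders are at most 2 and [kap_le] applies. *)
Lemma comb_dtest (l : seq atom) j lo hi : (j <= 3)%N -> 0 < lo -> hi < 1 ->
  (forall a, a \in l -> [/\ 0 < a.1.1.2, a.1.1.2 <= 1, lo < a.1.2 - a.1.1.2, a.1.2 < hi & (a.2 < j)%N]) ->
  (forall t, \sum_(a <- l) a.1.1.1 * tpow (3 - j + a.2) (a.1.2 - t) = 0) ->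
  dtest (comb l 3) j (tpM * \sum_(a <- l) `|a.1.1.1|).
Proof.
move=> j3 lo0 hi1 hl kill.
have s0 : 0 <= \sum_(a <- l) `|a.1.1.1| by apply: sumr_ge0.
have supp n t : (t < lo) || (hi < t) -> n = (3 - j)%N -> comb l n t = 0.
  move=> /orP[tl|th] ->.
    rewrite -[RHS](kill t); apply: eq_big_seq => a /hl[w0 _ ha _ _].
    by rewrite kap_left// (lt_trans tl).
  rewrite /comb big_seq big1// => a /hl[w0 _ _ ha _].
  by rewrite kap_right ?mulr0// (lt_trans ha).
exists (fun m t => (-1) ^+ (j + m) * comb l (3 - j + m) t); split.
- move=> m t; rewrite addnS exprS mulN1r mulNr -mulrN addnS.
  by apply: drvZ; apply: comb_drv => a /hl[].
- by exists lo, hi; split=> // t ht; rewrite addn0 supp ?mulr0// addn0.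
- move=> t; rewrite normrM normrX normrN1 expr1n mul1r addn0.
  have [ht|] := boolP ((t < lo) || (hi < t)).
    by rewrite supp// normr0 mulr_ge0// tpM_ge0.
  rewrite negb_or -!leNgt => /andP[tl th].
  rewrite (le_trans (ler_norm_sum _ _ _))// mulr_sumr !big_seq ler_sum// => a.
  move=> /hl[w0 w1 ha ha' aj]; rewrite normrM mulrC ler_wpM2r// kap_le//.
  + by move: (a.2 : nat) j3 aj; clear => k; lia.
  + by apply/andP; split; lra.
  + by apply/andP; split; lra.
- move=> t; rewrite addnn -muln2 exprM sqrr_sign mul1r.
  by rewrite subnK.
Qed.

(* Contracted points and widths keep the supports inside (0, 1), and [theta = 1 - e] compensates the
   contraction on derivative atoms. *)
Definition ctr e X : R := (1 - e) * X + e / 2.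
Definition at_ o X e t : R := (1 - e) ^+ o * kap (e / 4) (ctr e X) (3 + o) t.
Definition fn (l : seq (R * R * nat)) e t : R := \sum_(a <- l) a.1.1 * at_ a.2 a.1.2 e t.
Definition catom e (a : R * R * nat) : atom :=
  (a.1.1 * (1 - e) ^+ a.2, e / 4, ctr e a.1.2, a.2).

Lemma fnE l e : fn l e = comb (map (catom e) l) 3.
Proof.
apply/funext => t; rewrite /fn /comb big_map; apply: eq_bigr => a _.
by rewrite /at_ mulrA.
Qed.

(** Annihilation of polynomials of degree [< j], required for the image of the functional under
    every affine map [x -> th x + s]; the power of [th] is the chain rule on derivative atoms. The
    contraction of [fn] is the case [th = 1 - e]. *)
Definition kills j (l : seq (R * R * nat)) := forall th s,
  \sum_(a <- l) a.1.1 * th ^+ a.2 * tpow (3 - j + a.2) (th * a.1.2 + s) = 0.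

Lemma fn_dtest j l e : (j <= 3)%N -> 0 < e -> e < 1 -> kills j l ->
  (forall a, a \in l -> 0 <= a.1.2 <= 1 /\ (a.2 < j)%N) ->
  dtest (fn l e) j (tpM * \sum_(a <- l) `|a.1.1|).
Proof.
move=> j3 e0 e1 kl hl; rewrite fnE.
have := @comb_dtest (map (catom e) l) j (e / 8) (1 - e / 8) j3.
rewrite !big_map => h.
have [||||J [h1 h2 h3 h4]] := h.
- by rewrite divr_gt0.
- by rewrite ltrBlDr ltrDl divr_gt0.
- move=> _ /mapP[a /hl[/andP[X0 X1] aj] ->] /=; rewrite /ctr.
  have : 0 <= (1 - e) * a.1.2 by rewrite mulr_ge0// subr_ge0 ltW.
  have : (1 - e) * a.1.2 <= 1 - e by rewrite ler_piMr// subr_ge0 ltW.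
  by split=> //; lra.
- move=> t; rewrite -[RHS](kl (1 - e) (e / 2 - t)) big_map; apply: eq_bigr => a _ /=.
  by rewrite /ctr addrA.
exists J; split=> // t; apply: (le_trans (h3 t)).
rewrite ler_wpM2l ?tpM_ge0// ler_sum// => a _ /=; rewrite normrM ler_piMr//.
rewrite normrX exprn_ile1// ger0_norm; lra.
Qed.

(** A mollifier of fixed width, used as a reference that carries the mass of a point evaluation. *)
Definition bump (Z : R) : R -> R := kap 8^-1 Z 3.

Lemma bump_dtest Z : 4^-1 <= Z <= 3 / 4 -> dtest (bump Z) 0 (8 * tpM).
Proof.
move=> /andP[Z0 Z1].
have e0 : (0 : R) < 8^-1 by rewrite invr_gt0.
exists (fun m t => (-1) ^+ m * kap 8^-1 Z (3 + m) t); split.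
- move=> m t; rewrite addnS exprS mulN1r mulNr -mulrN.
  exact: drvZ (kap_drv _ _ _ e0).
- exists (10^-1), (4 / 5); split; [by rewrite invr_gt0|lra|].
  move=> t /orP[t1|t1]; rewrite /= addn0.
    by rewrite kap_left /tpow//= ?mulr0//; lra.
  by rewrite kap_right ?mulr0//; lra.
- move=> t; rewrite expr0 mul1r addn0 /kap invrK normrM ger0_norm//.
  have := @tp_le 3 ((Z - t) / 8^-1) isT; rewrite [tpow 3 _]/tpow/= normr0 => h.
  have : 8^-1 ^+ 2 * 8 ^+ 3 = 8 :> R by field.
  move=> ->; rewrite invrK in h; rewrite ler_wpM2l//; lra.
- by move=> t; rewrite expr0 mul1r addn0.
Qed.

(** Both kernels have mass 1, so their difference has a compactly supported primitive, bounded
    independently of [e]. *)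
Lemma at0_bump_dtest X e : 0 < e -> e < 1 -> 0 <= X <= 1 ->
  dtest (fun t => at_ 0 X e t - bump 2^-1 t) 1 (2 * tpM).
Proof.
move=> e0 e1 /andP[X0 X1].
have := @comb_dtest [:: (1, e / 4, ctr e X, 0%N); (-1, 8^-1, 2^-1, 0%N)] 1 (e / 8) (1 - e / 8) isT.
rewrite !big_cons !big_nil /= => h.
have X0e : 0 <= (1 - e) * X by rewrite mulr_ge0// subr_ge0 ltW.
have X1e : (1 - e) * X <= 1 - e by rewrite ler_piMr// subr_ge0 ltW.
have [||||J [h1 h2 h3 h4]] := h.
- by rewrite divr_gt0.
- by rewrite ltrBlDr ltrDl divr_gt0.
- move=> a; rewrite !inE => /orP[] /eqP -> /=; rewrite /ctr; split=> //; lra.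
- by move=> t; rewrite !big_cons big_nil /tpow /=; ring.
exists J; split=> // t.
  by apply: (le_trans (h3 t)); rewrite normrN normr1 addr0 mulrC.
by rewrite -h4 /comb !big_cons big_nil /= /at_ /bump; ring.
Qed.

End Kernels.

(** * Tensor functionals on the unit square, for abstract local data *)

Section LocalEstimates.
Context {R : realType}.
Implicit Types (X Y e : R) (i j o : nat) (l : seq (R * R * nat)).

Definition tame (f : R -> R) := continuous f /\ exists M, forall t, `|f t| <= M.

(* A distribution on the unit square, seen through its action [pairing] on tensor test functions: [bnd i j]
   bounds the L^1 norm of its (i, j)-th derivative, and [val_ o o'] is the pointwise value of its
   (o, o')-th derivative, for o + o' <= 1. *)
Record local_data := LocalData {
  pairing : (R -> R) -> (R -> R) -> R ;
  bnd : nat -> nat -> R ;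
  val_ : nat -> nat -> R -> R -> R }.

(** Bilinearity, integration by parts up to total order [k], and recovery of point values: all
    estimates on the unit square follow from these alone. *)
Definition valid (k : nat) (D : local_data) : Prop := (forall i j, 0 <= bnd D i j) /\
  [/\ (forall a a' b c, tame a -> tame a' -> tame b ->
         pairing D (fun t => c * a t + a' t) b = c * pairing D a b + pairing D a' b),
      (forall a b b' c, tame a -> tame b -> tame b' ->
         pairing D a (fun t => c * b t + b' t) = c * pairing D a b + pairing D a b'),
      (forall i j a b M N, (i + j <= k)%N -> dtest a i M -> dtest b j N ->
         `|pairing D a b| <= M * N * bnd D i j) &
      (forall o o' X Y, (o + o' <= 1)%N -> 0 <= X <= 1 -> 0 <= Y <= 1 ->
         pairing D (at_ o X e) (at_ o' Y e) @[e --> 0^'+] --> val_ D o o' X Y)].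

(** Exchange of the axes, so that an estimate proved in one direction holds in the other. *)
Definition swapl (D : local_data) : local_data :=
  LocalData (fun a b => pairing D b a) (fun i j => bnd D j i)
            (fun o o' X Y => val_ D o' o Y X).

Lemma valid_swap k D : valid k D -> valid k (swapl D).
Proof.
move=> [h0 [h1 h2 h3 h4]]; split=> /= [i j|]; [exact: h0|split].
- by move=> a a' b c ta ta' tb; exact: h2.
- by move=> a b b' c ta tb tb'; exact: h1.
- by move=> i j a b M N ij ha hb; rewrite (mulrC M); apply: h3 => //; rewrite addnC.
- by move=> o o' X Y oo X01 Y01; apply: h4 => //; rewrite addnC.
Qed.

Lemma jet_supp (J : nat -> R -> R) n t : jet J -> supp01 (J 0%N) ->
  (t <= 0) || (1 <= t) -> J n t = 0.
Proof.
move=> jJ [lo [hi [lo0 hi1 J0]]] /orP[t0|t1].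
  rewrite (@jet_near0 _ _ jJ [set t : R | t < lo] (fun _ _ => 0) (@open_lt R lo))//.
    by move=> x /= xlo; rewrite J0// xlo.
  exact: le_lt_trans t0 lo0.
rewrite (@jet_near0 _ _ jJ [set t : R | hi < t] (fun _ _ => 0) (@open_gt R hi))//.
  by move=> x /= xlo; rewrite J0// xlo orbT.
exact: lt_le_trans hi1 t1.
Qed.

Lemma jet_tame (J : nat -> R -> R) n : jet J -> supp01 (J 0%N) -> tame (J n).
Proof.
move=> jJ sJ; split; first exact: jet_continuous.
have [M' HM'] := continuous_bounded01 (jet_continuous (n := n) jJ).
have M'0 : 0 <= M' by apply: le_trans (HM' 0 _); rewrite ?normr_ge0// lexx ler01.
exists M' => t; have [t01|] := boolP (0 <= t <= 1); first exact: HM'.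
rewrite negb_and -!ltNge => /orP[h|h].
  by rewrite (jet_supp _ jJ sJ) ?normr0// (ltW h).
by rewrite (jet_supp _ jJ sJ) ?normr0// (ltW h) orbT.
Qed.

Lemma dtest_tame f i M : dtest f i M -> tame f.
Proof.
move=> [J [jJ sJ _ fJ]]; rewrite (_ : f = J i); last exact/funext.
exact: jet_tame.
Qed.

Lemma tameD f g : tame f -> tame g -> tame (fun t => f t + g t).
Proof.
move=> [cf [M HM]] [cg [N HN]]; split; last first.
  by exists (M + N) => t; rewrite (le_trans (ler_normD _ _))// lerD.
by move=> t; apply: cvgD; [exact: cf|exact: cg].
Qed.

Lemma tameZ c f : tame f -> tame (fun t => c * f t).
Proof.
move=> [cf [M HM]]; split; last by exists (`|c| * M) => t; rewrite normrM ler_wpM2l.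
by move=> t; apply: cvgM; [exact: cvg_cst|exact: cf].
Qed.

Lemma tame0 : tame (fun=> 0).
Proof. by split; [exact: cst_continuous|exists 0 => t; rewrite normr0]. Qed.

Lemma at_tame o X e : 0 < e -> tame (at_ o X e).
Proof.
move=> e0; have e4 : 0 < e / 4 by rewrite divr_gt0.
split; last first.
  pose f t := kap (e / 4) (ctr e X) (3 + o) t.
  have [M HM] : exists M, forall t, `|f t| <= M.
    have [M [M0 HM]] := @tp_bounded_ex R (3 + o).
    exists (`|(e / 4) ^+ 2 * (e / 4)^-1 ^+ (3 + o)| * M) => t.
    rewrite /f /kap normrM ler_wpM2l//.
    by have := HM _ (leqnn _) ((ctr e X - t) / (e / 4)); rewrite /tpow/= nth_nil normr0 addr0.
  exists (`|(1 - e) ^+ o| * M) => t.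
  by rewrite /at_ normrM ler_wpM2l//; exact: HM.
move=> t; apply: cvgM; first exact: cvg_cst.
exact: drv_continuous (kap_drv _ _ _ e4).
Qed.

Lemma fn_cons a l e : fn (a :: l) e = (fun t => a.1.1 * at_ a.2 a.1.2 e t + fn l e t).
Proof. by apply/funext => t; rewrite /fn big_cons. Qed.

Lemma fn_nil e : fn [::] e = (fun=> 0 : R).
Proof. by apply/funext => t; rewrite /fn big_nil. Qed.

Lemma fn_tame l e : 0 < e -> tame (fn l e).
Proof.
move=> e0; elim: l => [|a l ih]; first by rewrite fn_nil; exact: tame0.
by rewrite fn_cons; apply: tameD => //; apply/tameZ/at_tame.
Qed.

Lemma cvg_sum_in (T : eqType) (F : set_system R) (FF : Filter F) (l : seq T) (f : T -> R -> R) (a : T -> R) :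
  (forall x, x \in l -> f x e @[e --> F] --> a x) ->
  \sum_(x <- l) f x e @[e --> F] --> \sum_(x <- l) a x.
Proof.
elim: l => [|x l ih] h.
  by rewrite big_nil; under eq_fun do rewrite big_nil; exact: cvg_cst.
rewrite big_cons; under eq_fun do rewrite big_cons.
apply: cvgD; first by apply: h; rewrite mem_head.
by apply: ih => y yl; apply: h; rewrite in_cons yl orbT.
Qed.

Context (k : nat) (D : local_data) (vD : valid k D).

Lemma pairing0l b : tame b -> pairing D (fun=> 0) b = 0.
Proof.
move=> tb; have [_ [h _ _ _]] := vD.
have := h (fun=> 0) (fun=> 0) b (-1) tame0 tame0 tb.
by rewrite !mulN1r oppr0 addr0 addNr.
Qed.

Lemma pairing_fnl l b e : 0 < e -> tame b ->
  pairing D (fn l e) b = \sum_(a <- l) a.1.1 * pairing D (at_ a.2 a.1.2 e) b.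
Proof.
move=> e0 tb; have [_ [h _ _ _]] := vD.
elim: l => [|a l ih]; first by rewrite fn_nil big_nil pairing0l.
by rewrite fn_cons h ?big_cons ?ih//; [exact: at_tame|exact: fn_tame].
Qed.

Lemma pairing_fnr a l e : 0 < e -> tame a ->
  pairing D a (fn l e) = \sum_(b <- l) b.1.1 * pairing D a (at_ b.2 b.1.2 e).
Proof.
move=> e0 ta; have [_ [h1 h _ _]] := vD.
elim: l => [|b l ih].
  rewrite fn_nil big_nil.
  have := h a (fun=> 0) (fun=> 0) (-1) ta tame0 tame0.
  by rewrite !mulN1r oppr0 addr0 addNr.
by rewrite fn_cons h ?big_cons ?ih//; [exact: at_tame|exact: fn_tame].
Qed.

(** The tensor product of two point functionals, as the limit of [pairing D (fn lx e) (fn ly e)]. *)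
Definition eval2 (lx ly : seq (R * R * nat)) : R :=
  \sum_(a <- lx) \sum_(b <- ly) a.1.1 * (b.1.1 * val_ D a.2 b.2 a.1.2 b.1.2).

Definition in01 l := forall a, a \in l -> 0 <= a.1.2 <= 1.
Definition orders o l := forall a, a \in l -> (a.2 <= o)%N.

Lemma pairing_cvg lx ly o o' : in01 lx -> in01 ly -> orders o lx -> orders o' ly ->
  (o + o' <= 1)%N ->
  pairing D (fn lx e) (fn ly e) @[e --> 0^'+] --> eval2 lx ly.
Proof.
move=> ix iy ox oy oo; have [_ [_ _ _ h]] := vD.
have eqn : \forall e \near (0 : R)^'+,
    \sum_(a <- lx) \sum_(b <- ly) a.1.1 * (b.1.1 * pairing D (at_ a.2 a.1.2 e) (at_ b.2 b.1.2 e))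
    = pairing D (fn lx e) (fn ly e).
  near=> e; have e0 : 0 < e by [].
  rewrite pairing_fnl//; last exact: fn_tame.
  apply: eq_bigr => a _; rewrite pairing_fnr//; last exact: at_tame.
  by rewrite mulr_sumr.
apply: (cvg_trans (near_eq_cvg eqn)).
apply: cvg_sum_in => a al; apply: cvg_sum_in => b bl.
apply: cvgM; first exact: cvg_cst.
apply: cvgM; first exact: cvg_cst.
apply: h; [|exact: ix|exact: iy].
by rewrite (leq_trans _ oo)// leq_add// ?ox ?oy.
Unshelve. all: by end_near. Qed.

Lemma eval2_le lx ly o o' C : in01 lx -> in01 ly -> orders o lx -> orders o' ly ->
  (o + o' <= 1)%N ->
  (forall e, 0 < e -> e < 1 -> `|pairing D (fn lx e) (fn ly e)| <= C) ->
  `|eval2 lx ly| <= C.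
Proof.
move=> ix iy ox oy oo h.
have /cvg_norm := pairing_cvg ix iy ox oy oo.
move/cvgr_to_le; apply.
near=> e; apply: h => //.
Unshelve. all: by end_near. Qed.

Definition mass l : R := \sum_(a <- l) `|a.1.1|.

(** Both factors annihilate polynomials, so [i] derivatives are moved in x and [j] in y; the
    resulting bound is free of [e] and survives the limit. *)
Lemma tensor_le lx ly o o' i j : in01 lx -> in01 ly -> orders o lx -> orders o' ly ->
  (o + o' <= 1)%N -> (o < i <= 3)%N -> (o' < j <= 3)%N -> (i + j <= k)%N ->
  kills i lx -> kills j ly ->
  `|eval2 lx ly| <= tpM * mass lx * (tpM * mass ly) * bnd D i j.
Proof.
move=> ix iy ox oy oo /andP[oi i3] /andP[oj j3] ijk kx ky.
apply: (eval2_le ix iy ox oy oo) => e e0 e1.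
have [_ [_ _ h _]] := vD; apply: h => //; apply: fn_dtest => // a al.
  by split; [exact: ix|rewrite (leq_ltn_trans (ox _ al))].
by split; [exact: iy|rewrite (leq_ltn_trans (oy _ al))].
Qed.

(* The point evaluation at Y is split as a fixed bump plus a derivative. *)
Lemma point_le lx o Y i i' : in01 lx -> 0 <= Y <= 1 -> orders o lx -> (o <= 1)%N ->
  (o < i <= 3)%N -> (o < i' <= 3)%N -> (i <= k)%N -> (i' < k)%N ->
  kills i lx -> kills i' lx ->
  `|eval2 lx [:: (1, Y, 0%N)]| <=
    tpM * mass lx * (8 * tpM) * bnd D i 0 + tpM * mass lx * (2 * tpM) * bnd D i' 1.
Proof.
move=> ix Y01 ox o1 /andP[oi i3] /andP[oi' i3'] ik ik' kx kx'.
have iy : in01 [:: (1, Y, 0%N)] by move=> a; rewrite inE => /eqP ->.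
have oy : orders 0 [:: (1, Y, 0%N)] by move=> a; rewrite inE => /eqP ->.
apply: (@eval2_le _ _ o 0 _ ix iy ox oy); first by rewrite addn0.
move=> e e0 e1; have [_ [_ h2 h3 _]] := vD.
have db := @bump_dtest R 2^-1.
have {}db : dtest (bump (2^-1 : R)) 0 (8 * tpM) by apply: db; apply/andP; split; lra.
have dd := at0_bump_dtest e0 e1 Y01.
(* The bump costs no y-derivative and leaves [i] for x; the remainder is a y-derivative, which uses
   one unit of the total order, hence the condition [i' < k]. *)
rewrite (_ : fn [:: (1, Y, 0%N)] e = (fun t => 1 * bump 2^-1 t + (at_ 0 Y e t - bump 2^-1 t))); last first.
  by rewrite fn_cons fn_nil; apply/funext => t /=; ring.
have tx := fn_tame lx e0.
rewrite h2//; [|exact: dtest_tame db|exact: dtest_tame dd].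
rewrite mul1r (le_trans (ler_normD _ _))// lerD//.
  apply: h3 => //; first by rewrite addn0.
  by apply: fn_dtest => // a al; split; [exact: ix|rewrite (leq_ltn_trans (ox _ al))].
apply: h3 => //; first by rewrite addn1.
by apply: fn_dtest => // a al; split; [exact: ix|rewrite (leq_ltn_trans (ox _ al))].
Qed.

End LocalEstimates.

(** * Gradient of the bilinear interpolation error on the unit square *)

Section UnitSquare.
Context {R : realType} (D : @local_data R).
Implicit Types (X Y : R).

Notation U := (val_ D 0 0).
Notation Ux := (val_ D 1 0).
Notation G := (bnd D).

(** A generous common constant: the largest multiple of [tpM ^+ 2] to be dominated is 32, in
    [second_diff_le]. *)
Definition Kunit : R := 64 * tpM ^+ 2.

Lemma tpM2_ge0 : 0 <= (tpM : R) ^+ 2. Proof. exact: sqr_ge0. Qed.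

Definition bilin X Y : R :=
  (1 - X) * (1 - Y) * U 0 0 + X * (1 - Y) * U 1 0 + (1 - X) * Y * U 0 1 + X * Y * U 1 1.

Lemma in01_cons (a : R * R * nat) l : 0 <= a.1.2 <= 1 -> in01 l -> in01 (a :: l).
Proof. by move=> h hl b; rewrite inE => /orP[/eqP ->|/hl]. Qed.

Lemma in01_nil : @in01 R [::]. Proof. by []. Qed.

Lemma orders_cons n (a : R * R * nat) l : (a.2 <= n)%N -> orders n l -> orders n (a :: l).
Proof. by move=> h hl b; rewrite inE => /orP[/eqP ->|/hl]. Qed.

Lemma orders_nil n : @orders R n [::]. Proof. by []. Qed.

Lemma half01 : 0 <= (2^-1 : R) <= 1. Proof. by apply/andP; split; lra. Qed.
Lemma zero01 : 0 <= (0 : R) <= 1. Proof. by rewrite lexx ler01. Qed.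
Lemma one01 : 0 <= (1 : R) <= 1. Proof. by rewrite lexx ler01. Qed.

Ltac atoms := do ?[apply: in01_cons => /=; first by
   [exact: half01|exact: zero01|exact: one01|assumption]|exact: in01_nil
  |apply: orders_cons => //|exact: orders_nil].
Ltac kill := by move=> th s; rewrite !big_cons big_nil /tpow /=; field.

(** The three functionals in use: a multiple of the increment over [0, 1], the error of linear
    interpolation at [X], and the derivative at [X] minus the increment. *)
Definition l_diff (c : R) : seq (R * R * nat) := [:: (c, 1, 0%N); (- c, 0, 0%N)].
Definition l_hat X : seq (R * R * nat) := [:: (1, X, 0%N); (- (1 - X), 0, 0%N); (- X, 1, 0%N)].
Definition l_der X : seq (R * R * nat) := [:: (1, X, 1%N); (- 1, 1, 0%N); (1, 0, 0%N)].

Lemma kills_diff c : kills 1 (l_diff c). Proof. kill. Qed.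
Lemma kills_hat1 X : kills 1 (l_hat X). Proof. kill. Qed.
Lemma kills_hat2 X : kills 2 (l_hat X). Proof. kill. Qed.
Lemma kills_der X : kills 2 (l_der X). Proof. kill. Qed.
(** For quadratics the increment still equals the derivative at the midpoint; this one extra order
    is the source of superconvergence at the midlines. *)
Lemma kills_der_mid : kills 3 (l_der 2^-1). Proof. kill. Qed.

Lemma mass_diff : mass (l_diff 1) = 2.
Proof. by rewrite /mass !big_cons big_nil /= normrN normr1; lra. Qed.
Lemma mass_hat X : 0 <= X <= 1 -> mass (l_hat X) = 2.
Proof.
by move=> /andP[X0 X1]; rewrite /mass !big_cons big_nil /= !normrN normr1 !ger0_norm; lra.
Qed.
Lemma mass_der X : mass (l_der X) = 3.
Proof. by rewrite /mass !big_cons big_nil /= normrN normr1; lra. Qed.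

Lemma in01_diff c : in01 (l_diff c). Proof. by rewrite /l_diff; atoms. Qed.
Lemma in01_hat X : 0 <= X <= 1 -> in01 (l_hat X).
Proof. by rewrite /l_hat => X01; atoms. Qed.
Lemma in01_der X : 0 <= X <= 1 -> in01 (l_der X).
Proof. by rewrite /l_der => X01; atoms. Qed.
Lemma orders_diff c : orders 0 (l_diff c). Proof. by rewrite /l_diff; atoms. Qed.
Lemma orders_hat X : orders 0 (l_hat X). Proof. by rewrite /l_hat; atoms. Qed.
Lemma orders_der X : orders 1 (l_der X). Proof. by rewrite /l_der; atoms. Qed.
Hint Resolve in01_diff in01_hat in01_der orders_diff orders_hat orders_der
  kills_diff kills_hat1 kills_hat2 kills_der kills_der_mid half01 zero01 one01 : core.

Context (vD : valid 3 D).

Lemma G_ge0 i j : 0 <= G i j. Proof. by have [] := vD. Qed.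

Lemma diff_hat_le Y : 0 <= Y <= 1 ->
  `|U 1 Y - U 0 Y - (1 - Y) * (U 1 0 - U 0 0) - Y * (U 1 1 - U 0 1)| <= 4 * tpM ^+ 2 * G 1 2.
Proof.
move=> Y01.
have := @tensor_le _ _ _ vD (l_diff 1) (l_hat Y) 0 0 1 2.
rewrite mass_diff mass_hat// => /(_ (@in01_diff _) (@in01_hat _ Y01) (@orders_diff _) (@orders_hat _)).
move=> /(_ isT isT isT isT (kills_diff _) (kills_hat2 _)).
rewrite /eval2 !big_cons !big_nil /= => h.
rewrite (_ : 4 * _ * _ = tpM * 2 * (tpM * 2) * G 1 2); last by ring.
by apply: le_trans h; rewrite le_eqVlt; apply/orP; left; apply/eqP; congr `| _ |; ring.
Qed.

Lemma der_point_le X Y : 0 <= X <= 1 -> 0 <= Y <= 1 ->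
  `|Ux X Y - (U 1 Y - U 0 Y)| <= 24 * tpM ^+ 2 * G 2 0 + 6 * tpM ^+ 2 * G 2 1.
Proof.
move=> X01 Y01.
have := @point_le _ _ _ vD (l_der X) 1 Y 2 2.
rewrite mass_der => /(_ (@in01_der _ X01) Y01 (@orders_der _) isT isT isT isT isT (kills_der _) (kills_der _)).
rewrite /eval2 !big_cons !big_nil /= => h.
rewrite (_ : 24 * _ * _ + _ = tpM * 3 * (8 * tpM) * G 2 0 + tpM * 3 * (2 * tpM) * G 2 1); last by ring.
by apply: le_trans h; rewrite le_eqVlt; apply/orP; left; apply/eqP; congr `| _ |; ring.
Qed.

Lemma der_mid_point_le Y : 0 <= Y <= 1 ->
  `|Ux 2^-1 Y - (U 1 Y - U 0 Y)| <= 24 * tpM ^+ 2 * G 3 0 + 6 * tpM ^+ 2 * G 2 1.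
Proof.
move=> Y01.
have := @point_le _ _ _ vD (l_der 2^-1) 1 Y 3 2.
rewrite mass_der => /(_ (@in01_der _ half01) Y01 (@orders_der _) isT isT isT isT isT kills_der_mid (kills_der _)).
rewrite /eval2 !big_cons !big_nil /= => h.
rewrite (_ : 24 * _ * _ + _ = tpM * 3 * (8 * tpM) * G 3 0 + tpM * 3 * (2 * tpM) * G 2 1); last by ring.
by apply: le_trans h; rewrite le_eqVlt; apply/orP; left; apply/eqP; congr `| _ |; ring.
Qed.

Lemma hat_point_le X Y : 0 <= X <= 1 -> 0 <= Y <= 1 ->
  `|U X Y - (1 - X) * U 0 Y - X * U 1 Y| <= 16 * tpM ^+ 2 * G 2 0 + 4 * tpM ^+ 2 * G 2 1.
Proof.
move=> X01 Y01.
have := @point_le _ _ _ vD (l_hat X) 0 Y 2 2.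
rewrite mass_hat// => /(_ (@in01_hat _ X01) Y01 (@orders_hat _) isT isT isT isT isT (kills_hat2 _) (kills_hat2 _)).
rewrite /eval2 !big_cons !big_nil /= => h.
rewrite (_ : 16 * _ * _ + _ = tpM * 2 * (8 * tpM) * G 2 0 + tpM * 2 * (2 * tpM) * G 2 1); last by ring.
by apply: le_trans h; rewrite le_eqVlt; apply/orP; left; apply/eqP; congr `| _ |; ring.
Qed.

Lemma hat_diff_le X : 0 <= X <= 1 ->
  `|U X 1 - U X 0 - (1 - X) * (U 0 1 - U 0 0) - X * (U 1 1 - U 1 0)| <= 4 * tpM ^+ 2 * G 2 1.
Proof.
move=> X01.
have := @tensor_le _ _ _ vD (l_hat X) (l_diff 1) 0 0 2 1.
rewrite mass_diff mass_hat// => /(_ (@in01_hat _ X01) (@in01_diff _) (@orders_hat _) (@orders_diff _)).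
move=> /(_ isT isT isT isT (kills_hat2 _) (kills_diff _)).
rewrite /eval2 !big_cons !big_nil /= => h.
rewrite (_ : 4 * _ * _ = tpM * 2 * (tpM * 2) * G 2 1); last by ring.
by apply: le_trans h; rewrite le_eqVlt; apply/orP; left; apply/eqP; congr `| _ |; ring.
Qed.

(** At [X = 1/2] only third derivatives of u enter, whereas [dx_err_le] needs a second one; after
    scaling this is a gain of one power of h. *)
Lemma dx_mid_err_le Y : 0 <= Y <= 1 ->
  `|Ux 2^-1 Y - (1 - Y) * (U 1 0 - U 0 0) - Y * (U 1 1 - U 0 1)|
  <= Kunit * (G 3 0 + G 2 1 + G 1 2).
Proof.
move=> Y01; have h1 := diff_hat_le Y01; have h2 := der_mid_point_le Y01.
have g1 := mulr_ge0 tpM2_ge0 (G_ge0 3 0); have g2 := mulr_ge0 tpM2_ge0 (G_ge0 2 1).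
have g3 := mulr_ge0 tpM2_ge0 (G_ge0 1 2).
rewrite (_ : _ - _ - _ = (Ux 2^-1 Y - (U 1 Y - U 0 Y)) +
  (U 1 Y - U 0 Y - (1 - Y) * (U 1 0 - U 0 0) - Y * (U 1 1 - U 0 1))); last by ring.
apply: (le_trans (ler_normD _ _)); apply: (le_trans (lerD h2 h1)).
rewrite /Kunit; lra.
Qed.

Lemma dx_err_le X Y : 0 <= X <= 1 -> 0 <= Y <= 1 ->
  `|Ux X Y - (1 - Y) * (U 1 0 - U 0 0) - Y * (U 1 1 - U 0 1)|
  <= Kunit * (G 2 0 + G 2 1 + G 1 2).
Proof.
move=> X01 Y01; have h1 := diff_hat_le Y01; have h2 := der_point_le X01 Y01.
have g1 := mulr_ge0 tpM2_ge0 (G_ge0 2 0); have g2 := mulr_ge0 tpM2_ge0 (G_ge0 2 1).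
have g3 := mulr_ge0 tpM2_ge0 (G_ge0 1 2).
rewrite (_ : _ - _ - _ = (Ux X Y - (U 1 Y - U 0 Y)) +
  (U 1 Y - U 0 Y - (1 - Y) * (U 1 0 - U 0 0) - Y * (U 1 1 - U 0 1))); last by ring.
apply: (le_trans (ler_normD _ _)); apply: (le_trans (lerD h2 h1)).
rewrite /Kunit; lra.
Qed.

End UnitSquare.

(** * Second differences and the interpolation error itself *)

Section UnitSquare2.
Context {R : realType} (D : @local_data R) (vD : valid 3 D).
Implicit Types (X Y : R).

Notation U := (val_ D 0 0).
Notation G := (bnd D).

Lemma second_diff_le X : 0 <= X <= 1 ->
  `|2 * U X 2^-1 - U X 0 - U X 1| <= Kunit * (G 0 2 + G 1 2).
Proof.
move=> X01; have h01 := @half01 R.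
have := hat_point_le (valid_swap vD) h01 X01; rewrite /= => h.
have g1 := mulr_ge0 tpM2_ge0 (G_ge0 vD 0 2); have g2 := mulr_ge0 tpM2_ge0 (G_ge0 vD 1 2).
rewrite (_ : _ - _ - _ = 2 * (U X 2^-1 - (1 - 2^-1) * U X 0 - 2^-1 * U X 1)); last by field.
rewrite normrM ger0_norm// /Kunit; lra.
Qed.

(** The second difference in y is twice the functional [l_hat] at 1/2; its change from one column to
    another kills constants in x, so one x-derivative is available on top of two in y. *)
Lemma second_diff_var_le X : X = 0 \/ X = 1 ->
  `|(2 * U 2^-1 2^-1 - U 2^-1 0 - U 2^-1 1) - (2 * U X 2^-1 - U X 0 - U X 1)| <= Kunit * G 1 2.
Proof.
move=> X01.
pose l : seq (R * R * nat) := [:: (1, 2^-1, 0%N); (-1, X, 0%N)].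
have X01' : 0 <= X <= 1 by case: X01 => ->; [exact: zero01|exact: one01].
have i1 : in01 l by apply: in01_cons => //=; [exact: half01|apply: in01_cons].
have o1 : orders 0 l by do 2 apply: orders_cons => //.
have k1 : kills 1 l by move=> th s; rewrite !big_cons big_nil /tpow /=; ring.
have := @tensor_le _ _ _ vD l (l_hat 2^-1) 0 0 1 2 i1 (@in01_hat _ _ half01) o1 (@orders_hat _ _).
move=> /(_ isT isT isT isT k1 (kills_hat2 _)).
rewrite (mass_hat half01) (_ : mass l = 2); last first.
  by rewrite /mass !big_cons big_nil /= normrN normr1; lra.
rewrite /eval2 !big_cons !big_nil /= => h.
have g2 := mulr_ge0 tpM2_ge0 (G_ge0 vD 1 2).
rewrite (_ : _ - _ = 2 * (1 * (1 * U 2^-1 2^-1) + (1 * (- (1 - 2^-1) * U 2^-1 0) +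
   (1 * (- 2^-1 * U 2^-1 1) + 0)) +
  (-1 * (1 * U X 2^-1) + (-1 * (- (1 - 2^-1) * U X 0) + (-1 * (- 2^-1 * U X 1) + 0)) + 0))); last by field.
rewrite normrM ger0_norm// /Kunit.
have : 2 * (tpM * 2 * (tpM * 2) * G 1 2) <= 64 * tpM ^+ 2 * G 1 2 by lra.
by apply: le_trans; rewrite ler_wpM2l.
Qed.

Lemma vert_diff_mid_le : 
  `|U 2^-1 1 - U 2^-1 0 - 2^-1 * (U 0 1 - U 0 0) - 2^-1 * (U 1 1 - U 1 0)| <= Kunit * G 2 1.
Proof.
have := hat_diff_le vD half01; rewrite (_ : 1 - 2^-1 = 2^-1 :> R); last by field.
move=> /le_trans; apply; have g2 := mulr_ge0 tpM2_ge0 (G_ge0 vD 2 1); rewrite /Kunit; lra.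
Qed.

(** Interpolate linearly in x at height [Y], then in y on the two vertical sides, whose errors enter
    with the convex weights [1 - X] and [X]. *)
Lemma interp_err_le X Y : 0 <= X <= 1 -> 0 <= Y <= 1 ->
  `|U X Y - bilin D X Y| <= Kunit * (G 2 0 + G 2 1 + G 0 2 + G 1 2).
Proof.
move=> X01 Y01.
have h1 := hat_point_le vD X01 Y01.
have h2 := hat_point_le (valid_swap vD) Y01 zero01.
have h3 := hat_point_le (valid_swap vD) Y01 one01.
rewrite /= in h2 h3.
have g1 := mulr_ge0 tpM2_ge0 (G_ge0 vD 0 2); have g2 := mulr_ge0 tpM2_ge0 (G_ge0 vD 1 2).
have g3 := mulr_ge0 tpM2_ge0 (G_ge0 vD 2 0); have g4 := mulr_ge0 tpM2_ge0 (G_ge0 vD 2 1).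
rewrite /bilin (_ : _ - _ = (U X Y - (1 - X) * U 0 Y - X * U 1 Y) +
  ((1 - X) * (U 0 Y - (1 - Y) * U 0 0 - Y * U 0 1) +
   X * (U 1 Y - (1 - Y) * U 1 0 - Y * U 1 1))); last by ring.
move: X01 => /andP[X0 X1].
apply: (le_trans (ler_normD _ _)).
have : `|(1 - X) * (U 0 Y - (1 - Y) * U 0 0 - Y * U 0 1) +
   X * (U 1 Y - (1 - Y) * U 1 0 - Y * U 1 1)| <= 16 * tpM ^+ 2 * G 0 2 + 4 * tpM ^+ 2 * G 1 2.
  apply: (le_trans (ler_normD _ _)); rewrite !normrM (ger0_norm X0) (ger0_norm (_ : 0 <= 1 - X)) ?subr_ge0//.
  have X1' : 0 <= 1 - X by rewrite subr_ge0.
  have := lerD (ler_wpM2l X1' h2) (ler_wpM2l X0 h3).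
  by rewrite -mulrDl subrK mul1r.
rewrite /Kunit; lra.
Qed.

End UnitSquare2.

(** * Scaled tensor products as test functions on Omega *)

Section TensorTest.
Context {R : realType}.
Variables (J L : nat -> R -> R) (jJ : jet J) (jL : jet L) (x0 y0 hx hy : R).

Definition tensor (a b : R -> R) (z : R * R) : R := a ((z.1 - x0) / hx) * b ((z.2 - y0) / hy).

Lemma drv_rescale (j : nat -> R -> R) (c h t : R) n : jet j ->
  is_derive t 1 (fun s => j n ((s - c) / h)) (h^-1 * j n.+1 ((t - c) / h)).
Proof.
move=> jj; rewrite (_ : (t - c) / h = h^-1 * t + - c / h); last by ring.
have h1 := drv_affine (jj n (h^-1 * t + - c / h)).
by rewrite (_ : (fun _ => _) = (fun s => j n (h^-1 * s + - c / h)))//; apply/funext => s; congr j; ring.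
Qed.

(** Each [true] differentiates the x-factor and each [false] the y-factor, so only their numbers
    matter and not their order. *)
Lemma iterpd_tensor ds i j : iterpd ds (tensor (J i) (L j)) =
  (fun z => hx^-1 ^+ count id ds * hy^-1 ^+ count negb ds *
            tensor (J (i + count id ds)) (L (j + count negb ds)) z).
Proof.
elim: ds => [|d ds ih]; first by apply/funext => z /=; rewrite !expr0 !mul1r !addn0.
apply/funext => z; rewrite [LHS]/= ih /pd /tensor; case: d => /=; rewrite derive1E.
- have := drvZ (hx^-1 ^+ count id ds * hy^-1 ^+ count negb ds)
   (drvM (drv_rescale x0 hx z.1 (i + count id ds) jJ) (drv_cst (L (j + count negb ds) ((z.2 - y0) / hy)) z.1)).
  by move=> [_ ->]; rewrite add1n exprS addnS mulr0 addr0; ring.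
- have := drvZ (hx^-1 ^+ count id ds * hy^-1 ^+ count negb ds)
   (drvM (drv_cst (J (i + count id ds) ((z.1 - x0) / hx)) z.2) (drv_rescale y0 hy z.2 (j + count negb ds) jL)).
  by move=> [_ ->]; rewrite add1n exprS addnS mul0r add0r; ring.
Qed.

Lemma tensor_continuous (a b : R -> R) : continuous a -> continuous b -> continuous (tensor a b).
Proof.
move=> ca cb z; rewrite /tensor; apply: cvgM.
- apply: (@cvg_comp _ _ _ (fun z : R * R => (z.1 - x0) / hx) a); last exact: ca.
  apply: cvgM; last exact: cvg_cst.
  by apply: cvgB; [exact: cvg_fst|exact: cvg_cst].
- apply: (@cvg_comp _ _ _ (fun z : R * R => (z.2 - y0) / hy) b); last exact: cb.
  apply: cvgM; last exact: cvg_cst.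
  by apply: cvgB; [exact: cvg_snd|exact: cvg_cst].
Qed.

Lemma tensor_smooth : smooth (tensor (J 0) (L 0)).
Proof.
move=> ds; rewrite iterpd_tensor; split.
  move=> z; apply: cvgM; first exact: cvg_cst.
  by apply: tensor_continuous; exact: jet_continuous.
move=> z; split=> /=; rewrite /tensor /=.
- have := drvZ (hx^-1 ^+ count id ds * hy^-1 ^+ count negb ds)
   (drvM (drv_rescale x0 hx z.1 (0 + count id ds) jJ) (drv_cst (L (0 + count negb ds) ((z.2 - y0) / hy)) z.1)).
  by move=> [].
- have := drvZ (hx^-1 ^+ count id ds * hy^-1 ^+ count negb ds)
   (drvM (drv_cst (J (0 + count id ds) ((z.1 - x0) / hx)) z.2) (drv_rescale y0 hy z.2 (0 + count negb ds) jL)).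
  by move=> [].
Qed.

Lemma tensor_test a1 b1 a2 b2 : 0 < hx -> 0 < hy ->
  a1 <= x0 -> x0 + hx <= b1 -> a2 <= y0 -> y0 + hy <= b2 ->
  supp01 (J 0%N) -> supp01 (L 0%N) ->
  test_fun (Omega a1 b1 a2 b2) (tensor (J 0) (L 0)).
Proof.
move=> hx0 hy0 ax xb ay yb [lo [hi [lo0 hi1 J0]]] [lo' [hi' [lo'0 hi'1 L0]]].
split; first exact: tensor_smooth.
exists (`[x0 + lo * hx, x0 + hi * hx]%classic `*` `[y0 + lo' * hy, y0 + hi' * hy]%classic).
split.
- by apply: compact_setX; exact: segment_compact.
- move=> z [] /=; rewrite !in_itv /= => /andP[z1 z1'] /andP[z2 z2'].
  have h1 : 0 < lo * hx by rewrite mulr_gt0.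
  have h2 : 0 < lo' * hy by rewrite mulr_gt0.
  have h3 : hi * hx < hx by rewrite -[ltRHS]mul1r ltr_pM2r.
  have h4 : hi' * hy < hy by rewrite -[ltRHS]mul1r ltr_pM2r.
  by split; apply/andP; split; lra.
- move=> z nz; rewrite /tensor.
  have [h|h] := boolP (((z.1 - x0) / hx < lo) || (hi < (z.1 - x0) / hx)).
    by rewrite J0// mul0r.
  have [h'|h'] := boolP (((z.2 - y0) / hy < lo') || (hi' < (z.2 - y0) / hy)).
    by rewrite L0// mulr0.
  exfalso; apply: nz; move: h h'; rewrite !negb_or -!leNgt !ler_pdivlMr// !ler_pdivrMr//.
  by move=> /andP[? ?] /andP[? ?]; split; rewrite /= in_itv /=; apply/andP; split; lra.
Qed.

Lemma Dalpha_tensor i j : 0 < hx -> 0 < hy -> forall z,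
  tensor (J i) (L j) z = hx ^+ i * hy ^+ j * Dalpha i j (tensor (J 0) (L 0)) z.
Proof.
move=> hx0 hy0 z; rewrite /Dalpha iterpd_tensor !count_cat !count_nseq /=.
rewrite !mul1n !mul0n addn0 !add0n mulrA.
rewrite [X in _ = X * _](_ : _ = (hx * hx^-1) ^+ i * (hy * hy^-1) ^+ j); last by rewrite !exprMn; ring.
by rewrite !divff ?gt_eqF// !expr1n !mul1r.
Qed.

End TensorTest.

(** * Measures of rectangles and integrals of products *)

Section PlaneMeasure.
Context {R : realType}.
Local Notation leb := (@lebesgue_measure R).
Local Notation mu2 := (@mu2 R).
Local Notation pT := (measurableTypeR R * measurableTypeR R)%type.

Lemma OmegaE (a1 b1 a2 b2 : R) :
  Omega a1 b1 a2 b2 = `]a1, b1[%classic `*` `]a2, b2[%classic.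
Proof. by apply/seteqP; split => z /=; rewrite !in_itv. Qed.

Lemma OmegabarE (a1 b1 a2 b2 : R) :
  Omegabar a1 b1 a2 b2 = `[a1, b1]%classic `*` `[a2, b2]%classic.
Proof. by apply/seteqP; split => z /=; rewrite !in_itv. Qed.

Lemma measurable_Omega (a1 b1 a2 b2 : R) : measurable (Omega a1 b1 a2 b2 : set pT).
Proof. by rewrite OmegaE; apply: measurableX. Qed.

Lemma measurable_Omegabar (a1 b1 a2 b2 : R) : measurable (Omegabar a1 b1 a2 b2 : set pT).
Proof. by rewrite OmegabarE; apply: measurableX. Qed.

Lemma mu2_Omega (a1 b1 a2 b2 : R) : a1 <= b1 -> a2 <= b2 ->
  mu2 (Omega a1 b1 a2 b2) = ((b1 - a1) * (b2 - a2))%:E.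
Proof.
move=> ab1 ab2; rewrite OmegaE.
transitivity (leb `]a1, b1[%classic * leb `]a2, b2[%classic)%E; first exact: product_measure1E.
rewrite !lebesgue_measure_itv /= !lte_fin.
move: ab1 ab2; rewrite !le_eqVlt => /predU1P[->|ab1] /predU1P[->|ab2];
 rewrite ?ltxx ?subrr ?mul0r ?mulr0 ?mul0e ?mule0//.
by rewrite ab1 ab2 -!EFinB -EFinM.
Qed.

Lemma mu2_Omegabar (a1 b1 a2 b2 : R) : a1 <= b1 -> a2 <= b2 ->
  mu2 (Omegabar a1 b1 a2 b2) = ((b1 - a1) * (b2 - a2))%:E.
Proof.
move=> ab1 ab2; rewrite OmegabarE.
transitivity (leb `[a1, b1]%classic * leb `[a2, b2]%classic)%E; first exact: product_measure1E.
rewrite !lebesgue_measure_itv /= !lte_fin.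
move: ab1 ab2; rewrite !le_eqVlt => /predU1P[->|ab1] /predU1P[->|ab2];
 rewrite ?ltxx ?subrr ?mul0r ?mulr0 ?mul0e ?mule0//.
by rewrite ab1 ab2 -!EFinB -EFinM.
Qed.

Lemma measurable_cont (f : R -> R) : continuous f -> measurable_fun (setT : set (measurableTypeR R)) f.
Proof. exact: continuous_measurable_fun. Qed.

Lemma measurable_tensor (x0 y0 hx hy : R) a b : continuous a -> continuous b ->
  measurable_fun (setT : set pT) (tensor x0 y0 hx hy a b).
Proof.
move=> ca cb; rewrite /tensor; apply: measurable_funM.
- apply: (@measurableT_comp _ _ _ _ _ _ a); first exact: measurable_cont.
  apply: measurable_funM => //; apply: measurable_funB => //; exact: measurable_fst.
- apply: (@measurableT_comp _ _ _ _ _ _ b); first exact: measurable_cont.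
  apply: measurable_funM => //; apply: measurable_funB => //; exact: measurable_snd.
Qed.

Lemma integral_supp_FTC (f F : R -> R) (x y : R) : x < y -> continuous f ->
  (forall t : R, is_derive t 1 F (f t)) -> (forall t, t < x \/ y < t -> f t = 0) ->
  (\int[leb]_t (f t)%:E = (F y - F x)%:E)%E.
Proof.
move=> xy cf dF f0.
rewrite EFinB -(@continuous_FTC2 R f F x y xy).
- rewrite [RHS]integral_mkcond; apply: eq_integral => t _; rewrite patchE.
  case: ifPn => // /negP; rewrite inE /= in_itv /= => /negP; rewrite negb_and -!ltNge.
  by move=> /orP[h|h]; rewrite f0//; [left|right].
- exact: continuous_subspaceT.
- have cF : continuous F by move=> t; exact: drv_continuous (dF t).
  split; first by move=> t _; have [] := dF t.
    exact: cvg_at_right_filter (cF x).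
  exact: cvg_at_left_filter (cF y).
- by move=> t _; rewrite derive1E; have [_ ->] := dF t.
Qed.

Lemma integrable_supp (f : R -> R) (x y : R) : continuous f ->
  (forall t, t < x \/ y < t -> f t = 0) -> leb.-integrable setT (EFin \o f).
Proof.
move=> cf f0.
have h : leb.-integrable `[x, y] (EFin \o f).
  by apply: continuous_compact_integrable; [exact: segment_compact|exact: continuous_subspaceT].
have mI : measurable (`[x, y]%classic : set (measurableTypeR R)) by exact: measurable_itv.
move/(integrable_mkcond _ mI): h.
apply: eq_integrable => // t _; rewrite patchE.
case: ifPn => // /negP; rewrite inE /= in_itv /= => /negP; rewrite negb_and -!ltNge.
by move=> /orP[k|k]; rewrite /= f0//; [left|right].
Qed.

Lemma integral_prod (f g : R -> R) x y x' y' (I I' : R) :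
  continuous f -> continuous g ->
  (forall t, t < x \/ y < t -> f t = 0) -> (forall t, t < x' \/ y' < t -> g t = 0) ->
  (\int[leb]_t (f t)%:E = I%:E)%E -> (\int[leb]_t (g t)%:E = I'%:E)%E ->
  (\int[mu2]_z (f z.1 * g z.2)%:E = (I * I')%:E)%E.
Proof.
move=> cf cg f0 g0 iI iI'.
have if_ := integrable_supp cf f0; have ig_ := integrable_supp cg g0.
have mfg : measurable_fun (setT : set pT) (fun z => f z.1 * g z.2).
  apply: measurable_funM.
    by apply: (@measurableT_comp _ _ _ _ _ _ f); [exact: measurable_cont|exact: measurable_fst].
  by apply: (@measurableT_comp _ _ _ _ _ _ g); [exact: measurable_cont|exact: measurable_snd].
have int : mu2.-integrable setT (fun z : pT => (f z.1 * g z.2)%:E).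
  apply/(integrable12ltyP leb leb); first exact/measurable_EFinP.
  under eq_integral => s _.
    under eq_integral => t _ do rewrite /= normrM EFinM.
    rewrite ge0_integralZl//; last first.
      by apply/measurable_EFinP; apply: measurableT_comp => //; exact: measurable_cont.
    over.
  have /integrableP[_ h1] := if_; have /integrableP[_ h2] := ig_.
  rewrite /= in h1 h2.
  rewrite ge0_integralZr//; first last.
  - exact: integral_ge0.
  - by apply/measurable_EFinP; apply: measurableT_comp => //; exact: measurable_cont.
  apply: lte_mul_pinfty => //; first exact: integral_ge0.
  by rewrite ge0_fin_numE//; exact: integral_ge0.
rewrite -(integral12_prod_meas1 int) /fubini_F /=.
under eq_integral => s _.
  under eq_integral => t _ do rewrite EFinM.
  rewrite integralZl// iI'; over.
by rewrite integralZr// iI -EFinM.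
Qed.

End PlaneMeasure.

(** * Pairing a function with tensor kernels carried by a cell *)

Section Pairing.
Context {R : realType}.
Local Notation leb := (@lebesgue_measure R).
Local Notation mu2 := (@mu2 R).
Local Notation pT := (measurableTypeR R * measurableTypeR R)%type.
Variables (a1 b1 a2 b2 : R).
Local Notation D := (Omega a1 b1 a2 b2).
Local Notation Dbar := (Omegabar a1 b1 a2 b2).
Implicit Types (f g u : R * R -> R) (a b : R -> R) (M N X Y e t : R).

Lemma within_continuous_eps (A : set (R * R)) f z0 (eta : R) :
  {within A, continuous f} -> A z0 -> 0 < eta ->
  exists2 d : R, 0 < d & forall z, A z -> `|z.1 - z0.1| < d -> `|z.2 - z0.2| < d ->
    `|f z - f z0| < eta.
Proof.
move=> /subspace_continuousP h Az0 eta0.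
have /cvgrPdist_lt /(_ _ eta0) := h z0 Az0.
move=> /nbhs_ballP [d /= d0 hd]; exists d => // z Az z1 z2.
rewrite distrC; apply: hd => //.
by split; rewrite /ball /= distrC.
Qed.

Lemma Omega_sub : D `<=` Dbar.
Proof. by move=> z [/andP[? ?] /andP[? ?]]; split; apply/andP; split; apply: ltW. Qed.

Lemma continuous_bounded_Omegabar f : {within Dbar, continuous f} ->
  exists2 M, 0 <= M & forall z, Dbar z -> `|f z| <= M.
Proof.
move=> cf; have : compact (f @` Dbar).
  apply: continuous_compact => //; rewrite OmegabarE.
  by apply: compact_setX; exact: segment_compact.
move/compact_bounded => [M [_ HM]]; exists (`|M| + 1); first by rewrite addr_ge0.
move=> z Dz; apply: (HM (`|M| + 1)); first by rewrite (le_lt_trans (ler_norm _))// ltrDl.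
by exists z.
Qed.

Lemma bounded_near_ex (A : set pT) f M : (forall z, A z -> `|f z| <= M) -> [bounded f x | x in A].
Proof.
move=> h; exists M; split; first exact: num_real.
by move=> N MN z Az; apply: (le_trans (h z Az)); apply: ltW.
Qed.

Definition intD f := mu2.-integrable (D : set pT) (EFin \o f).

Lemma mu2_D_lty : (mu2 (D : set pT) < +oo)%E.
Proof.
apply: (@le_lt_trans _ _ (mu2 (Omega (Num.min a1 b1) (Num.max a1 b1) (Num.min a2 b2) (Num.max a2 b2) : set pT))).
  apply: le_measure; rewrite ?inE; [exact: measurable_Omega|exact: measurable_Omega|].
  move=> z [/andP[z1 z2] /andP[z3 z4]].
  by split; rewrite gt_min lt_max ?z1 ?z2 ?z3 ?z4 ?orbT.
by rewrite mu2_Omega ?ltry// ge_min le_max lexx.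
Qed.

Lemma bounded_intD f M : measurable_fun (D : set pT) f -> (forall z, D z -> `|f z| <= M) -> intD f.
Proof.
move=> mf h; apply: measurable_bounded_integrable => //.
- exact: measurable_Omega.
- exact: mu2_D_lty.
- exact: bounded_near_ex h.
Qed.

Lemma intD_mul f (h : R * R -> R) M : intD f -> measurable_fun (D : set pT) h ->
  (forall z, D z -> `|h z| <= M) -> intD (fun z => f z * h z).
Proof.
move=> jf mh hM; rewrite /intD.
rewrite (_ : EFin \o _ = ((EFin \o f) \* (EFin \o h))%E); last by apply/funext => z /=; rewrite EFinM.
by apply: integrableMl => //; [exact: measurable_Omega|exact: bounded_near_ex hM].
Qed.

Variables (x0 y0 hx hy : R) (hx0 : 0 < hx) (hy0 : 0 < hy).
Hypotheses (ax : a1 <= x0) (xb : x0 + hx <= b1) (ay : a2 <= y0) (yb : y0 + hy <= b2).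
Local Notation K := (Omega x0 (x0 + hx) y0 (y0 + hy)).
Local Notation ten := (tensor x0 y0 hx hy).

Local Ltac geo := move: (hx0) (hy0) (ax) (xb) (ay) (yb) => ? ? ? ? ? ?.

Lemma K_sub : K `<=` D.
Proof.
geo; by move=> [s t] [/= /andP[? ?] /andP[? ?]]; split; apply/andP; split => /=; lra.
Qed.

Lemma intD_tensor f a b : intD f -> tame a -> tame b -> intD (fun z => f z * ten a b z).
Proof.
move=> jf [ca [M HM]] [cb [N HN]]; apply: (@intD_mul _ _ (M * N)) => //.
  apply: (@measurable_funS _ _ _ _ setT) => //; exact: measurable_tensor.
by move=> z _; rewrite /tensor normrM ler_pM.
Qed.

(** The pairing of the pull-back of [f] to the unit square; the prefactor is the Jacobian.
    Integrating over Omega instead of K matches the definition of weak derivatives, and the kernels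
    in use vanish outside K. *)
Definition pairK f a b : R := (hx * hy)^-1 * Rintegral mu2 (D : set pT) (fun z => f z * ten a b z).

Lemma pairK_linl f a a' b c : intD f -> tame a -> tame a' -> tame b ->
  pairK f (fun t => c * a t + a' t) b = c * pairK f a b + pairK f a' b.
Proof.
move=> jf ta ta' tb; rewrite /pairK mulrCA -mulrDr; congr (_ * _).
rewrite -RintegralZl; [|exact: measurable_Omega|exact: intD_tensor].
rewrite -RintegralD; [|exact: measurable_Omega| |exact: intD_tensor].
  by apply: eq_Rintegral => z _; rewrite /tensor; ring.
rewrite (_ : EFin \o _ = (fun z => c%:E * (f z * ten a b z)%:E)%E); last by apply/funext => z /=; rewrite EFinM.
by apply: integrableZl; [exact: measurable_Omega|exact: intD_tensor].
Qed.

Lemma pairK_linr f a b b' c : intD f -> tame a -> tame b -> tame b' ->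
  pairK f a (fun t => c * b t + b' t) = c * pairK f a b + pairK f a b'.
Proof.
move=> jf ta tb tb'; rewrite /pairK mulrCA -mulrDr; congr (_ * _).
rewrite -RintegralZl; [|exact: measurable_Omega|exact: intD_tensor].
rewrite -RintegralD; [|exact: measurable_Omega| |exact: intD_tensor].
  by apply: eq_Rintegral => z _; rewrite /tensor; ring.
rewrite (_ : EFin \o _ = (fun z => c%:E * (f z * ten a b z)%:E)%E); last by apply/funext => z /=; rewrite EFinM.
by apply: integrableZl; [exact: measurable_Omega|exact: intD_tensor].
Qed.

Definition L1K f : R := Rintegral mu2 (K : set pT) (fun z => `|f z|).

Lemma L1K_ge0 f : 0 <= L1K f. Proof. exact: Rintegral_ge0. Qed.

(** The support conditions confine the integral to K, where the test function is at most [M * N]. *)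
Lemma pairK_le f a b M N : intD f -> tame a -> tame b -> 0 <= M -> 0 <= N ->
  (forall t, `|a t| <= M) -> (forall t, `|b t| <= N) ->
  (forall t, (t <= 0) || (1 <= t) -> a t = 0) -> (forall t, (t <= 0) || (1 <= t) -> b t = 0) ->
  `|pairK f a b| <= M * N * ((hx * hy)^-1 * L1K f).
Proof.
move=> jf ta tb M0 N0 aM bN a0 b0.
rewrite /pairK normrM (ger0_norm (_ : 0 <= (hx * hy)^-1)); last by rewrite invr_ge0 mulr_ge0// ltW.
rewrite [leRHS]mulrCA; apply: ler_wpM2l; first by rewrite invr_ge0 mulr_ge0// ltW.
have mD := @measurable_Omega R a1 b1 a2 b2; have mK := @measurable_Omega R x0 (x0 + hx) y0 (y0 + hy).
have jK : mu2.-integrable (K : set pT) (EFin \o (fun z => `|f z|)).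
  exact: (integrableS mD mK K_sub (integrable_norm jf)).
apply: (le_trans (le_normr_Rintegral mD (intD_tensor jf ta tb))).
have jZ : mu2.-integrable (K : set pT) (EFin \o (fun z => M * N * `|f z|)).
  rewrite (_ : EFin \o _ = (fun z : pT => (M * N)%:E * (`|f z|)%:E)%E); last first.
    by apply/funext => z /=; rewrite EFinM.
  exact: integrableZl.
rewrite /L1K -RintegralZl//.
rewrite (_ : Rintegral _ (K : set pT) _ =
  Rintegral mu2 (D : set pT) ((fun z => M * N * `|f z|) \_ K)); last first.
  by rewrite -Rintegral_mkcondr setIidr//; exact: K_sub.
apply: le_Rintegral => //.
- by apply: integrable_norm; exact: intD_tensor.
- rewrite -restrict_EFin; apply/(integrable_restrict _ mK mD).
  by rewrite setIidr//; exact: K_sub.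
- move=> z Dz; case: ifPn => [|nK].
    by move=> _; rewrite normrM mulrC ler_wpM2r// /tensor normrM ler_pM.
  suff -> : ten a b z = 0 by rewrite mulr0 normr0.
  rewrite /tensor.
  have [h|h] := boolP (((z.1 - x0) / hx <= 0) || (1 <= (z.1 - x0) / hx)); first by rewrite a0// mul0r.
  have [h'|h'] := boolP (((z.2 - y0) / hy <= 0) || (1 <= (z.2 - y0) / hy)); first by rewrite b0// mulr0.
  exfalso; move/negP: nK; apply; rewrite inE.
  move: h h'; rewrite !negb_or -!ltNge !ltr_pdivlMr// !ltr_pdivrMr//.
  by move=> /andP[? ?] /andP[? ?]; split; apply/andP; split; geo; lra.
Qed.

(** The definition of the weak derivative, tested with the undifferentiated tensor; each derivative
    in unit coordinates is a physical one times [hx] or [hy]. *)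
Lemma weak_pairK m p u (g : nat -> nat -> R * R -> R) i j (J L : nat -> R -> R) :
  weak_derivs D m p u g -> intD u -> intD (g i j) -> (i + j <= m)%N ->
  jet J -> jet L -> supp01 (J 0%N) -> supp01 (L 0%N) ->
  pairK u (J i) (L j) = (-1) ^+ (i + j) * (hx ^+ i * hy ^+ j) * pairK (g i j) (J 0%N) (L 0%N).
Proof.
move=> [_ _ wd] ju jg ijm jJ jL sJ sL; have [_ _ h] := wd i j ijm.
have tf := tensor_test jJ jL hx0 hy0 ax xb ay yb sJ sL.
have mD := @measurable_Omega R a1 b1 a2 b2.
have {h} := h _ tf.
have e1 : (\int[mu2]_(z in (D : set pT)) (u z * Dalpha i j (ten (J 0%N) (L 0%N)) z)%:E =
   ((hx ^+ i * hy ^+ j)^-1)%:E * \int[mu2]_(z in (D : set pT)) (u z * ten (J i) (L j) z)%:E)%E.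
  rewrite -integralZl//; last by apply: intD_tensor => //; exact: jet_tame.
  apply: eq_integral => z _; rewrite -EFinM; congr EFin.
  rewrite (Dalpha_tensor jJ jL x0 y0 i j hx0 hy0).
  by rewrite [u z * (_ * _)]mulrCA mulKf// mulf_neq0// expf_neq0// gt_eqF.
move=> e2.
have {e2} e3 : (((hx ^+ i * hy ^+ j)^-1)%:E * \int[mu2]_(z in (D : set pT)) (u z * ten (J i) (L j) z)%:E =
   ((-1) ^+ (i + j))%:E * \int[mu2]_(z in (D : set pT)) (g i j z * ten (J 0%N) (L 0%N) z)%:E)%E.
  by rewrite -e1; exact: e2.
have f1 : (\int[mu2]_(z in (D : set pT)) (u z * ten (J i) (L j) z)%:E)%E \is a fin_num.
  by apply: integrable_fin_num => //; apply: intD_tensor => //; exact: jet_tame.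
have f2 : (\int[mu2]_(z in (D : set pT)) (g i j z * ten (J 0%N) (L 0%N) z)%:E)%E \is a fin_num.
  by apply: integrable_fin_num => //; apply: intD_tensor => //; exact: jet_tame.
have := congr1 fine e3; rewrite !fineM//= => e4.
rewrite /pairK /Rintegral mulrCA; congr (_ * _).
rewrite mulrAC -e4 mulrAC mulVf ?mul1r// mulf_neq0// expf_neq0// gt_eqF//.
Qed.

Lemma at0_pt_le X e t : 0 < e -> `|at_ 0 X e t| <= 4 / e * tpM.
Proof.
move=> e0; rewrite /at_ expr0 mul1r addn0 /kap normrM.
have -> : (e / 4) ^+ 2 * (e / 4)^-1 ^+ 3 = 4 / e by field; rewrite gt_eqF.
rewrite ger0_norm; last by rewrite divr_ge0// ltW.
rewrite ler_wpM2l//; first by rewrite divr_ge0// ltW.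
have := @tp_le R 3 ((ctr e X - t) / (e / 4)) isT; rewrite [tpow 3 _]/tpow/= normr0 addr0; lra.
Qed.

Lemma at0_supp X e t : 0 < e -> t < ctr e X - e / 4 \/ ctr e X < t -> at_ 0 X e t = 0.
Proof.
move=> e0; have e4 : 0 < e / 4 by rewrite divr_gt0.
by move=> [h|h]; rewrite /at_ addn0; [rewrite kap_left// /tpow /= mulr0|rewrite kap_right// mulr0].
Qed.

Lemma ctr_bounds X e : 0 < e -> e < 1 -> 0 <= X <= 1 ->
  [/\ e / 4 <= ctr e X - e / 4, ctr e X <= 1 - e / 2 & `|ctr e X - X| <= e / 2].
Proof.
move=> e0 e1 /andP[X0 X1]; rewrite /ctr.
have h1 : 0 <= (1 - e) * X by rewrite mulr_ge0// subr_ge0 ltW.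
have h2 : (1 - e) * X <= 1 - e by rewrite ler_piMr// subr_ge0 ltW.
have h3 : 0 <= e * X by rewrite mulr_ge0// ltW.
have h4 : e * X <= e by rewrite ler_piMr// ltW.
by split; rewrite ?ler_norml; lra.
Qed.

Lemma at0_jet X e : 0 < e -> jet (fun m t => (-1) ^+ m * kap (e / 4) (ctr e X) (3 + m) t).
Proof.
move=> e0 m t; rewrite addnS exprS mulN1r mulNr -mulrN.
by apply: drvZ; apply: kap_drv; rewrite divr_gt0.
Qed.

Lemma at0_supp01 X e : 0 < e -> e < 1 -> 0 <= X <= 1 -> supp01 (at_ 0 X e).
Proof.
move=> e0 e1 X01; have [h1 h2 _] := ctr_bounds e0 e1 X01.
exists (e / 8), (1 - e / 8); split; [by rewrite divr_gt0|lra|].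
by move=> t /orP[h|h]; rewrite at0_supp//; [left|right]; lra.
Qed.

(** Masses are read off from antiderivatives, which for these kernels are kernels of lower order. *)
Lemma pairK1_mass a b (A B : R -> R) : continuous a -> continuous b ->
  (forall t, is_derive t 1 A (a t)) -> (forall t, is_derive t 1 B (b t)) ->
  (forall t, (t <= 0) || (1 <= t) -> a t = 0) -> (forall t, (t <= 0) || (1 <= t) -> b t = 0) ->
  pairK (fun=> 1) a b = (A 1 - A 0) * (B 1 - B 0).
Proof.
move=> ca cb dA dB a0 b0.
have mass1 (c h : R) (w W : R -> R) : 0 < h -> continuous w -> (forall t, is_derive t 1 W (w t)) ->
    (forall t, (t <= 0) || (1 <= t) -> w t = 0) ->
    [/\ continuous (fun s => w ((s - c) / h)),
     (forall t, t < c \/ c + h < t -> w ((t - c) / h) = 0) &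
     (\int[leb]_t (w ((t - c) / h))%:E = (h * (W 1 - W 0))%:E)%E].
  move=> h0 cw dW w0.
  have supp t : t < c \/ c + h < t -> w ((t - c) / h) = 0.
    move=> [th|th]; apply: w0.
      by rewrite pmulr_lle0 ?invr_gt0// subr_le0 ltW.
    by rewrite ler_pdivlMr// mul1r lerBrDl (ltW th) orbT.
  have cc : continuous (fun s => w ((s - c) / h)).
    move=> s; apply: (@cvg_comp _ _ _ (fun s : R => (s - c) / h) w); last exact: cw.
    by apply: cvgM; [apply: cvgB; [exact: cvg_id|exact: cvg_cst]|exact: cvg_cst].
  split=> //.
  pose F s := h * W ((s - c) / h).
  have dF (t : R) : is_derive t 1 F (w ((t - c) / h)).
    have e t' : (t' - c) / h = h^-1 * t' + - c / h by rewrite mulrBl mulrC mulNr.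
    have d1 : is_derive (h^-1 * t + - c / h) 1 W (w ((t - c) / h)) by rewrite e; exact: dW.
    have := drvZ h (drv_affine d1); rewrite (_ : (fun _ => _) = F); last first.
      by apply/funext => s; rewrite /F e.
    by move=> /is_derive_eq; apply; rewrite mulrA divff ?mul1r// gt_eqF.
  have cch : c < c + h by rewrite ltrDl.
  rewrite (integral_supp_FTC cch cc dF supp) /F; congr EFin.
  by rewrite subrr mul0r [c + h]addrC addrK divff ?gt_eqF// mulrBr.
have [c1 s1 i1] := mass1 x0 hx a A hx0 ca dA a0.
have [c2 s2 i2] := mass1 y0 hy b B hy0 cb dB b0.
rewrite /pairK /Rintegral.
under eq_integral do rewrite mul1r.
rewrite (_ : (\int[_]_(z in _) _)%E = (hx * (A 1 - A 0) * (hy * (B 1 - B 0)))%:E) /=.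
  by field; rewrite !gt_eqF.
rewrite -(integral_prod c1 c2 s1 s2 i1 i2) integral_mkcond.
apply: eq_integral => z _; rewrite patchE; case: ifPn => // /negP; rewrite inE => nD.
have [h|h] := boolP (((z.1 - x0) / hx <= 0) || (1 <= (z.1 - x0) / hx)); first by rewrite a0// mul0r.
have [h'|h'] := boolP (((z.2 - y0) / hy <= 0) || (1 <= (z.2 - y0) / hy)); first by rewrite b0// mulr0.
exfalso; apply: nD; apply: K_sub.
move: h h'; rewrite !negb_or -!ltNge !ltr_pdivlMr// !ltr_pdivrMr//.
by move=> /andP[? ?] /andP[? ?]; split; apply/andP; split; geo; lra.
Qed.

Lemma kap_drvN (w X t : R) n : 0 < w -> is_derive t 1 (fun s => - kap w X n s) (kap w X n.+1 t).
Proof.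
move=> w0; have := drvZ (-1) (kap_drv X n t w0).
by rewrite mulN1r opprK (_ : (fun _ => _) = (fun s => - kap w X n s))//; apply/funext => s; rewrite mulN1r.
Qed.

Lemma at0_prod_mass X Y e : 0 < e -> e < 1 -> 0 <= X <= 1 -> 0 <= Y <= 1 ->
  pairK (fun=> 1) (at_ 0 X e) (at_ 0 Y e) = 1.
Proof.
move=> e0 e1 X01 Y01; have e4 : 0 < e / 4 by rewrite divr_gt0.
have [h1 h2 _] := ctr_bounds e0 e1 X01; have [h3 h4 _] := ctr_bounds e0 e1 Y01.
have dA (Z : R) (t : R) : is_derive t 1 (fun s => - kap (e / 4) (ctr e Z) 2 s) (at_ 0 Z e t).
  by rewrite /at_ expr0 mul1r addn0; exact: kap_drvN.
rewrite (pairK1_mass (at_tame 0 X e0).1 (at_tame 0 Y e0).1 (dA X) (dA Y)).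
- rewrite !(kap_right _ (t := 1))//; [|lra|lra].
  by rewrite !kap_left//; [rewrite /tpow/=; ring|lra|lra].
- by move=> t /orP[t0|t1]; apply: at0_supp => //; [left|right]; lra.
- by move=> t /orP[t0|t1]; apply: at0_supp => //; [left|right]; lra.
Qed.

End Pairing.

(** * Recovery of point values as the width tends to 0 *)

Section PairingLimits.
Context {R : realType}.
Local Notation mu2 := (@mu2 R).
Local Notation pT := (measurableTypeR R * measurableTypeR R)%type.
Variables (a1 b1 a2 b2 : R).
Local Notation D := (Omega a1 b1 a2 b2).
Local Notation Dbar := (Omegabar a1 b1 a2 b2).
Implicit Types (f g u : R * R -> R) (a b : R -> R) (M N X Y e t : R).
Local Notation intD := (intD a1 b1 a2 b2).
Variables (x0 y0 hx hy : R) (hx0 : 0 < hx) (hy0 : 0 < hy).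
Hypotheses (ax : a1 <= x0) (xb : x0 + hx <= b1) (ay : a2 <= y0) (yb : y0 + hy <= b2).
Local Notation ten := (tensor x0 y0 hx hy).
Local Notation pairK := (pairK a1 b1 a2 b2 x0 y0 hx hy).
Local Ltac geo := move: (hx0) (hy0) (ax) (xb) (ay) (yb) => ? ? ? ? ? ?.

(** Since the kernels change sign, the bound is sup norm times area of the support. The smallness of
    [f] is asked almost everywhere, as for weak derivatives without a continuous representative. *)
Lemma pairK_box_le f a b M N s s' r r' eta : intD f -> tame a -> tame b -> 0 <= M -> 0 <= N -> 0 <= eta ->
  s <= s' -> r <= r' ->
  (forall t, `|a t| <= M) -> (forall t, `|b t| <= N) ->
  (forall t, t < s \/ s' < t -> a t = 0) -> (forall t, t < r \/ r' < t -> b t = 0) ->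
  {ae mu2, forall z : pT, D z -> s <= (z.1 - x0) / hx <= s' -> r <= (z.2 - y0) / hy <= r' -> `|f z| <= eta} ->
  `|pairK f a b| <= eta * (M * N) * ((s' - s) * (r' - r)).
Proof.
move=> jf ta tb M0 N0 eta0 ss rr aM bN a0 b0 fle.
have mD := @measurable_Omega R a1 b1 a2 b2.
have jt := intD_tensor x0 y0 hx hy jf ta tb.
pose B : set pT := Omegabar (x0 + s * hx) (x0 + s' * hx) (y0 + r * hy) (y0 + r' * hy).
have mB : measurable B by exact: measurable_Omegabar.
have hB : mu2 B = (((s' - s) * (r' - r)) * (hx * hy))%:E.
  rewrite /B mu2_Omegabar; last 2 first.
  - by rewrite lerD2l ler_pM2r.
  - by rewrite lerD2l ler_pM2r.
  by congr EFin; ring.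
rewrite /pairK normrM (ger0_norm (_ : 0 <= (hx * hy)^-1)); last by rewrite invr_ge0 mulr_ge0// ltW.
rewrite mulrC ler_pdivrMr ?mulr_gt0//.
rewrite -lee_fin EFin_normr_Rintegral//.
have mt : measurable_fun (D : set pT) (fun z => f z * ten a b z).
  by apply/measurable_EFinP; exact: measurable_int jt.
apply: (le_trans (le_abse_integral _ mD _)); first exact/measurable_EFinP.
apply: (@le_trans _ _ (\int[mu2]_(z in D) ((eta * (M * N))%:E * (\1_B z)%:E))%E).
  apply: ae_ge0_le_integral => //.
  - by apply: measurableT_comp => //; apply/measurable_EFinP.
  - by move=> z _; rewrite -EFinM lee_fin mulr_ge0// mulr_ge0// mulr_ge0.
  - apply: emeasurable_funM => //; apply/measurable_EFinP; exact: measurable_indic.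
  apply: filterS fle => z hz Dz /=.
  rewrite -EFinM lee_fin.
  have [h|h] := boolP (((z.1 - x0) / hx < s) || (s' < (z.1 - x0) / hx)).
    by rewrite /tensor a0 ?mul0r ?mulr0 ?normr0; [rewrite !mulr_ge0|apply/orP].
  have [h'|h'] := boolP (((z.2 - y0) / hy < r) || (r' < (z.2 - y0) / hy)).
    by rewrite /tensor b0 ?mulr0 ?mulr0 ?normr0; [rewrite !mulr_ge0|apply/orP].
  move: h h'; rewrite !negb_or -!leNgt => k1 k2.
  have Bz : B z.
    move: k1 k2; rewrite !ler_pdivlMr// !ler_pdivrMr// => /andP[? ?] /andP[? ?].
    by split; apply/andP; split; lra.
  rewrite indicE mem_set// mulr1 normrM ler_pM//; first exact: hz.
  by rewrite /tensor normrM ler_pM.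
rewrite ge0_integralZl//; last 2 first.
- by apply/measurable_EFinP; exact: measurable_indic.
- by rewrite lee_fin !mulr_ge0.
rewrite [leRHS](_ : _ = ((eta * (M * N))%:E * mu2 B)%E); last by rewrite hB -EFinM; congr EFin; ring.
apply: lee_wpmul2l; first by rewrite lee_fin !mulr_ge0.
rewrite integral_indic//; apply: le_measure; rewrite ?inE//.
exact: measurableI.
Qed.

Lemma intD_cst (c : R) : intD (fun=> c).
Proof. exact: (@bounded_intD _ _ _ _ _ _ `|c|). Qed.

Lemma pairK_subc f a b (m : R) : intD f -> tame a -> tame b ->
  pairK (fun z => f z - m) a b = pairK f a b - m * pairK (fun=> 1) a b.
Proof.
move=> jf ta tb; have mD := @measurable_Omega R a1 b1 a2 b2.
have j1 := intD_tensor x0 y0 hx hy (intD_cst 1) ta tb.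
rewrite /pairK mulrCA -mulrBr; congr (_ * _).
rewrite -RintegralZl// -RintegralB//; last 2 first.
- exact: intD_tensor.
- by have := integrableZl mD m j1; apply: eq_integrable.
by apply: eq_Rintegral => z _; ring.
Qed.

(** The kernels have mass 1, so [f - m] is tested on a shrinking box. Height [4/e * tpM] times width
    [e/4] leaves [tpM] per direction, whence the tolerance [eta / tpM ^+ 2]. *)
Lemma pairK_cvg f X Y : intD f -> {within Dbar, continuous f} -> 0 <= X <= 1 -> 0 <= Y <= 1 ->
  pairK f (at_ 0 X e) (at_ 0 Y e) @[e --> 0^'+] --> f (x0 + hx * X, y0 + hy * Y).
Proof.
move=> jf cf X01 Y01; apply/cvgrPdist_le => eta eta0.
have C0 : 0 < (tpM : R) by apply: lt_le_trans ltr01 tpM_ge1.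
have Dz : Dbar (x0 + hx * X, y0 + hy * Y).
  have h1 : 0 <= hx * X <= hx by move: X01 => /andP[? ?]; rewrite mulr_ge0 ?ler_piMr// ltW.
  have h2 : 0 <= hy * Y <= hy by move: Y01 => /andP[? ?]; rewrite mulr_ge0 ?ler_piMr// ltW.
  by geo; split; apply/andP; split => /=; lra.
have eta0' : 0 < eta / tpM ^+ 2 by rewrite divr_gt0// exprn_gt0.
have [d d0 hd] := within_continuous_eps cf Dz eta0'.
near=> e.
have e0 : 0 < e by [].
have e1 : e < 1 by near: e; apply: nbhs_right_lt.
have ehx : hx * e < d.
  by rewrite -ltr_pdivlMl//; near: e; apply: nbhs_right_lt; rewrite mulr_gt0// invr_gt0.
have ehy : hy * e < d.
  by rewrite -ltr_pdivlMl//; near: e; apply: nbhs_right_lt; rewrite mulr_gt0// invr_gt0.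
have tX := at_tame 0 X e0; have tY := at_tame 0 Y e0.
set m := f _; rewrite distrC.
have -> : pairK f (at_ 0 X e) (at_ 0 Y e) - m = pairK (fun z => f z - m) (at_ 0 X e) (at_ 0 Y e).
  by rewrite pairK_subc// (at0_prod_mass hx0 hy0 ax xb ay yb e0 e1 X01 Y01) mulr1.
have jfm : intD (fun z => f z - m).
  have := integrableB (@measurable_Omega R a1 b1 a2 b2) jf (intD_cst m).
  by apply: eq_integrable => //; exact: measurable_Omega.
have M0 : 0 <= 4 / e * (tpM : R) by rewrite mulr_ge0 ?tpM_ge0// divr_ge0// ltW.
have [k1 k2 k3] := ctr_bounds e0 e1 X01; have [l1 l2 l3] := ctr_bounds e0 e1 Y01.
have close (c h z Z : R) : 0 < h -> h * e < d -> `|ctr e Z - Z| <= e / 2 ->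
    ctr e Z - e / 4 <= (z - c) / h <= ctr e Z -> `|z - (c + h * Z)| < d.
  move=> h0 hed; rewrite ler_norml => /andP[? ?] /andP[? ?].
  rewrite (_ : z - _ = h * ((z - c) / h - Z)); last by field; rewrite gt_eqF.
  apply: le_lt_trans hed; rewrite normrM (gtr0_norm h0) ler_pM2l// ler_norml; lra.
have -> : eta = (eta / tpM ^+ 2) * ((4 / e * tpM) * (4 / e * tpM)) *
   ((ctr e X - (ctr e X - e / 4)) * (ctr e Y - (ctr e Y - e / 4))).
  by field; rewrite !gt_eqF.
apply: pairK_box_le => //.
- exact: ltW.
- by rewrite lerBlDr lerDl divr_ge0// ltW.
- by rewrite lerBlDr lerDl divr_ge0// ltW.
- by move=> t; exact: at0_pt_le.
- by move=> t; exact: at0_pt_le.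
- by move=> t; exact: at0_supp.
- by move=> t; exact: at0_supp.
apply/nearW => z Dz' zX zY; apply/ltW/hd.
- exact: Omega_sub.
- exact: close.
- exact: close.
Unshelve. all: by end_near. Qed.

(** The factors [hx^(i-1) hy^(j-1)] are those of a derivative pulled back to the unit square and
    measured in L^1; point values of first derivatives scale by [hx] or [hy]. *)
Definition ldata u (g : nat -> nat -> R * R -> R) : local_data :=
  LocalData (pairK u) (fun i j => hx ^+ i * hy ^+ j / (hx * hy) * L1K x0 y0 hx hy (g i j))
    (fun o o' X Y => let z := (x0 + hx * X, y0 + hy * Y) in
       if (o, o') is (0%N, 0%N) then u z else if o is 0%N then hy * g 0%N 1%N z else hx * g 1%N 0%N z).

Lemma ldata_valid m p u (g : nat -> nat -> R * R -> R) : (1 <= m)%N -> weak_derivs D m p u g -> intD u ->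
  (forall i j, (i + j <= m)%N -> intD (g i j)) ->
  {within Dbar, continuous u} -> {within Dbar, continuous (g 1%N 0%N)} ->
  {within Dbar, continuous (g 0%N 1%N)} -> valid m (ldata u g).
Proof.
move=> m1 wd ju jg cu cg1 cg2; split => /= [i j|].
  by rewrite mulr_ge0 ?L1K_ge0// divr_ge0 ?mulr_ge0 ?exprn_ge0// ltW.
split => /=.
- by move=> *; exact: pairK_linl.
- by move=> *; exact: pairK_linr.
- move=> i j a b M N ijm [J [jJ sJ JM aJ]] [L [jL sL LN bL]].
  have -> : a = J i by apply/funext.
  have -> : b = L j by apply/funext.
  rewrite (weak_pairK hx0 hy0 ax xb ay yb wd ju (jg _ _ ijm) ijm jJ jL sJ sL).
  have M0 : 0 <= M by apply: le_trans (JM 0); rewrite normr_ge0.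
  have N0 : 0 <= N by apply: le_trans (LN 0); rewrite normr_ge0.
  have := pairK_le hx0 hy0 ax xb ay yb (jg _ _ ijm) (jet_tame 0 jJ sJ) (jet_tame 0 jL sL) M0 N0 JM LN.
  move=> /(_ (fun t => @jet_supp _ _ 0 t jJ sJ) (fun t => @jet_supp _ _ 0 t jL sL)) h.
  have hc : 0 <= hx ^+ i * hy ^+ j by rewrite mulr_ge0 ?exprn_ge0// ltW.
  rewrite -mulrA normrM normrX normrN1 expr1n mul1r normrM (ger0_norm hc).
  rewrite [leRHS](_ : _ = hx ^+ i * hy ^+ j * (M * N * ((hx * hy)^-1 * L1K x0 y0 hx hy (g i j)))); last by ring.
  by rewrite ler_wpM2l.
(* A derivative atom is minus the derivative of a value atom, up to the compensating factor [1 - e],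
   which tends to 1. *)
have at1E X e : at_ 1 X e =
    (fun t => - (1 - e) * ((-1) ^+ 1 * kap (e / 4) (ctr e X) (3 + 1) t) + 0).
  apply/funext => t; by rewrite /at_ !expr1 mulN1r mulrN mulNr opprK addr0.
have t0 : tame (fun=> 0 : R) := tame0.
case=> [|[|//]] [|[|//]] X Y // _ X01 Y01.
- exact: pairK_cvg.
- have gg : hy * pairK (g 0%N 1%N) (at_ 0 X e) (at_ 0 Y e) * (1 - e) @[e --> 0^'+] -->
     hy * g 0%N 1%N (x0 + hx * X, y0 + hy * Y) * (1 - 0).
    apply: cvgM; first by apply: cvgM; [exact: cvg_cst|apply: pairK_cvg => //; exact: jg].
    apply: cvgB; first exact: cvg_cst.
    exact: cvg_at_right_filter cvg_id.
  rewrite subr0 mulr1 in gg; apply: cvg_trans gg; apply: near_eq_cvg; near=> e.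
  have e0 : 0 < e by [].
  have e1 : e < 1 by near: e; apply: nbhs_right_lt.
  have sX := at0_supp01 e0 e1 X01; have sY := at0_supp01 e0 e1 Y01.
  have jX := at0_jet X e0; have jY := at0_jet Y e0.
  have sX' : supp01 (fun t => (-1) ^+ 0 * kap (e / 4) (ctr e X) (3 + 0) t) by exact: sX.
  have sY' : supp01 (fun t => (-1) ^+ 0 * kap (e / 4) (ctr e Y) (3 + 0) t) by exact: sY.
  have tX := at_tame 0 X e0.
  have tY := @jet_tame _ _ 1 jY sY'.
  rewrite at1E.
  rewrite (pairK_linr x0 y0 hx hy _ ju tX tY t0)//.
  have -> : pairK u (at_ 0 X e) (fun=> 0) = 0.
    by rewrite /pairK /Rintegral (_ : (fun _ => _) = cst 0) ?integral0 ?mulr0//; apply/funext => z; rewrite /tensor !mulr0.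
  rewrite addr0.
  have := weak_pairK hx0 hy0 ax xb ay yb wd ju (jg 0%N 1%N m1) m1 jX jY sX' sY'.
  have -> : at_ 0 X e = (fun t => (-1) ^+ 0 * kap (e / 4) (ctr e X) (3 + 0) t) by [].
  have -> : at_ 0 Y e = (fun t => (-1) ^+ 0 * kap (e / 4) (ctr e Y) (3 + 0) t) by [].
  by move=> ->; rewrite !expr1 expr0; ring.
- have gg : hx * pairK (g 1%N 0%N) (at_ 0 X e) (at_ 0 Y e) * (1 - e) @[e --> 0^'+] -->
     hx * g 1%N 0%N (x0 + hx * X, y0 + hy * Y) * (1 - 0).
    apply: cvgM; first by apply: cvgM; [exact: cvg_cst|apply: pairK_cvg => //; exact: jg].
    apply: cvgB; first exact: cvg_cst.
    exact: cvg_at_right_filter cvg_id.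
  rewrite subr0 mulr1 in gg; apply: cvg_trans gg; apply: near_eq_cvg; near=> e.
  have e0 : 0 < e by [].
  have e1 : e < 1 by near: e; apply: nbhs_right_lt.
  have sX := at0_supp01 e0 e1 X01; have sY := at0_supp01 e0 e1 Y01.
  have jX := at0_jet X e0; have jY := at0_jet Y e0.
  have sX' : supp01 (fun t => (-1) ^+ 0 * kap (e / 4) (ctr e X) (3 + 0) t) by exact: sX.
  have sY' : supp01 (fun t => (-1) ^+ 0 * kap (e / 4) (ctr e Y) (3 + 0) t) by exact: sY.
  have tY := at_tame 0 Y e0.
  have tX := @jet_tame _ _ 1 jX sX'.
  rewrite at1E.
  rewrite (pairK_linl x0 y0 hx hy _ ju tX t0 tY)//.
  have -> : pairK u (fun=> 0) (at_ 0 Y e) = 0.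
    by rewrite /pairK /Rintegral (_ : (fun _ => _) = cst 0) ?integral0 ?mulr0//; apply/funext => z; rewrite /tensor mul0r mulr0.
  rewrite addr0.
  have := weak_pairK hx0 hy0 ax xb ay yb wd ju (jg 1%N 0%N m1) m1 jX jY sX' sY'.
  have -> : at_ 0 X e = (fun t => (-1) ^+ 0 * kap (e / 4) (ctr e X) (3 + 0) t) by [].
  have -> : at_ 0 Y e = (fun t => (-1) ^+ 0 * kap (e / 4) (ctr e Y) (3 + 0) t) by [].
  by move=> ->; rewrite !expr1 expr0; ring.
Unshelve. all: by end_near. Qed.

End PairingLimits.

(** * Increments along axis-parallel segments from weak derivatives *)

Section Increments.
Context {R : realType}.
Local Notation mu2 := (@mu2 R).
Local Notation pT := (measurableTypeR R * measurableTypeR R)%type.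
Variables (a1 b1 a2 b2 : R).
Local Notation D := (Omega a1 b1 a2 b2).
Local Notation Dbar := (Omegabar a1 b1 a2 b2).
Local Notation intD := (intD a1 b1 a2 b2).
Implicit Types (f u : R * R -> R) (X Y e t : R).

(** The [m]-th derivative of a difference of two smoothed Heaviside functions, that is, of a
    smoothed indicator of [Y, Y']; for [m = 1] it is, up to sign, the difference of two point
    atoms. *)
Definition hvd Y Y' e m t : R :=
  (-1) ^+ m * kap (e / 4) (ctr e Y') (2 + m) t - (-1) ^+ m * kap (e / 4) (ctr e Y) (2 + m) t.

Lemma heaviside_diff Y Y' e : 0 < e -> e < 1 -> 0 <= Y -> Y <= Y' -> Y' <= 1 ->
  let b := hvd Y Y' e in
  jet b /\ [/\ (forall t, t < ctr e Y - e / 4 \/ ctr e Y' < t -> b 0%N t = 0),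
   supp01 (b 0%N), (forall t, `|b 0%N t| <= 2 * tpM),
   (forall t, b 1%N t = - (at_ 0 Y' e t - at_ 0 Y e t)) &
   ctr e Y <= ctr e Y'].
Proof.
move=> e0 e1 Y0 YY Y1 b; have e4 : 0 < e / 4 by rewrite divr_gt0.
have Y01 : 0 <= Y <= 1 by rewrite Y0 (le_trans YY).
have Y'01 : 0 <= Y' <= 1 by rewrite Y1 (le_trans Y0).
have [h1 h2 _] := ctr_bounds e0 e1 Y01; have [h3 h4 _] := ctr_bounds e0 e1 Y'01.
have cc : ctr e Y <= ctr e Y' by rewrite /ctr lerD2r ler_wpM2l// subr_ge0 ltW.
have s0 t : t < ctr e Y - e / 4 \/ ctr e Y' < t -> b 0%N t = 0.
  move=> [th|th]; rewrite /b /hvd !expr0 !mul1r addn0.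
    by rewrite !kap_left ?subrr// (lt_le_trans th)// lerB.
  by rewrite !kap_right ?subrr// (le_lt_trans cc).
split; last split=> //.
- have j1 (Z : R) : jet (fun m t => (-1) ^+ m * kap (e / 4) (ctr e Z) (2 + m) t).
    move=> m t; rewrite addnS exprS mulN1r mulNr -mulrN.
    by apply: drvZ; apply: kap_drv.
  move=> m t; rewrite /b /hvd -mulNr; apply: drvD; first exact: j1.
  have := drvZ (-1) (j1 Y m t); rewrite !mulN1r (_ : (fun _ => _) = (fun t => - ((-1) ^+ m * kap (e / 4) (ctr e Y) (2 + m) t))).
    by rewrite mulNr.
  by apply/funext => s; rewrite mulN1r.
- exists (e / 8), (1 - e / 8); split; [by rewrite divr_gt0|lra|].
  by move=> t /orP[h|h]; apply: s0; [left|right]; lra.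
- move=> t; have [t01|] := boolP (0 <= t <= 1).
    rewrite /b /hvd !expr0 !mul1r addn0 (le_trans (ler_normB _ _))//.
    have e41 : e / 4 <= 1 by lra.
    have := kap_le e4 e41 (leqnn 2) (_ : 0 <= ctr e Y <= 1) t01.
    have := kap_le e4 e41 (leqnn 2) (_ : 0 <= ctr e Y' <= 1) t01.
    move=> k1 k2; have := k1 _; have := k2 _; lra.
  rewrite negb_and -!ltNge => t01; rewrite s0 ?normr0 ?mulr_ge0 ?tpM_ge0//.
  by case/orP: t01 => h; [left|right]; lra.
- by move=> t; rewrite /b /hvd /at_ expr1 !expr0 !mul1r !addn0 addn1; ring.
Qed.

Lemma at0_primitive X e : 0 < e -> e < 1 -> 0 <= X <= 1 ->
  let A t := - kap (e / 4) (ctr e X) 2 t in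
  [/\ (forall t : R, is_derive t 1 A (at_ 0 X e t)), A 1 - A 0 = 1 &
      forall t, (t <= 0) || (1 <= t) -> at_ 0 X e t = 0].
Proof.
move=> e0 e1 X01; have e4 : 0 < e / 4 by rewrite divr_gt0.
have [h1 h2 _] := ctr_bounds e0 e1 X01; split.
- by move=> t; rewrite /at_ expr0 mul1r addn0; exact: kap_drvN.
- rewrite /= kap_right//; last by lra.
  by rewrite kap_left//; [rewrite /tpow/=; ring|lra].
- by move=> t /orP[t0|t1]; apply: at0_supp => //; [left|right]; lra.
Qed.

Lemma hvd_primitive Y Y' e : 0 < e -> e < 1 -> 0 <= Y -> Y <= Y' -> Y' <= 1 ->
  let B t := - kap (e / 4) (ctr e Y') 1 t + kap (e / 4) (ctr e Y) 1 t in
  [/\ (forall t : R, is_derive t 1 B (hvd Y Y' e 0 t)), B 1 - B 0 = (1 - e) * (Y' - Y) &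
      forall t, (t <= 0) || (1 <= t) -> hvd Y Y' e 0 t = 0].
Proof.
move=> e0 e1 Y0 YY Y1; have e4 : 0 < e / 4 by rewrite divr_gt0.
have [_ [b0 _ _ _ _]] := heaviside_diff e0 e1 Y0 YY Y1.
have Y01 : 0 <= Y <= 1 by rewrite Y0 (le_trans YY).
have Y'01 : 0 <= Y' <= 1 by rewrite Y1 (le_trans Y0).
have [h1 h2 _] := ctr_bounds e0 e1 Y01; have [h3 h4 _] := ctr_bounds e0 e1 Y'01.
split.
- by move=> t; rewrite /hvd !expr0 !mul1r addn0; apply: drvD; [exact: kap_drvN|exact: kap_drv].
- rewrite /= !(kap_right _ (t := 1))//; [|lra|lra].
  by rewrite !kap_left//; [rewrite /tpow/= /ctr; ring|lra|lra].
- by move=> t /orP[t0|t1]; apply: b0 => //; [left|right]; lra.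
Qed.

Lemma band_close (c h z Y Y' e d : R) : 0 < h -> h * e < d ->
  `|ctr e Y - Y| <= e / 2 -> `|ctr e Y' - Y'| <= e / 2 -> 0 < e ->
  ctr e Y - e / 4 <= (z - c) / h <= ctr e Y' -> c + h * Y - d < z < c + h * Y' + d.
Proof.
move=> h0 hed; rewrite !ler_norml => /andP[k1 k2] /andP[k3 k4] e0 /andP[z1 z2].
have [w1 w2] : Y - e < (z - c) / h /\ (z - c) / h < Y' + e by split; lra.
move: w1 w2; rewrite ltr_pdivlMr// ltr_pdivrMr// => w1 w2; apply/andP; split; lra.
Qed.

Hypotheses (ab1 : a1 < b1) (ab2 : a2 < b2).
Local Notation pairK := (pairK a1 b1 a2 b2 a1 a2 (b1 - a1) (b2 - a2)).

Lemma unit_coord (c h x : R) : 0 < h -> c <= x <= c + h ->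
  0 <= (x - c) / h <= 1 /\ c + h * ((x - c) / h) = x.
Proof.
move=> h0 /andP[x1 x2]; split.
  by rewrite divr_ge0 ?subr_ge0 ?(ltW h0)//= ler_pdivrMr// mul1r lerBlDl.
by field; rewrite gt_eqF.
Qed.

Lemma increment_y m p u (g : nat -> nat -> R * R -> R) x y y' (c eta d : R) :
  (1 <= m)%N -> weak_derivs D m p u g -> intD u -> intD (g 0%N 1%N) ->
  {within Dbar, continuous u} -> 0 <= eta -> 0 < d ->
  Dbar (x, y) -> Dbar (x, y') -> y <= y' ->
  {ae mu2, forall z : pT, D z -> `|z.1 - x| < d -> y - d < z.2 < y' + d -> `|g 0%N 1%N z - c| <= eta} ->
  `|u (x, y') - u (x, y) - c * (y' - y)| <= 2 * tpM ^+ 2 * eta * (y' - y).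
Proof.
move=> m1 wd ju jg cu eta0 d0 [/= xx yy1] [_ /= yy2] yy' hae.
have hx0 : 0 < b1 - a1 by rewrite subr_gt0.
have hy0 : 0 < b2 - a2 by rewrite subr_gt0.
have eb1 : a1 + (b1 - a1) = b1 by rewrite addrC subrK.
have eb2 : a2 + (b2 - a2) = b2 by rewrite addrC subrK.
have xb : a1 + (b1 - a1) <= b1 by rewrite eb1.
have yb : a2 + (b2 - a2) <= b2 by rewrite eb2.
have xx' : a1 <= x <= a1 + (b1 - a1) by rewrite eb1.
have yy1' : a2 <= y <= a2 + (b2 - a2) by rewrite eb2.
have yy2' : a2 <= y' <= a2 + (b2 - a2) by rewrite eb2.
have [X01 eX] := unit_coord hx0 xx'.
have [Y01 eY] := unit_coord hy0 yy1'.
have [Y'01 eY'] := unit_coord hy0 yy2'.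
have YY : (y - a2) / (b2 - a2) <= (y' - a2) / (b2 - a2).
  by rewrite ler_pM2r ?invr_gt0// lerD2r.
set X := (x - a1) / (b1 - a1) in X01 eX *.
set Y := (y - a2) / (b2 - a2) in Y01 eY YY *.
set Y' := (y' - a2) / (b2 - a2) in Y'01 eY' YY *.
pose P e := pairK u (at_ 0 X e) (at_ 0 Y' e) - pairK u (at_ 0 X e) (at_ 0 Y e).
(* The claim at width [e]: the kernels have mass [(1 - e)(Y' - Y)] and their y-support has length
   [(1 - e)(Y' - Y) + e/4], in unit coordinates. The limit [e -> 0] is the claim itself. *)
pose Q e := `|P e - c * ((b2 - a2) * ((1 - e) * (Y' - Y)))| -
   2 * tpM ^+ 2 * eta * ((b2 - a2) * ((1 - e) * (Y' - Y) + e / 4)).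
have e1c : (fun e : R => 1 - e) e @[e --> 0^'+] --> (1 - 0 : R).
  by apply: cvgB; [exact: cvg_cst|exact: cvg_at_right_filter cvg_id].
have cP : P e @[e --> 0^'+] --> u (x, y') - u (x, y).
  rewrite -eX -eY -eY'.
  by apply: cvgB; apply: pairK_cvg.
have cQ : Q e @[e --> 0^'+] --> `|u (x, y') - u (x, y) - c * ((b2 - a2) * ((1 - 0) * (Y' - Y)))|
   - 2 * tpM ^+ 2 * eta * ((b2 - a2) * ((1 - 0) * (Y' - Y) + 0 / 4)).
  apply: cvgB.
    apply: cvg_norm; apply: cvgB; first exact: cP.
    by apply: cvgM; [exact: cvg_cst|apply: cvgM; [exact: cvg_cst|apply: cvgM; [exact: e1c|exact: cvg_cst]]].
  apply: cvgM; first exact: cvg_cst; apply: cvgM; first exact: cvg_cst.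
  apply: cvgD; first by apply: cvgM; [exact: e1c|exact: cvg_cst].
  by apply: cvgM; [exact: cvg_at_right_filter cvg_id|exact: cvg_cst].
have yY : y' - y = (b2 - a2) * (Y' - Y) by rewrite -{1}eY' -{1}eY; ring.
rewrite -subr_le0; move/cvgr_to_le : cQ.
rewrite subr0 !mul1r mul0r addr0 -yY; apply.
near=> e; rewrite /Q subr_le0.
have e0 : 0 < e by [].
have e1 : e < 1 by near: e; apply: nbhs_right_lt.
have ehx : (b1 - a1) * e < d.
  by rewrite -ltr_pdivlMl//; near: e; apply: nbhs_right_lt; rewrite mulr_gt0// invr_gt0.
have ehy : (b2 - a2) * e < d.
  by rewrite -ltr_pdivlMl//; near: e; apply: nbhs_right_lt; rewrite mulr_gt0// invr_gt0.
have [Y0 _] := andP Y01; have [_ Y'1] := andP Y'01.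
have [jb [b0 sb bM b1E cYY]] := heaviside_diff e0 e1 Y0 YY Y'1.
rewrite /= in jb b0 sb bM b1E; set b := hvd Y Y' e in jb b0 sb bM b1E.
have tX := at_tame 0 X e0; have tY := at_tame 0 Y e0; have tY' := at_tame 0 Y' e0.
have tb := jet_tame 0 jb sb.
have jX := at0_jet X e0.
have [k1 k2 k3] := ctr_bounds e0 e1 X01; have [l1 l2 l3] := ctr_bounds e0 e1 Y01.
have [l1' l2' l3'] := ctr_bounds e0 e1 Y'01.
have sX' : supp01 (fun t => (-1) ^+ 0 * kap (e / 4) (ctr e X) (3 + 0) t) by exact: (at0_supp01 e0 e1 X01).
(* One integration by parts: [b 1] is minus the difference of the two atoms, so the increment of u
   becomes a pairing with its weak derivative. *)
have PE : P e = (b2 - a2) * pairK (g 0%N 1%N) (at_ 0 X e) (b 0%N).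
  have := weak_pairK hx0 hy0 (lexx a1) xb (lexx a2) yb wd ju jg (m1 : (0 + 1 <= m)%N) jX jb sX' sb.
  rewrite -[fun t => (-1) ^+ 0 * _]/(at_ 0 X e).
  rewrite (_ : b 1%N = (fun t => (-1) * at_ 0 Y' e t + at_ 0 Y e t)); last first.
    by apply/funext => t; rewrite b1E; ring.
  rewrite (pairK_linr _ _ _ _ _ ju tX tY' tY) /P expr0 mul1r expr1 => h.
  rewrite (_ : _ - _ = - (-1 * pairK u (at_ 0 X e) (at_ 0 Y' e) + pairK u (at_ 0 X e) (at_ 0 Y e))); last by ring.
  by rewrite h; ring.
have mass : pairK (fun=> 1) (at_ 0 X e) (b 0%N) = (1 - e) * (Y' - Y).
  have [dA mA sA] := at0_primitive e0 e1 X01; have [dB mB sB] := hvd_primitive e0 e1 Y0 YY Y'1.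
  by rewrite (pairK1_mass hx0 hy0 (lexx a1) xb (lexx a2) yb tX.1 tb.1 dA dB sA sB) mA mB mul1r.
rewrite PE [c * (_ * _)]mulrCA -mulrBr -mass -pairK_subc//.
rewrite normrM (gtr0_norm hy0) [leRHS]mulrCA ler_wpM2l ?(ltW hy0)//.
(* Height [4/e * tpM] over width [e/4] in x, and height [2 * tpM] over the band in y. *)
rewrite mass [leRHS](_ : _ = eta * ((4 / e * tpM) * (2 * tpM)) *
   ((ctr e X - (ctr e X - e / 4)) * (ctr e Y' - (ctr e Y - e / 4)))); last first.
  by rewrite /ctr; field; rewrite gt_eqF.
have jgc : intD (fun z => g 0%N 1%N z - c).
  have := integrableB (@measurable_Omega R a1 b1 a2 b2) jg (intD_cst a1 b1 a2 b2 c).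
  by apply: eq_integrable => //; exact: measurable_Omega.
apply: pairK_box_le => //.
- by rewrite mulr_ge0 ?tpM_ge0// divr_ge0// ltW.
- by rewrite mulr_ge0 ?tpM_ge0.
- by rewrite lerBlDr lerDl divr_ge0// ltW.
- by rewrite (le_trans _ cYY)// lerBlDr lerDl divr_ge0// ltW.
- by move=> t; exact: at0_pt_le.
- by move=> t; exact: at0_supp.
apply: filterS hae => z hz Dz zX zY; apply: hz => //.
- by have := band_close hx0 ehx k3 k3 e0 zX; rewrite eX -ltr_distlC distrC.
- by have := band_close hy0 ehy l3 l3' e0 zY; rewrite eY eY'.
Unshelve. all: by end_near. Qed.

(** A fundamental theorem of calculus for a weak derivative controlled almost everywhere near the
    segment, like [increment_y]. With [c = 0] the pair gives the Lipschitz bound for the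
    coefficients; with [c] a value of the continuous derivative it gives classical
    differentiability. *)
Lemma increment_x m p u (g : nat -> nat -> R * R -> R) x x' y (c eta d : R) :
  (1 <= m)%N -> weak_derivs D m p u g -> intD u -> intD (g 1%N 0%N) ->
  {within Dbar, continuous u} -> 0 <= eta -> 0 < d ->
  Dbar (x, y) -> Dbar (x', y) -> x <= x' ->
  {ae mu2, forall z : pT, D z -> x - d < z.1 < x' + d -> `|z.2 - y| < d -> `|g 1%N 0%N z - c| <= eta} ->
  `|u (x', y) - u (x, y) - c * (x' - x)| <= 2 * tpM ^+ 2 * eta * (x' - x).
Proof.
move=> m1 wd ju jg cu eta0 d0 [/= xx1 yy] [/= xx2 _] xx' hae.
have hx0 : 0 < b1 - a1 by rewrite subr_gt0.
have hy0 : 0 < b2 - a2 by rewrite subr_gt0.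
have eb1 : a1 + (b1 - a1) = b1 by rewrite addrC subrK.
have eb2 : a2 + (b2 - a2) = b2 by rewrite addrC subrK.
have xb : a1 + (b1 - a1) <= b1 by rewrite eb1.
have yb : a2 + (b2 - a2) <= b2 by rewrite eb2.
have xx1' : a1 <= x <= a1 + (b1 - a1) by rewrite eb1.
have xx2' : a1 <= x' <= a1 + (b1 - a1) by rewrite eb1.
have yy' : a2 <= y <= a2 + (b2 - a2) by rewrite eb2.
have [X01 eX] := unit_coord hx0 xx1'.
have [X'01 eX'] := unit_coord hx0 xx2'.
have [Y01 eY] := unit_coord hy0 yy'.
have XX : (x - a1) / (b1 - a1) <= (x' - a1) / (b1 - a1).
  by rewrite ler_pM2r ?invr_gt0// lerD2r.
set X := (x - a1) / (b1 - a1) in X01 eX XX *.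
set X' := (x' - a1) / (b1 - a1) in X'01 eX' XX *.
set Y := (y - a2) / (b2 - a2) in Y01 eY *.
pose P e := pairK u (at_ 0 X' e) (at_ 0 Y e) - pairK u (at_ 0 X e) (at_ 0 Y e).
pose Q e := `|P e - c * ((b1 - a1) * ((1 - e) * (X' - X)))| -
   2 * tpM ^+ 2 * eta * ((b1 - a1) * ((1 - e) * (X' - X) + e / 4)).
have e1c : (fun e : R => 1 - e) e @[e --> 0^'+] --> (1 - 0 : R).
  by apply: cvgB; [exact: cvg_cst|exact: cvg_at_right_filter cvg_id].
have cP : P e @[e --> 0^'+] --> u (x', y) - u (x, y).
  rewrite -eX -eY -eX'.
  by apply: cvgB; apply: pairK_cvg.
have cQ : Q e @[e --> 0^'+] --> `|u (x', y) - u (x, y) - c * ((b1 - a1) * ((1 - 0) * (X' - X)))|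
   - 2 * tpM ^+ 2 * eta * ((b1 - a1) * ((1 - 0) * (X' - X) + 0 / 4)).
  apply: cvgB.
    apply: cvg_norm; apply: cvgB; first exact: cP.
    by apply: cvgM; [exact: cvg_cst|apply: cvgM; [exact: cvg_cst|apply: cvgM; [exact: e1c|exact: cvg_cst]]].
  apply: cvgM; first exact: cvg_cst; apply: cvgM; first exact: cvg_cst.
  apply: cvgD; first by apply: cvgM; [exact: e1c|exact: cvg_cst].
  by apply: cvgM; [exact: cvg_at_right_filter cvg_id|exact: cvg_cst].
have xX : x' - x = (b1 - a1) * (X' - X) by rewrite -{1}eX' -{1}eX; ring.
rewrite -subr_le0; move/cvgr_to_le : cQ.
rewrite subr0 !mul1r mul0r addr0 -xX; apply.
near=> e; rewrite /Q subr_le0.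
have e0 : 0 < e by [].
have e1 : e < 1 by near: e; apply: nbhs_right_lt.
have ehx : (b1 - a1) * e < d.
  by rewrite -ltr_pdivlMl//; near: e; apply: nbhs_right_lt; rewrite mulr_gt0// invr_gt0.
have ehy : (b2 - a2) * e < d.
  by rewrite -ltr_pdivlMl//; near: e; apply: nbhs_right_lt; rewrite mulr_gt0// invr_gt0.
have [X0 _] := andP X01; have [_ X'1] := andP X'01.
have [ja [a0 sa aM a1E cXX]] := heaviside_diff e0 e1 X0 XX X'1.
rewrite /= in ja a0 sa aM a1E; set a := hvd X X' e in ja a0 sa aM a1E.
have tX := at_tame 0 X e0; have tY := at_tame 0 Y e0; have tX' := at_tame 0 X' e0.
have ta := jet_tame 0 ja sa.
have jY := at0_jet Y e0.
have [k1 k2 k3] := ctr_bounds e0 e1 X01; have [l1 l2 l3] := ctr_bounds e0 e1 Y01.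
have [k1' k2' k3'] := ctr_bounds e0 e1 X'01.
have sY' : supp01 (fun t => (-1) ^+ 0 * kap (e / 4) (ctr e Y) (3 + 0) t) by exact: (at0_supp01 e0 e1 Y01).
have PE : P e = (b1 - a1) * pairK (g 1%N 0%N) (a 0%N) (at_ 0 Y e).
  have := weak_pairK hx0 hy0 (lexx a1) xb (lexx a2) yb wd ju jg (m1 : (1 + 0 <= m)%N) ja jY sa sY'.
  rewrite -[fun t => (-1) ^+ 0 * _]/(at_ 0 Y e).
  rewrite (_ : a 1%N = (fun t => (-1) * at_ 0 X' e t + at_ 0 X e t)); last first.
    by apply/funext => t; rewrite a1E; ring.
  rewrite (pairK_linl _ _ _ _ _ ju tX' tX tY) /P expr0 mulr1 expr1 => h.
  rewrite (_ : _ - _ = - (-1 * pairK u (at_ 0 X' e) (at_ 0 Y e) + pairK u (at_ 0 X e) (at_ 0 Y e))); last by ring.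
  by rewrite h; ring.
have mass : pairK (fun=> 1) (a 0%N) (at_ 0 Y e) = (1 - e) * (X' - X).
  have [dB mB sB] := at0_primitive e0 e1 Y01; have [dA mA sA] := hvd_primitive e0 e1 X0 XX X'1.
  by rewrite (pairK1_mass hx0 hy0 (lexx a1) xb (lexx a2) yb ta.1 tY.1 dA dB sA sB) mA mB mulr1.
rewrite PE [c * (_ * _)]mulrCA -mulrBr -mass -pairK_subc//.
rewrite normrM (gtr0_norm hx0) [leRHS]mulrCA ler_wpM2l ?(ltW hx0)//.
rewrite mass [leRHS](_ : _ = eta * ((2 * tpM) * (4 / e * tpM)) *
   ((ctr e X' - (ctr e X - e / 4)) * (ctr e Y - (ctr e Y - e / 4)))); last first.
  by rewrite /ctr; field; rewrite gt_eqF.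
have jgc : intD (fun z => g 1%N 0%N z - c).
  have := integrableB (@measurable_Omega R a1 b1 a2 b2) jg (intD_cst a1 b1 a2 b2 c).
  by apply: eq_integrable => //; exact: measurable_Omega.
apply: pairK_box_le => //.
- by rewrite mulr_ge0 ?tpM_ge0.
- by rewrite mulr_ge0 ?tpM_ge0// divr_ge0// ltW.
- by rewrite (le_trans _ cXX)// lerBlDr lerDl divr_ge0// ltW.
- by rewrite lerBlDr lerDl divr_ge0// ltW.
- by move=> t; exact: at0_pt_le.
- by move=> t; exact: at0_supp.
apply: filterS hae => z hz Dz zX zY; apply: hz => //.
- by have := band_close hx0 ehx k3 k3' e0 zX; rewrite eX eX'.
- by have := band_close hy0 ehy l3 l3 e0 zY; rewrite eY -ltr_distlC distrC.
Unshelve. all: by end_near. Qed.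

End Increments.

(** * Consequences of finite L^p norms on Omega *)

Section LpIntegrable.
Context {R : realType}.
Local Notation mu2 := (@mu2 R).
Local Notation pT := (measurableTypeR R * measurableTypeR R)%type.
Variables (a1 b1 a2 b2 : R).
Hypotheses (ab1 : a1 < b1) (ab2 : a2 < b2).
Local Notation D := (Omega a1 b1 a2 b2).
Local Notation intD := (intD a1 b1 a2 b2).
Implicit Types (f : R * R -> R).

Lemma mu2_setT_gt0 : (0 < mu2 (setT : set pT))%E.
Proof.
apply: (@lt_le_trans _ _ (mu2 (D : set pT))).
  by rewrite mu2_Omega ?(ltW ab1) ?(ltW ab2)// lte_fin mulr_gt0// subr_gt0.
by apply: le_measure; rewrite ?inE//; exact: measurable_Omega.
Qed.

Lemma Lp_pow f (r : R) : 0 < r -> measurable_fun (D : set pT) f ->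
  ((LpnormD D r%:E f) `^ r = \int[mu2]_(z in (D : set pT)) (`|f z| `^ r)%:E)%E.
Proof.
move=> r0 mf; have rn0 : r != 0 by rewrite gt_eqF.
rewrite /LpnormD (poweR_Lnorm _ _ rn0).
rewrite [RHS]integral_mkcond; apply: eq_integral => z _.
rewrite patchE indicE; case: ifPn => zD.
  by rewrite mul1r -poweR_EFin.
by rewrite mul0r abse0 poweR0r// gt_eqF.
Qed.

Lemma Loo_ae f : (LpnormD D +oo f < +oo)%E ->
  {ae mu2, forall z : pT, D z -> `|f z| <= fine (LpnormD D +oo f)}.
Proof.
rewrite /LpnormD; set F := (fun z => _); move=> fin.
have F0 : (0 <= Lnorm mu2 +oo F)%E by exact: Lnorm_ge0.
have Ff : Lnorm mu2 +oo F \is a fin_num by rewrite ge0_fin_numE.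
have := @ess_sup_ge _ _ _ mu2 (abse \o F).
apply: filterS => z /= hz Dz; rewrite -lee_fin fineK//.
(* The norm for exponent [+oo] is the essential supremum only when the whole space has positive
   measure. *)
rewrite unlock /= mu2_setT_gt0; move: hz; rewrite /F indicE mem_set//.
by rewrite mul1r.
Qed.

(** Omega has finite measure: use the essential bound if [p = +oo], and [t <= 1 + t^r] if
    [p = r >= 1]. *)
Lemma Lp_intD f p : measurable_fun (D : set pT) f -> (1 <= p)%E -> (LpnormD D p f < +oo)%E -> intD f.
Proof.
have mD := @measurable_Omega R a1 b1 a2 b2.
move=> mf; case: p => [r|_|//]; last first.
  move=> fin; have hae := Loo_ae fin.
  apply/integrableP; split; first exact/measurable_EFinP.
  apply: (@le_lt_trans _ _ (\int[mu2]_(z in (D : set pT)) (cst (fine (LpnormD D +oo f))%:E z))%E).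
    apply: ae_ge0_le_integral => //.
    - by apply: measurableT_comp => //; apply/measurable_EFinP.
    - by move=> z _; rewrite lee_fin fine_ge0//; exact: Lnorm_ge0.
  by rewrite integral_cst// lte_mul_pinfty ?lee_fin ?fine_ge0 ?Lnorm_ge0 ?mu2_D_lty.
rewrite lee_fin => r1 fin; have r0 : 0 < r by apply: lt_le_trans r1.
have mfr : measurable_fun (D : set pT) (fun z => `|f z| `^ r).
  by apply: (@measurableT_comp _ _ _ _ _ _ (@powR R ^~ r)) => //; apply: measurableT_comp.
apply/integrableP; split; first exact/measurable_EFinP.
apply: (@le_lt_trans _ _ (\int[mu2]_(z in (D : set pT)) (1%:E + (`|f z| `^ r)%:E))%E).
  apply: ge0_le_integral => //.
  - by apply: measurableT_comp => //; apply/measurable_EFinP.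
  - by apply: emeasurable_funD => //; exact/measurable_EFinP.
  - move=> z _; rewrite -EFinD lee_fin.
    have [h|h] := leP `|f z| 1; first by rewrite (le_trans h)// lerDl powR_ge0.
    by rewrite -[leLHS]powRr1// -[leLHS]add0r lerD// ler_powR// ltW.
rewrite ge0_integralD//; last exact/measurable_EFinP.
rewrite -Lp_pow// integral_cst// mul1e lte_add_pinfty//; first exact: mu2_D_lty.
exact: poweR_lty.
Qed.

End LpIntegrable.

(** * Exact action of mollifiers on bilinear functions *)

Section BilinearBounds.
Context {R : realType}.
Variables (a1 b1 a2 b2 : R).
Implicit Types (f u v : R * R -> R) (X Y Z e t : R).

(* The mollifier reproduces affine functions. *)
Lemma bump_moments Z : 4^-1 <= Z <= 3 / 4 ->
  let J := fun m t => (-1) ^+ m * kap 8^-1 Z (3 + m) t in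
  [/\ jet J, supp01 (J 0%N) & forall t, `|J 0%N t| <= 8 * tpM] /\
  exists A0 A1 B0 B1 : R -> R,
  [/\ forall t : R, is_derive t 1 A0 (J 0%N t), forall t : R, is_derive t 1 A1 (t * J 0%N t),
      forall t : R, is_derive t 1 B0 (J 1%N t) & forall t : R, is_derive t 1 B1 (t * J 1%N t)] /\
  [/\ A0 1 - A0 0 = 1, A1 1 - A1 0 = Z, B0 1 - B0 0 = 0 & B1 1 - B1 0 = -1].
Proof.
move=> Z14 J; have e0 : (0 : R) < 8^-1 by rewrite invr_gt0.
have jJ : jet J.
  move=> m t; rewrite /J addnS exprS mulN1r mulNr -mulrN.
  exact: drvZ (kap_drv _ _ _ e0).
move: (Z14) => /andP[Z0 Z1].
have k1 n : kap 8^-1 Z n 1 = 0 by apply: kap_right => //; lra.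
have k0 n : kap 8^-1 Z n 0 = tpow n Z by rewrite kap_left ?subr0//; lra.
split; first split=> //.
- exists (10^-1), (4 / 5); split; [by rewrite invr_gt0|lra|].
  move=> t /orP[t1|t1]; rewrite /J /= addn0.
    by rewrite kap_left //= /tpow /= ?mulr0//; lra.
  by rewrite kap_right ?mulr0//; lra.
- move=> t; rewrite /J expr0 mul1r addn0 /kap normrM ger0_norm//.
  have := @tp_le R 3 ((Z - t) / 8^-1) isT; rewrite [tpow 3 _]/tpow/= normr0 => h.
  have -> : 8^-1 ^+ 2 * 8^-1^-1 ^+ 3 = 8 :> R by field.
  by rewrite ler_wpM2l//; lra.
(* Antiderivatives of [J] and [t J] by parts, through kernels of lower order. The moments are exact
   because these kernels vanish at 1 and equal [tpow] at 0. *)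
exists (fun t => - kap 8^-1 Z 2 t), (fun t => t * (- kap 8^-1 Z 2 t) + - kap 8^-1 Z 1 t),
  (fun t => kap 8^-1 Z 3 t), (fun t => t * kap 8^-1 Z 3 t + kap 8^-1 Z 2 t); split; first split.
- by move=> t; rewrite /J expr0 mul1r addn0; exact: kap_drvN.
- move=> t; have := drvD (drvM (drv_id t) (kap_drvN Z t 2 e0)) (kap_drvN Z t 1 e0).
  by move=> /is_derive_eq; apply; rewrite /J expr0 mul1r addn0; ring.
- by move=> t; have := kap_drv Z 3 t e0; move=> /is_derive_eq; apply; rewrite /J expr1 mulN1r addn1.
- move=> t; have := drvD (drvM (drv_id t) (kap_drv Z 3 t e0)) (kap_drv Z 2 t e0).
  by move=> /is_derive_eq; apply; rewrite /J expr1 addn1; ring.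
- by split; rewrite !k1 !k0 /tpow /=; ring.
Qed.

Variables (x0 y0 hx hy : R) (hx0 : 0 < hx) (hy0 : 0 < hy).
Hypotheses (ax : a1 <= x0) (xb : x0 + hx <= b1) (ay : a2 <= y0) (yb : y0 + hy <= b2).
Local Notation K := (Omega x0 (x0 + hx) y0 (y0 + hy)).
Local Notation pairK := (pairK a1 b1 a2 b2 x0 y0 hx hy).

Lemma continuous_affmul (c d : R) (a : R -> R) : continuous a -> continuous (fun t => (c + d * t) * a t).
Proof.
move=> ca t; apply: cvgM; last exact: ca.
by apply: cvgD; [exact: cvg_cst|apply: cvgM; [exact: cvg_cst|exact: cvg_id]].
Qed.

(** Only the zeroth and first moments of each factor are seen by a bilinear function, and what [f]
    does outside K is invisible to the kernel. *)
Lemma pairK_bilin f (al be ga de : R) (a b A0 A1 B0 B1 : R -> R) :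
  (forall z, K z -> f z = al + be * ((z.1 - x0) / hx) + ga * ((z.2 - y0) / hy)
                        + de * ((z.1 - x0) / hx) * ((z.2 - y0) / hy)) ->
  tame a -> tame b ->
  (forall t, (t <= 0) || (1 <= t) -> a t = 0) -> (forall t, (t <= 0) || (1 <= t) -> b t = 0) ->
  (forall t : R, is_derive t 1 A0 (a t)) -> (forall t : R, is_derive t 1 A1 (t * a t)) ->
  (forall t : R, is_derive t 1 B0 (b t)) -> (forall t : R, is_derive t 1 B1 (t * b t)) ->
  pairK f a b = (al * (A0 1 - A0 0) + be * (A1 1 - A1 0)) * (B0 1 - B0 0)
              + (ga * (A0 1 - A0 0) + de * (A1 1 - A1 0)) * (B1 1 - B1 0).
Proof.
move=> fE ta tb a0 b0 dA0 dA1 dB0 dB1.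
have tam (c d : R) (w : R -> R) : tame w -> (forall t, (t <= 0) || (1 <= t) -> w t = 0) ->
    tame (fun t => (c + d * t) * w t).
  move=> [cw [M HM]] w0; split; first exact: continuous_affmul.
  exists ((`|c| + `|d|) * M) => t; have M0 : 0 <= M by apply: le_trans (HM 0).
  have [t01|] := boolP (0 <= t <= 1).
    rewrite normrM ler_pM// (le_trans (ler_normD _ _))// lerD2l normrM ler_piMr//.
    by move: t01 => /andP[t0 t1]; rewrite ger0_norm.
  rewrite negb_and -!ltNge => h; rewrite w0; last by case/orP: h => h; rewrite (ltW h) ?orbT.
  by rewrite mulr0 normr0 mulr_ge0// addr_ge0.
have e1 := pairK1_mass hx0 hy0 ax xb ay yb (@continuous_affmul al be _ ta.1) tb.1.
have e2 := pairK1_mass hx0 hy0 ax xb ay yb (@continuous_affmul ga de _ ta.1) (@continuous_affmul 0 1 _ tb.1).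
have dl (c d t : R) (w W0 W1 : R -> R) : is_derive t 1 W0 (w t) -> is_derive t 1 W1 (t * w t) ->
    is_derive t 1 (fun t => c * W0 t + d * W1 t) ((c + d * t) * w t).
  move=> d0 d1; have := drvD (drvZ c d0) (drvZ d d1).
  by move=> /is_derive_eq; apply; ring.
have {}e1 := e1 _ _ (fun t => dl al be t a A0 A1 (dA0 t) (dA1 t)) dB0.
have {}e2 := e2 _ _ (fun t => dl ga de t a A0 A1 (dA0 t) (dA1 t)) (fun t => dl 0 1 t b B0 B1 (dB0 t) (dB1 t)).
rewrite [RHS](_ : _ = pairK (fun=> 1) (fun t => (al + be * t) * a t) b +
  pairK (fun=> 1) (fun t => (ga + de * t) * a t) (fun t => (0 + 1 * t) * b t)); last first.
  rewrite e1 ?e2//.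
  - by ring.
  - by move=> t h; rewrite a0// mulr0.
  - by move=> t h; rewrite b0// mulr0.
  - by move=> t h; rewrite a0// mulr0.
have mD := @measurable_Omega R a1 b1 a2 b2.
rewrite /pairK -mulrDr; congr (_ * _); rewrite -RintegralD//.
- apply: eq_Rintegral => z; rewrite inE => Dz; rewrite /tensor.
  have [h|h] := boolP (((z.1 - x0) / hx <= 0) || (1 <= (z.1 - x0) / hx)).
    by rewrite a0// !(mul0r, mulr0, addr0).
  have [h'|h'] := boolP (((z.2 - y0) / hy <= 0) || (1 <= (z.2 - y0) / hy)).
    by rewrite b0// !(mul0r, mulr0, addr0).
  rewrite fE; first by ring.
  move: h h'; rewrite !negb_or -!ltNge !ltr_pdivlMr// !ltr_pdivrMr//.
  rewrite !mul0r !mul1r => /andP[z1 z2] /andP[z3 z4].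
  split; apply/andP; split.
  - by rewrite -subr_gt0.
  - by rewrite -ltrBlDl.
  - by rewrite -subr_gt0.
  - by rewrite -ltrBlDl.
- by apply: intD_tensor => //; [exact: intD_cst|exact: tam].
- by apply: intD_tensor => //; [exact: intD_cst|exact: tam|exact: tam].
Qed.

End BilinearBounds.

(** * Inverse estimates for bilinear functions in L^1 *)

Section NodalBounds.
Context {R : realType}.
Variables (a1 b1 a2 b2 : R).
Local Notation D := (Omega a1 b1 a2 b2).
Local Notation intD := (intD a1 b1 a2 b2).
Variables (x0 y0 hx hy : R) (hx0 : 0 < hx) (hy0 : 0 < hy).
Hypotheses (ax : a1 <= x0) (xb : x0 + hx <= b1) (ay : a2 <= y0) (yb : y0 + hy <= b2).
Local Notation K := (Omega x0 (x0 + hx) y0 (y0 + hy)).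
Local Notation pairK := (pairK a1 b1 a2 b2 x0 y0 hx hy).

(** An affine function is recovered from its values at 3/8 and 5/8 with weights of absolute value at
    most 5/2 on [0, 1]. *)
Lemma extrapolate (c d M Y : R) : 0 <= Y <= 1 -> `|c + d * (3 / 8)| <= M -> `|c + d * (5 / 8)| <= M ->
  `|c + d * Y| <= 5 * M.
Proof.
move=> /andP[Y0 Y1] h1 h2.
rewrite (_ : c + d * Y = (5 / 2 - 4 * Y) * (c + d * (3 / 8)) + (4 * Y - 3 / 2) * (c + d * (5 / 8))); last by field.
have M0 : 0 <= M by apply: le_trans h1.
apply: (le_trans (ler_normD _ _)); rewrite !normrM.
have k1 : `|5 / 2 - 4 * Y| <= 5 / 2 by rewrite ler_norml; lra.
have k2 : `|4 * Y - 3 / 2| <= 5 / 2 by rewrite ler_norml; lra.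
have := ler_pM (normr_ge0 _) (normr_ge0 _) k1 h1.
have := ler_pM (normr_ge0 _) (normr_ge0 _) k2 h2.
lra.
Qed.

(** The function v is tied to [gv] only through test functions, so values are obtained by testing
    with mollifiers at 3/8 and 5/8, which reproduce bilinear functions, and then extrapolating. The
    64 is the product of two bump heights 8, and 25 is two extrapolations. *)
Lemma nodal_bounds q v (gv : nat -> nat -> R * R -> R) (al be ga de : R) :
  weak_derivs D 1 q v gv -> intD v -> (forall i j, (i + j <= 1)%N -> intD (gv i j)) ->
  (forall z, K z -> v z = al + be * ((z.1 - x0) / hx) + ga * ((z.2 - y0) / hy)
                        + de * ((z.1 - x0) / hx) * ((z.2 - y0) / hy)) ->
  let M := 64 * tpM ^+ 2 / (hx * hy) in
  forall X Y : R, 0 <= X <= 1 -> 0 <= Y <= 1 ->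
  [/\ `|al + be * X + ga * Y + de * X * Y| <= 25 * (M * L1K x0 y0 hx hy (gv 0%N 0%N)),
      `|be + de * Y| <= 5 * (hx * (M * L1K x0 y0 hx hy (gv 1%N 0%N))) &
      `|ga + de * X| <= 5 * (hy * (M * L1K x0 y0 hx hy (gv 0%N 1%N)))].
Proof.
move=> wd jv jg vE M X Y X01 Y01.
have p38 : 4^-1 <= (3 / 8 : R) <= 3 / 4 by apply/andP; split; lra.
have p58 : 4^-1 <= (5 / 8 : R) <= 3 / 4 by apply/andP; split; lra.
have key (Z Z' : R) : 4^-1 <= Z <= 3 / 4 -> 4^-1 <= Z' <= 3 / 4 ->
  [/\ `|al + be * Z + ga * Z' + de * Z * Z'| <= M * L1K x0 y0 hx hy (gv 0%N 0%N),
      `|be + de * Z'| <= hx * (M * L1K x0 y0 hx hy (gv 1%N 0%N)) &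
      `|ga + de * Z| <= hy * (M * L1K x0 y0 hx hy (gv 0%N 1%N))].
  move=> hZ hZ'.
  have [[jJ sJ bJ] [A0 [A1 [C0 [C1 [[dA0 dA1 dC0 dC1] [mA0 mA1 mC0 mC1]]]]]]] := bump_moments hZ.
  have [[jL sL bL] [B0 [B1 [E0 [E1 [[dB0 dB1 dE0 dE1] [mB0 mB1 mE0 mE1]]]]]]] := bump_moments hZ'.
  set J := (X in jet X) in jJ sJ bJ dA0 dA1 dC0 dC1 *.
  set L := (X in jet X) in jL sL bL dB0 dB1 dE0 dE1 *.
  have tM : 0 <= 8 * (tpM : R) by rewrite mulr_ge0 ?tpM_ge0.
  have wk i j (ij : (i + j <= 1)%N) : `|pairK (gv i j) (J 0%N) (L 0%N)| <= M * L1K x0 y0 hx hy (gv i j).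
    have := pairK_le hx0 hy0 ax xb ay yb (jg _ _ ij) (jet_tame 0 jJ sJ) (jet_tame 0 jL sL) tM tM bJ bL.
    move=> /(_ (fun t => @jet_supp _ _ 0 t jJ sJ) (fun t => @jet_supp _ _ 0 t jL sL)).
    by move=> /le_trans; apply; rewrite /M le_eqVlt; apply/orP; left; apply/eqP; ring.
  have sp n t := @jet_supp _ _ n t jJ sJ.
  have sp' n t := @jet_supp _ _ n t jL sL.
  have tJ n := jet_tame n jJ sJ; have tL n := jet_tame n jL sL.
  have wkE i j (ij : (i + j <= 1)%N) := weak_pairK hx0 hy0 ax xb ay yb wd jv (jg i j ij) ij jJ jL sJ sL.
  split.
  - have := pairK_bilin hx0 hy0 ax xb ay yb vE (tJ 0%N) (tL 0%N) (sp 0%N) (sp' 0%N) dA0 dA1 dB0 dB1.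
    rewrite (wkE 0%N 0%N isT) mA0 mA1 mB0 mB1 !expr0 !mul1r => e.
    rewrite (_ : _ + _ + _ + _ = pairK (gv 0%N 0%N) (J 0%N) (L 0%N)); first exact: wk.
    by rewrite e; ring.
  - have := pairK_bilin hx0 hy0 ax xb ay yb vE (tJ 1%N) (tL 0%N) (sp 1%N) (sp' 0%N) dC0 dC1 dB0 dB1.
    rewrite (wkE 1%N 0%N isT) mC0 mC1 mB0 mB1 addn0 !expr1 !expr0 !mulr1 => e.
    rewrite (_ : _ + _ = hx * pairK (gv 1%N 0%N) (J 0%N) (L 0%N)); last by move: e; lra.
    by rewrite normrM (gtr0_norm hx0) ler_wpM2l ?(ltW hx0)//; exact: wk.
  - have := pairK_bilin hx0 hy0 ax xb ay yb vE (tJ 0%N) (tL 1%N) (sp 0%N) (sp' 1%N) dA0 dA1 dE0 dE1.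
    rewrite (wkE 0%N 1%N isT) mA0 mA1 mE0 mE1 add0n !expr1 !expr0 !mul1r !mulr1 => e.
    rewrite (_ : _ + _ = hy * pairK (gv 0%N 1%N) (J 0%N) (L 0%N)); last by move: e; lra.
    by rewrite normrM (gtr0_norm hy0) ler_wpM2l ?(ltW hy0)//; exact: wk.
have [k1 l1 m1] := key _ _ p38 p38; have [k2 l2 m2] := key _ _ p58 p38.
have [k3 _ _] := key _ _ p38 p58; have [k4 l4 _] := key _ _ p58 p58.
split; [|exact: extrapolate|exact: extrapolate].
have h1 : `|al + be * X + ga * (3 / 8) + de * X * (3 / 8)| <= 5 * (M * L1K x0 y0 hx hy (gv 0%N 0%N)).
  rewrite (_ : _ + _ + _ + _ = (al + ga * (3 / 8)) + (be + de * (3 / 8)) * X); last by ring.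
  apply: extrapolate => //.
    by move: k1; congr (`| _ | <= _); ring.
  by move: k2; congr (`| _ | <= _); ring.
have h2 : `|al + be * X + ga * (5 / 8) + de * X * (5 / 8)| <= 5 * (M * L1K x0 y0 hx hy (gv 0%N 0%N)).
  rewrite (_ : _ + _ + _ + _ = (al + ga * (5 / 8)) + (be + de * (5 / 8)) * X); last by ring.
  apply: extrapolate => //.
    by move: k3; congr (`| _ | <= _); ring.
  by move: k4; congr (`| _ | <= _); ring.
rewrite (_ : _ + _ + _ + _ = (al + be * X) + (ga + de * X) * Y); last by ring.
rewrite (_ : 25 * _ = 5 * (5 * (M * L1K x0 y0 hx hy (gv 0%N 0%N)))); last by ring.
apply: extrapolate => //.
  by move: h1; congr (`| _ | <= _); ring.
by move: h2; congr (`| _ | <= _); ring.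
Qed.

End NodalBounds.

(** * Lipschitz coefficients, classical derivatives and the fundamental theorem on lines *)

Section LinesAndLipschitz.
Context {R : realType}.
Local Notation leb := (@lebesgue_measure R).
Local Notation mu2 := (@mu2 R).
Local Notation pT := (measurableTypeR R * measurableTypeR R)%type.
Variables (a1 b1 a2 b2 : R).
Hypotheses (ab1 : a1 < b1) (ab2 : a2 < b2).
Local Notation D := (Omega a1 b1 a2 b2).
Local Notation Dbar := (Omegabar a1 b1 a2 b2).
Local Notation intD := (intD a1 b1 a2 b2).

Lemma cont_intD (u : R * R -> R) : measurable_fun (D : set pT) u -> {within Dbar, continuous u} -> intD u.
Proof.
move=> mu cu; have [M _ HM] := continuous_bounded_Omegabar cu.
by apply: (bounded_intD mu) => z Dz; apply: HM; exact: Omega_sub.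
Qed.

(** Two points of the closed rectangle are joined by a path with one corner, and each leg is an
    increment with [c = 0]. *)
Lemma lipschitz_W1oo (f : R * R -> R) (g : nat -> nat -> R * R -> R) :
  weak_derivs D 1 +oo%E f g -> {within Dbar, continuous f} ->
  exists2 L, 0 <= L & forall z z', Dbar z -> Dbar z' ->
    `|f z - f z'| <= L * (`|z.1 - z'.1| + `|z.2 - z'.2|).
Proof.
move=> wd cf; have [mf _ wdg] := wd.
have jf := cont_intD mf cf.
have jg i j : (i + j <= 1)%N -> intD (g i j).
  by move=> /wdg[mg lg _]; exact: (Lp_intD ab1 ab2 mg (leey _) lg).
pose N i j := fine (LpnormD D +oo (g i j)).
have N0 i j : 0 <= N i j by rewrite fine_ge0//; exact: Lnorm_ge0.
have NE i j : (i + j <= 1)%N -> {ae mu2, forall z : pT, D z -> `|g i j z| <= N i j}.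
  by move=> /wdg[_ lg _]; exact: Loo_ae.
have hy x y y' : Dbar (x, y) -> Dbar (x, y') ->
    `|f (x, y') - f (x, y)| <= 2 * tpM ^+ 2 * N 0%N 1%N * `|y' - y|.
  wlog yy : y y' / y <= y' => [hw d1 d2|d1 d2].
    have [h|/ltW h] := leP y y'; first exact: hw.
    by rewrite distrC (distrC y'); apply: hw.
  have := @increment_y _ _ _ _ _ ab1 ab2 1 _ _ _ x y y' 0 (N 0%N 1%N) 1 isT wd jf (jg 0%N 1%N isT) cf (N0 _ _) ltr01 d1 d2 yy.
  rewrite mul0r subr0 (ger0_norm (_ : 0 <= y' - y)) ?subr_ge0//; apply.
  by apply: filterS (NE 0%N 1%N isT) => z hz Dz _ _; rewrite subr0; exact: hz.
have hx x x' y : Dbar (x, y) -> Dbar (x', y) ->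
    `|f (x', y) - f (x, y)| <= 2 * tpM ^+ 2 * N 1%N 0%N * `|x' - x|.
  wlog xx : x x' / x <= x' => [hw d1 d2|d1 d2].
    have [h|/ltW h] := leP x x'; first exact: hw.
    by rewrite distrC (distrC x'); apply: hw.
  have := @increment_x _ _ _ _ _ ab1 ab2 1 _ _ _ x x' y 0 (N 1%N 0%N) 1 isT wd jf (jg 1%N 0%N isT) cf (N0 _ _) ltr01 d1 d2 xx.
  rewrite mul0r subr0 (ger0_norm (_ : 0 <= x' - x)) ?subr_ge0//; apply.
  by apply: filterS (NE 1%N 0%N isT) => z hz Dz _ _; rewrite subr0; exact: hz.
have T0 : 0 <= 2 * (tpM : R) ^+ 2 by rewrite mulr_ge0// sqr_ge0.
exists (2 * tpM ^+ 2 * (N 0%N 1%N + N 1%N 0%N)); first by rewrite mulr_ge0// addr_ge0.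
move=> [x y] [x' y'] [/= dx dy] [/= dx' dy'].
have h1 := hx x' x y (conj dx' dy) (conj dx dy).
have h2 := hy x' y' y (conj dx' dy') (conj dx' dy).
rewrite (_ : f (x, y) - _ = (f (x, y) - f (x', y)) + (f (x', y) - f (x', y'))); last by ring.
rewrite (le_trans (ler_normD _ _))//.
apply: (le_trans (lerD h1 h2)); rewrite mulrDr lerD// ler_wpM2r// ler_wpM2l//.
  by rewrite lerDr.
by rewrite lerDl.
Qed.

Lemma derive_of_increments (f : R -> R) (y c : R) :
  (forall eta, 0 < eta -> exists2 d, 0 < d & forall y', `|y' - y| < d -> `|f y' - f y - c * (y' - y)| <= eta * `|y' - y|) ->
  is_derive y 1 f c.
Proof.
move=> h; apply/is_derive1_caratheodory.
exists (fun z => if z == y then c else (f z - f y) / (z - y)); split.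
- move=> z; case: eqP => [->|/eqP zy]; first by rewrite !subrr mulr0.
  by rewrite mulfVK// subr_eq0.
- pose q z := if z == y then c else (f z - f y) / (z - y).
  have qy : q y = c by rewrite /q eqxx.
  suff k : q z @[z --> y] --> q y by exact: k.
  rewrite qy /q.
  apply/cvgrPdist_le => eta eta0; have [d d0 hd] := h _ eta0.
  near=> z; case: eqP => [_|/eqP zy]; first by rewrite subrr normr0 ltW.
  have zy0 : z - y != 0 by rewrite subr_eq0.
  rewrite distrC (_ : _ / _ - c = (f z - f y - c * (z - y)) / (z - y)); last by field.
  rewrite normrM normfV ler_pdivrMr ?normr_gt0//; apply: hd.
  by rewrite distrC; near: z; apply: (@cvgr_dist_lt _ _ _ _ _ id y cvg_id).
- by rewrite eqxx.
Unshelve. all: by end_near. Qed.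

Lemma line_continuous_y (f : R * R -> R) (x al be : R) : {within Dbar, continuous f} ->
  a1 <= x <= b1 -> a2 <= al -> be <= b2 -> {within `[al, be], continuous (fun y => f (x, y))}.
Proof.
move=> cf x01 aal beb; apply/subspace_continuousP => y; rewrite /= in_itv /= => /andP[y1 y2].
apply/cvgrPdist_lt => eta eta0.
have Dz : Dbar (x, y) by split; rewrite //= (le_trans aal y1) (le_trans y2 beb).
have [d d0 hd] := within_continuous_eps cf Dz eta0.
near=> y'; rewrite distrC; apply: hd => /=.
- have : y' \in `[al, be]%classic by rewrite inE; near: y'; exact: withinT.
  rewrite inE /= in_itv /= => /andP[y'1 y'2].
  by split; rewrite //= (le_trans aal y'1) (le_trans y'2 beb).
- by rewrite subrr normr0.
- rewrite distrC; near: y'; apply: cvg_within.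
  exact: (@cvgr_dist_lt _ _ _ _ _ id y cvg_id).
Unshelve. all: by end_near. Qed.

Lemma line_continuous_x (f : R * R -> R) (y al be : R) : {within Dbar, continuous f} ->
  a2 <= y <= b2 -> a1 <= al -> be <= b1 -> {within `[al, be], continuous (fun x => f (x, y))}.
Proof.
move=> cf y01 aal beb; apply/subspace_continuousP => x; rewrite /= in_itv /= => /andP[x1 x2].
apply/cvgrPdist_le => eta eta0.
have Dz : Dbar (x, y) by split; rewrite //= (le_trans aal x1) (le_trans x2 beb).
have [d d0 hd] := within_continuous_eps cf Dz eta0.
near=> x'; rewrite distrC; apply: ltW; apply: hd => /=.
- have : x' \in `[al, be]%classic by rewrite inE; near: x'; exact: withinT.
  rewrite inE /= in_itv /= => /andP[x'1 x'2].
  by split; rewrite //= (le_trans aal x'1) (le_trans x'2 beb).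
- rewrite distrC; near: x'; apply: cvg_within.
  exact: (@cvgr_dist_lt _ _ _ _ _ id x cvg_id).
- by rewrite subrr normr0.
Unshelve. all: by end_near. Qed.

Section FTC.
Variables (m : nat) (p : \bar R) (u : R * R -> R) (g : nat -> nat -> R * R -> R).
Hypotheses (m1 : (1 <= m)%N) (wd : weak_derivs D m p u g) (ju : intD u) (cu : {within Dbar, continuous u}).

(** A continuous weak derivative is a classical one: near the point it is close to its value there,
    which serves as [c] in [increment_y]. *)
Lemma is_derive_y x y : intD (g 0%N 1%N) -> {within Dbar, continuous (g 0%N 1%N)} ->
  D (x, y) -> is_derive y 1 (fun t => u (x, t)) (g 0%N 1%N (x, y)).
Proof.
move=> jg cg Dxy; apply: derive_of_increments => eta eta0.
have C0 : 0 < 2 * (tpM : R) ^+ 2 by rewrite mulr_gt0// exprn_gt0// (lt_le_trans ltr01 tpM_ge1).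
have eta0' : 0 < eta / (2 * tpM ^+ 2) by rewrite divr_gt0.
have [d d0 hd] := within_continuous_eps cg (Omega_sub Dxy) eta0'.
move: (Dxy) => [/= x01 /andP[y1 y2]].
exists (Num.min (d / 2) (Num.min (y - a2) (b2 - y))).
  by rewrite !lt_min divr_gt0//= !subr_gt0 y1.
move=> y'; rewrite !lt_min => /and3P[h1 h2 h3].
have d20 : 0 < d / 2 by rewrite divr_gt0.
have Dy' : Dbar (x, y').
  split; first by rewrite /= !ltW//; case/andP: x01.
  move: h2 h3; rewrite !ltr_norml => /andP[? ?] /andP[? ?] /=; apply/andP; split; lra.
have reg s s' : `|s - y| < d / 2 -> `|s' - y| < d / 2 ->
  {ae mu2, forall z : pT, D z -> `|z.1 - x| < d / 2 -> s - d / 2 < z.2 < s' + d / 2 ->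
     `|g 0%N 1%N z - g 0%N 1%N (x, y)| <= eta / (2 * tpM ^+ 2)}.
  move=> hs hs'; apply/nearW => z Dz zx zy; apply/ltW/hd.
  - exact: Omega_sub.
  - by rewrite (lt_trans zx)//= ltr_pdivrMr// mulr_natr mulr2n ltrDl.
  - move: hs hs' zy; rewrite !ltr_norml => /andP[? ?] /andP[? ?] /andP[? ?] /=; apply/andP; split; lra.
have yy0 : `|y - y| < d / 2 by rewrite subrr normr0.
have e0 := ltW eta0'.
rewrite (_ : eta * _ = 2 * tpM ^+ 2 * (eta / (2 * tpM ^+ 2)) * `|y' - y|); last first.
  by congr (_ * _); rewrite mulrC divfK// gt_eqF.
have [yy|/ltW yy] := leP y y'.
  have := increment_y ab1 ab2 m1 wd ju jg cu e0 d20 (Omega_sub Dxy) Dy' yy (reg _ _ yy0 h1).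
  by rewrite (ger0_norm (_ : 0 <= y' - y))// subr_ge0.
have := increment_y ab1 ab2 m1 wd ju jg cu e0 d20 Dy' (Omega_sub Dxy) yy (reg _ _ h1 yy0).
rewrite (distrC y') (ger0_norm (_ : 0 <= y - y')) ?subr_ge0//.
rewrite -normrN; congr (`| _ | <= _); ring.
Qed.

Lemma is_derive_x x y : intD (g 1%N 0%N) -> {within Dbar, continuous (g 1%N 0%N)} ->
  D (x, y) -> is_derive x 1 (fun t => u (t, y)) (g 1%N 0%N (x, y)).
Proof.
move=> jg cg Dxy; apply: derive_of_increments => eta eta0.
have C0 : 0 < 2 * (tpM : R) ^+ 2 by rewrite mulr_gt0// exprn_gt0// (lt_le_trans ltr01 tpM_ge1).
have eta0' : 0 < eta / (2 * tpM ^+ 2) by rewrite divr_gt0.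
have [d d0 hd] := within_continuous_eps cg (Omega_sub Dxy) eta0'.
move: (Dxy) => [/= /andP[x1 x2] y01].
exists (Num.min (d / 2) (Num.min (x - a1) (b1 - x))).
  by rewrite !lt_min divr_gt0//= !subr_gt0 x1.
move=> x'; rewrite !lt_min => /and3P[h1 h2 h3].
have d20 : 0 < d / 2 by rewrite divr_gt0.
have Dx' : Dbar (x', y).
  split; last by rewrite /= !ltW//; case/andP: y01.
  move: h2 h3; rewrite !ltr_norml => /andP[? ?] /andP[? ?] /=; apply/andP; split; lra.
have reg s s' : `|s - x| < d / 2 -> `|s' - x| < d / 2 ->
  {ae mu2, forall z : pT, D z -> s - d / 2 < z.1 < s' + d / 2 -> `|z.2 - y| < d / 2 ->
     `|g 1%N 0%N z - g 1%N 0%N (x, y)| <= eta / (2 * tpM ^+ 2)}.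
  move=> hs hs'; apply/nearW => z Dz zx zy; apply/ltW/hd.
  - exact: Omega_sub.
  - move: hs hs' zx; rewrite !ltr_norml => /andP[? ?] /andP[? ?] /andP[? ?] /=; apply/andP; split; lra.
  - by rewrite (lt_trans zy)//= ltr_pdivrMr// mulr_natr mulr2n ltrDl.
have xx0 : `|x - x| < d / 2 by rewrite subrr normr0.
have e0 := ltW eta0'.
rewrite (_ : eta * _ = 2 * tpM ^+ 2 * (eta / (2 * tpM ^+ 2)) * `|x' - x|); last first.
  by congr (_ * _); rewrite mulrC divfK// gt_eqF.
have [xx|/ltW xx] := leP x x'.
  have := increment_x ab1 ab2 m1 wd ju jg cu e0 d20 (Omega_sub Dxy) Dx' xx (reg _ _ xx0 h1).
  by rewrite (ger0_norm (_ : 0 <= x' - x))// subr_ge0.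
have := increment_x ab1 ab2 m1 wd ju jg cu e0 d20 Dx' (Omega_sub Dxy) xx (reg _ _ h1 xx0).
rewrite (distrC x') (ger0_norm (_ : 0 <= x - x')) ?subr_ge0//.
rewrite -normrN; congr (`| _ | <= _); ring.
Qed.

End FTC.

Lemma Rintegral_FTC (f F : R -> R) (al be : R) : al < be ->
  {within `[al, be], continuous f} -> {within `[al, be], continuous F} ->
  (forall t : R, al < t < be -> is_derive t 1 F (f t)) ->
  Rintegral leb `[al, be] f = F be - F al.
Proof.
move=> ab cf cF dF; rewrite /Rintegral (@continuous_FTC2 R f F al be ab)//.
- have [_ c1 c2] := (continuous_within_itvP F ab).1 cF.
  split => //= t tI; move: tI; rewrite in_itv /= => /dF[]//.
- by move=> t; rewrite in_itv /= => /dF[_ <-]; rewrite derive1E.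
Qed.

End LinesAndLipschitz.

(** * The flux through one midline of a cell *)

Section Flux.
Context {R : realType}.
Local Notation leb := (@lebesgue_measure R).
Implicit Types (F f : R -> R).

Lemma integrable_segment F (al be : R) : {within `[al, be], continuous F} ->
  leb.-integrable `[al, be] (EFin \o F).
Proof. by move=> cF; apply: continuous_compact_integrable => //; exact: segment_compact. Qed.

Lemma Rintegral_segment_le F (al be M : R) : al <= be -> {within `[al, be], continuous F} ->
  (forall y, al <= y <= be -> `|F y| <= M) -> `|Rintegral leb `[al, be] F| <= M * (be - al).
Proof.
move=> ab cF FM; have iF := integrable_segment cF.
have mI : measurable (`[al, be]%classic : set (measurableTypeR R)) by exact: measurable_itv.
apply: (le_trans (le_normr_Rintegral mI iF)).
have leI : fine (leb `[al, be]%classic) = be - al.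
  rewrite lebesgue_measure_itv /= lte_fin; move: ab; rewrite le_eqVlt => /predU1P[->|->//].
  by rewrite ltxx subrr.
rewrite -leI -Rintegral_cst//.
apply: le_Rintegral => //.
- exact: integrable_norm.
- apply: continuous_compact_integrable; first exact: segment_compact.
  by apply: continuous_subspaceT => x; exact: cvg_cst.
Qed.

Lemma within_continuousM (A : set R) F f : {within A, continuous F} -> {within A, continuous f} ->
  {within A, continuous (fun y => F y * f y)}.
Proof. by move=> cF cf x; apply: cvgM; [exact: cF|exact: cf]. Qed.

Lemma within_continuousD (A : set R) F f : {within A, continuous F} -> {within A, continuous f} ->
  {within A, continuous (fun y => F y + f y)}.
Proof. by move=> cF cf x; apply: cvgD; [exact: cF|exact: cf]. Qed.

Lemma within_continuous_cst (A : set R) (c : R) : {within A, continuous (fun=> c)}.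
Proof. by move=> x; exact: cvg_cst. Qed.

(* Freezing the off-diagonal coefficient at [a0] costs only O(h) relative to the L^oo sizes. *)
Lemma frozen_flux_le (f1 f2 wx wy W : R -> R) (al be a0 E1 E2 Ainf del : R) : al < be ->
  {within `[al, be], continuous f1} -> {within `[al, be], continuous f2} ->
  {within `[al, be], continuous wx} -> {within `[al, be], continuous wy} ->
  (forall y, al <= y <= be -> `|f1 y| <= Ainf) -> (forall y, al <= y <= be -> `|f2 y - a0| <= del) ->
  (forall y, al <= y <= be -> `|wx y| <= E1) -> (forall y, al <= y <= be -> `|wy y| <= E2) ->
  Rintegral leb `[al, be] wy = W be - W al ->
  `|Rintegral leb `[al, be] (fun y => f1 y * wx y + f2 y * wy y) - a0 * (W be - W al)|
    <= (Ainf * E1 + del * E2) * (be - al).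
Proof.
move=> ab c1 c2 cx cy f1A f2d wxE wyE ftc.
have mI : measurable (`[al, be]%classic : set (measurableTypeR R)) by exact: measurable_itv.
have cF := within_continuousD (within_continuousM c1 cx) (within_continuousM c2 cy).
have cG := within_continuousM (@within_continuous_cst `[al, be]%classic a0) cy.
rewrite -ftc -RintegralZl//; last exact: integrable_segment.
rewrite -RintegralB//; [|exact: integrable_segment|exact: integrable_segment].
apply: Rintegral_segment_le; first exact: ltW.
  have := within_continuousD cF (within_continuousM (@within_continuous_cst `[al, be]%classic (-1)) cG).
  rewrite (_ : (fun y => f1 y * wx y + f2 y * wy y + -1 * (a0 * wy y)) =
    (fun y => f1 y * wx y + f2 y * wy y - a0 * wy y))//.
  by apply/funext => y; rewrite mulN1r.
move=> y yI; rewrite (_ : _ - _ = f1 y * wx y + (f2 y - a0) * wy y); last by ring.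
apply: (le_trans (ler_normD _ _)); rewrite !normrM; apply: lerD; apply: ler_pM => //.
- exact: f1A.
- exact: wxE.
- exact: f2d.
- exact: wyE.
Qed.

(** The exchange behind the cell estimate: a jump of v is of size [V / h], the other factor carries
    an [h], and the powers cancel. *)
Lemma norm4_le (h V a b c : R) : 0 < h -> h * `|a| <= V -> `|b| <= h * c -> 0 <= c -> `|a * b| <= V * c.
Proof.
move=> h0 ha hb c0; rewrite normrM -(ler_pM2l h0) mulrA.
by apply: (le_trans (ler_pM _ _ ha hb)); rewrite ?mulr_ge0 ?(ltW h0)// mulrCA.
Qed.

(* The antisymmetric part of the frozen flux is a second difference, moved to the two vertical edges. *)
Lemma flux_algebra (h V G D0 D1 dL dR Qb Qt Wb Wm Wt a0 aL aR SL SR kB kA kT kS kL : R) :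
  0 < h -> 0 <= G -> 0 <= kB -> 0 <= kA -> 0 <= kT -> 0 <= kS -> 0 <= kL ->
  h * `|D0| <= V -> h * `|D1| <= V -> h * `|dL| <= V -> h * `|dR| <= V -> D0 - D1 = dL - dR ->
  `|Qb - a0 * (Wm - Wb)| <= h * (kB * G) -> `|Qt - a0 * (Wt - Wm)| <= h * (kB * G) ->
  `|a0| <= kA -> `|Wt - Wb| <= h * (kT * G) ->
  `|(2 * Wm - Wb - Wt) - SL| <= h * (kT * G) -> `|(2 * Wm - Wb - Wt) - SR| <= h * (kT * G) ->
  `|a0 - aL| <= h * kL -> `|a0 - aR| <= h * kL -> `|SL| <= kS * G -> `|SR| <= kS * G ->
  `|D0 * Qb + D1 * Qt - 2^-1 * (dL * (aL * SL) - dR * (aR * SR))|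
   <= (2 * kB + 2 * kA * kT + kL * kS) * (V * G).
Proof.
move=> h0 G0 kB0 kA0 kT0 kS0 kL0 hD0 hD1 hdL hdR dd hQb hQt ha hT hSL hSR hal har SLb SRb.
(* With S = 2 Wm - Wb - Wt, the two half increments are [(Wt - Wb + S)/2] and [(Wt - Wb - S)/2].
   Thus S is multiplied by [D0 - D1 = dL - dR], and is then compared with [SL] in the term of [dL]
   and with [SR] in that of [dR]. *)
rewrite (_ : _ - _ = D0 * (Qb - a0 * (Wm - Wb)) + D1 * (Qt - a0 * (Wt - Wm)) +
   2^-1 * (D0 * (a0 * (Wt - Wb)) + D1 * (a0 * (Wt - Wb)) +
   (dL * (a0 * ((2 * Wm - Wb - Wt) - SL) + (a0 - aL) * SL)
    - dR * (a0 * ((2 * Wm - Wb - Wt) - SR) + (a0 - aR) * SR)))); last first.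
  have -> : dL = D0 - D1 + dR by rewrite dd subrK.
  by field.
have t1 := norm4_le h0 hD0 hQb (mulr_ge0 kB0 G0).
have t2 := norm4_le h0 hD1 hQt (mulr_ge0 kB0 G0).
have aw x k : `|x| <= h * (k * G) -> `|a0 * x| <= h * (kA * k * G).
  move=> hx; rewrite normrM; apply: (le_trans (ler_pM _ _ ha hx)) => //.
  by rewrite le_eqVlt; apply/orP; left; apply/eqP; ring.
have kAT : 0 <= kA * kT * G by rewrite !mulr_ge0.
have t3 := norm4_le h0 hD0 (aw _ _ hT) kAT.
have t4 := norm4_le h0 hD1 (aw _ _ hT) kAT.
have bS a S (hS : `|(2 * Wm - Wb - Wt) - S| <= h * (kT * G)) (hal' : `|a0 - a| <= h * kL) (Sb : `|S| <= kS * G) :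
    `|a0 * ((2 * Wm - Wb - Wt) - S) + (a0 - a) * S| <= h * ((kA * kT + kL * kS) * G).
  apply: (le_trans (ler_normD _ _)).
  rewrite (_ : h * _ = h * (kA * kT * G) + h * kL * (kS * G)); last by ring.
  by rewrite lerD//; [exact: aw|rewrite normrM ler_pM].
have kk : 0 <= (kA * kT + kL * kS) * G by rewrite mulr_ge0// addr_ge0// mulr_ge0.
have t5 := norm4_le h0 hdL (bS _ _ hSL hal SLb) kk.
have t6 := norm4_le h0 hdR (bS _ _ hSR har SRb) kk.
apply: (le_trans (ler_normD _ _)).
rewrite (_ : (_ + _) * (V * G) = (V * (kB * G) + V * (kB * G)) +
  2^-1 * ((V * (kA * kT * G) + V * (kA * kT * G)) + (V * ((kA * kT + kL * kS) * G) + V * ((kA * kT + kL * kS) * G)))); last by field.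
apply: lerD; first by apply: (le_trans (ler_normD _ _)); exact: lerD.
rewrite normrM ger0_norm ?invr_ge0// ler_wpM2l ?invr_ge0//.
apply: (le_trans (ler_normD _ _)); apply: lerD; first by apply: (le_trans (ler_normD _ _)); exact: lerD.
by apply: (le_trans (ler_normB _ _)); exact: lerD.
Qed.

Definition Cflux (gam H Ainf Lip : R) : R :=
  2 * (Ainf * (3 * gam ^+ 2 * Kunit) + Lip * (gam ^+ 2 * Kunit * (1 + 2 * H)))
  + 2 * Ainf * (Kunit * gam) + Lip * (Kunit * gam * (1 + H)).

Lemma Kunit_ge0 : 0 <= Kunit :> R. Proof. by rewrite mulr_ge0// sqr_ge0. Qed.

(** Stated for abstract local data, so that the other direction is the same lemma applied to
    [swapl]. Here [D0], [D1] stand for the jumps of v along bottom and top, [dL], [dR] for those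
    along left and right, and [W] for the error on the midline. *)
Lemma flux_dir (L : @local_data R) (hx hy h gam H G V Ainf Lip y0 : R) (f1 f2 wx wy W : R -> R)
    (D0 D1 dL dR aL aR a0 : R) :
  valid 3 L -> 0 < hx -> 0 < hy -> 0 < h -> hy <= h -> h <= gam * hx -> h <= gam * hy -> h <= H ->
  1 <= gam -> 0 <= G -> 0 <= Ainf -> 0 <= Lip ->
  bnd L 3 0 <= gam * h * G -> bnd L 2 1 <= gam * h * G -> bnd L 1 2 <= gam * h * G -> bnd L 0 2 <= gam * G ->
  let U := val_ L 0 0 in
  (forall y, y0 <= y <= y0 + hy -> let Y := (y - y0) / hy in
     hx * wx y = val_ L 1 0 2^-1 Y - (1 - Y) * (U 1 0 - U 0 0) - Y * (U 1 1 - U 0 1)) ->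
  (forall y, y0 <= y <= y0 + hy -> let Y := (y - y0) / hy in
     hy * wy y = val_ L 0 1 2^-1 Y - 2^-1 * (U 0 1 - U 0 0) - 2^-1 * (U 1 1 - U 1 0)) ->
  W y0 = U 2^-1 0 - 2^-1 * (U 0 0 + U 1 0) -> W (y0 + hy) = U 2^-1 1 - 2^-1 * (U 0 1 + U 1 1) ->
  W (y0 + hy / 2) = U 2^-1 2^-1 - 4^-1 * (U 0 0 + U 1 0 + U 0 1 + U 1 1) ->
  let I := `[y0, y0 + hy]%classic in
  {within I, continuous f1} -> {within I, continuous f2} ->
  {within I, continuous wx} -> {within I, continuous wy} ->
  Rintegral leb `[y0, y0 + hy / 2] wy = W (y0 + hy / 2) - W y0 ->
  Rintegral leb `[y0 + hy / 2, y0 + hy] wy = W (y0 + hy) - W (y0 + hy / 2) ->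
  (forall y, y0 <= y <= y0 + hy -> `|f1 y| <= Ainf) -> (forall y, y0 <= y <= y0 + hy -> `|f2 y - a0| <= h * Lip) ->
  `|a0| <= Ainf -> `|a0 - aL| <= h * Lip -> `|a0 - aR| <= h * Lip ->
  h * `|D0| <= V -> h * `|D1| <= V -> h * `|dL| <= V -> h * `|dR| <= V -> D0 - D1 = dL - dR ->
  `|D0 * Rintegral leb `[y0, y0 + hy / 2] (fun y => f1 y * wx y + f2 y * wy y)
    + D1 * Rintegral leb `[y0 + hy / 2, y0 + hy] (fun y => f1 y * wx y + f2 y * wy y)
    - 2^-1 * (dL * (aL * (2 * U 0 2^-1 - U 0 0 - U 0 1)) - dR * (aR * (2 * U 1 2^-1 - U 1 0 - U 1 1)))|
  <= Cflux gam H Ainf Lip * (V * G).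
Proof.
move=> vL hx0 hy0 h0 hyh hgx hgy hH gam1 G0 A0 Lip0 b30 b21 b12 b02 U wxE wyE W0 W1 Wm I
  c1 c2 cx cy ftb ftt f1A f2d a0A aLd aRd hD0 hD1 hdL hdR dd.
have K0 := Kunit_ge0.
have Y01 y : y0 <= y <= y0 + hy -> 0 <= (y - y0) / hy <= 1.
  by move=> yI; have [] := unit_coord hy0 yI.
have bg i j : 0 <= bnd L i j by have [] := vL.
(* On its midline this component involves third derivatives only, so dividing by [hx] leaves no
   negative power of h. *)
have wxb y : y0 <= y <= y0 + hy -> `|wx y| <= 3 * gam ^+ 2 * Kunit * G.
  move=> yI; have := dx_mid_err_le vL (Y01 y yI); rewrite -(wxE y yI) => k.
  rewrite -(ler_pM2l h0).
  apply: (le_trans (ler_wpM2r (normr_ge0 _) hgx)).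
  rewrite (_ : gam * hx * _ = gam * `|hx * wx y|); last by rewrite normrM (gtr0_norm hx0) mulrA.
  have gam0 : 0 <= gam by apply: le_trans gam1.
  apply: (le_trans (ler_wpM2l gam0 k)).
  rewrite (_ : h * _ = gam * (Kunit * (gam * h * G + gam * h * G + gam * h * G))); last by ring.
  by rewrite ler_wpM2l// ler_wpM2l// !lerD.
(* The tangential component runs over all heights and meets second derivatives: it is one power of h
   larger, and is multiplied by the oscillation [h * Lip] of the coefficient. *)
have wyb y : y0 <= y <= y0 + hy -> h * `|wy y| <= gam ^+ 2 * Kunit * (1 + 2 * H) * G.
  move=> yI; have h01 := @half01 R.
  have := dx_err_le (valid_swap vL) (Y01 y yI) h01; rewrite /= (_ : 1 - 2^-1 = 2^-1); last by field.
  rewrite -/U -(wyE y yI) => k.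
  apply: (le_trans (ler_wpM2r (normr_ge0 _) hgy)).
  rewrite (_ : gam * hy * _ = gam * `|hy * wy y|); last by rewrite normrM (gtr0_norm hy0) mulrA.
  have gam0 : 0 <= gam by apply: le_trans gam1.
  apply: (le_trans (ler_wpM2l gam0 k)).
  rewrite (_ : gam ^+ 2 * _ * _ * _ = gam * (Kunit * (gam * G + gam * H * G + gam * H * G))); last by ring.
  rewrite ler_wpM2l// ler_wpM2l// !lerD//.
    by apply: (le_trans b12); rewrite ler_wpM2r// ler_wpM2l.
  by apply: (le_trans b21); rewrite ler_wpM2r// ler_wpM2l.
have gam0 : 0 <= gam by apply: le_trans gam1.
have H0 : 0 <= H by rewrite (le_trans (ltW h0)).
have hy2 : 0 < hy / 2 by rewrite divr_gt0.
have ey : y0 + hy = y0 + hy / 2 + hy / 2 by rewrite -addrA -splitr.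
pose kB := Ainf * (3 * gam ^+ 2 * Kunit) + Lip * (gam ^+ 2 * Kunit * (1 + 2 * H)).
have kB0 : 0 <= kB.
  have g2 : 0 <= gam ^+ 2 by exact: sqr_ge0.
  have h2 : 0 <= 1 + 2 * H by rewrite addr_ge0// mulr_ge0.
  by rewrite addr_ge0//; apply: mulr_ge0 => //; apply: mulr_ge0 => //; apply: mulr_ge0.
have frz al be : al < be -> y0 <= al -> be <= y0 + hy -> be - al = hy / 2 ->
    Rintegral leb `[al, be] wy = W be - W al ->
    `|Rintegral leb `[al, be] (fun y => f1 y * wx y + f2 y * wy y) - a0 * (W be - W al)| <= h * (kB * G).
  move=> ab y0a bey len ftc.
  have sub : `[al, be]%classic `<=` I.
    by move=> y; rewrite /I /= !in_itv /= => /andP[/(le_trans y0a)-> /le_trans->].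
  have inI y : al <= y <= be -> y0 <= y <= y0 + hy by move=> /andP[/(le_trans y0a)-> /le_trans->].
  have cw F : {within I, continuous F} -> {within `[al, be], continuous F} by apply: continuous_subspaceW.
  have := @frozen_flux_le f1 f2 wx wy W al be a0 (3 * gam ^+ 2 * Kunit * G)
    (gam ^+ 2 * Kunit * (1 + 2 * H) * G / h) Ainf (h * Lip) ab (cw _ c1) (cw _ c2) (cw _ cx) (cw _ cy).
  move=> /(_ (fun y yI => f1A y (inI y yI)) (fun y yI => f2d y (inI y yI)) (fun y yI => wxb y (inI y yI))) k.
  have {k} k := k _ ftc.
  apply: (le_trans (k _)).
    by move=> y yI; rewrite ler_pdivlMr// mulrC; exact: wyb (inI y yI).
  rewrite len (_ : _ + _ = kB * G); last by rewrite /kB; field; rewrite gt_eqF.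
  rewrite mulrC ler_wpM2r ?mulr_ge0// (le_trans _ hyh)// ler_pdivrMr// ler_peMr ?(ltW hy0)//.
  by rewrite ler1n.
have fb := frz _ _ (_ : y0 < y0 + hy / 2) (lexx _).
have ft := frz _ _ (_ : y0 + hy / 2 < y0 + hy) _ (lexx _).
rewrite /Cflux -/kB.
have kT0 : 0 <= Kunit * gam by rewrite mulr_ge0.
have kS0 : 0 <= Kunit * gam * (1 + H) by rewrite mulr_ge0// addr_ge0.
have SB X : 0 <= X <= 1 -> `|2 * U X 2^-1 - U X 0 - U X 1| <= Kunit * gam * (1 + H) * G.
  move=> X01; apply: (le_trans (second_diff_le vL X01)).
  rewrite (_ : _ * G = Kunit * (gam * G + gam * H * G)); last by ring.
  by rewrite ler_wpM2l// lerD// (le_trans b12)// ler_wpM2r// ler_wpM2l.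
have SV X : X = 0 \/ X = 1 -> `|(2 * W (y0 + hy / 2) - W y0 - W (y0 + hy)) - (2 * U X 2^-1 - U X 0 - U X 1)| <= h * (Kunit * gam * G).
  move=> X01; have k := second_diff_var_le vL X01.
  (* The interpolant is affine on the midline, so the second difference of the error is that of
     u. *)
  rewrite (_ : 2 * W _ - _ - _ = 2 * U 2^-1 2^-1 - U 2^-1 0 - U 2^-1 1); last by rewrite Wm W0 W1; field.
  apply: (le_trans k); rewrite (_ : h * _ = Kunit * (gam * h * G)); last by ring.
  by rewrite ler_wpM2l.
apply: (@flux_algebra h V G D0 D1 dL dR _ _ (W y0) (W (y0 + hy / 2)) (W (y0 + hy)) a0 aL aR _ _ kB Ainf (Kunit * gam) _ Lip) => //.
- by apply: fb => //; rewrite ?ltrDl ?lerD2l ?ler_pdivrMr// ?ler_peMr ?(ltW hy0) ?ler1n// addrC addKr.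
- by apply: ft => //; rewrite ?ltrD2l ?lerDl ?(ltW hy2)// ?ltr_pdivrMr// ?ltr_pMr ?ltr1n// ey [X in X - _]addrC addrK.
- have k := vert_diff_mid_le vL.
  rewrite (_ : W _ - W _ = U 2^-1 1 - U 2^-1 0 - 2^-1 * (U 0 1 - U 0 0) - 2^-1 * (U 1 1 - U 1 0)); last by rewrite W0 W1; ring.
  apply: (le_trans k); rewrite (_ : h * _ = Kunit * (gam * h * G)); last by ring.
  by rewrite ler_wpM2l.
- by apply: SV; left.
- by apply: SV; right.
- exact: (SB 0 (@zero01 R)).
- exact: (SB 1 (@one01 R)).
Qed.

End Flux.

(** * Edges, interpolant and fluxes of one cell *)

Section Cell.
Context {R : realType}.
Local Notation leb := (@lebesgue_measure R).
Implicit Types (u v a : R * R -> R).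

Lemma half_box (c h : R) : (c + (c + h)) / 2 = c + h / 2.
Proof. by field. Qed.

Definition edge_mid (E : (R * R) * (R * R)) : R * R := ((E.1.1 + E.2.1) / 2, (E.1.2 + E.2.2) / 2).

(* The frozen flux carried by an edge: jump of v along the edge, times the coefficient and the second
   difference of u at its midpoint. *)
Definition edge_flux a u v (E : (R * R) * (R * R)) : R :=
  (v E.2 - v E.1) * (a (edge_mid E) * (2 * u (edge_mid E) - u E.1 - u E.2)).

Definition bottomE (K : rect R) := ((K.1.1, K.1.2), (K.2.1, K.1.2)).
Definition topE (K : rect R) := ((K.1.1, K.2.2), (K.2.1, K.2.2)).
Definition leftE (K : rect R) := ((K.1.1, K.1.2), (K.1.1, K.2.2)).
Definition rightE (K : rect R) := ((K.2.1, K.1.2), (K.2.1, K.2.2)).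

Variables (x0 y0 hx hy : R) (hx0 : 0 < hx) (hy0 : 0 < hy).
Local Notation K := (((x0, y0), (x0 + hx, y0 + hy)) : rect R).

Lemma derive1_affine (f : R -> R) (al be x : R) : (forall t, f t = al + be * t) -> derive1 f x = be.
Proof.
move=> fE; rewrite derive1E; have h := drvD (drv_cst al x) (drvZ be (drv_id x)).
rewrite (_ : f = fun t => al + be * t); last exact/funext.
by have [_ ->] := h; rewrite add0r mulr1.
Qed.

Lemma pd_interp_x u (x y : R) : hx * pd true (interpK K u) (x, y) =
  (1 - (y - y0) / hy) * (u (x0 + hx, y0) - u (x0, y0))
  + (y - y0) / hy * (u (x0 + hx, y0 + hy) - u (x0, y0 + hy)).
Proof.
have ex : x0 + hx - x0 = hx by rewrite addrC addKr.
have ey : y0 + hy - y0 = hy by rewrite addrC addKr.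
set rhs := RHS; rewrite /pd /= (@derive1_affine _ (interpK K u (0, y)) (rhs / hx)).
  by rewrite mulrC divfK// gt_eqF.
by move=> t; rewrite /interpK /= ex ey /rhs; field; rewrite !gt_eqF.
Qed.

Lemma pd_interp_y u (x y : R) : hy * pd false (interpK K u) (x, y) =
  (1 - (x - x0) / hx) * (u (x0, y0 + hy) - u (x0, y0))
  + (x - x0) / hx * (u (x0 + hx, y0 + hy) - u (x0 + hx, y0)).
Proof.
have ex : x0 + hx - x0 = hx by rewrite addrC addKr.
have ey : y0 + hy - y0 = hy by rewrite addrC addKr.
set rhs := RHS; rewrite /pd /= (@derive1_affine _ (interpK K u (x, 0)) (rhs / hy)).
  by rewrite mulrC divfK// gt_eqF.
by move=> t; rewrite /interpK /= ex ey /rhs; field; rewrite !gt_eqF.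
Qed.

(** Each half midline separates two control volumes and enters with opposite normals; weighted by
    the nodal values this produces jumps of v. *)
Lemma fluxK_verts (F : R * R -> R * R) :
  let cx := x0 + hx / 2 in let cy := y0 + hy / 2 in
  let Qx al be := Rintegral leb `[al, be] (fun y => (F (cx, y)).1) in
  let Qy al be := Rintegral leb `[al, be] (fun x => (F (x, cy)).2) in
  [/\ fluxK K (x0, y0) F = Qx y0 cy + Qy x0 cx,
      fluxK K (x0 + hx, y0) F = - Qx y0 cy + Qy cx (x0 + hx),
      fluxK K (x0, y0 + hy) F = Qx cy (y0 + hy) - Qy x0 cx &
      fluxK K (x0 + hx, y0 + hy) F = - Qx cy (y0 + hy) - Qy cx (x0 + hx)].
Proof.
move=> cx cy Qx Qy; have hx2 : 0 < hx / 2 by rewrite divr_gt0.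
have hy2 : 0 < hy / 2 by rewrite divr_gt0.
have c1 : x0 < cx by rewrite ltrDl.
have c2 : cx < x0 + hx by rewrite ltrD2l ltr_pdivrMr// ltr_pMr// ltr1n.
have c3 : y0 < cy by rewrite ltrDl.
have c4 : cy < y0 + hy by rewrite ltrD2l ltr_pdivrMr// ltr_pMr// ltr1n.
have s1 : Num.sg (cx - x0) = 1 by rewrite gtr0_sg// subr_gt0.
have s2 : Num.sg (cx - (x0 + hx)) = -1 by rewrite ltr0_sg// subr_lt0.
have s3 : Num.sg (cy - y0) = 1 by rewrite gtr0_sg// subr_gt0.
have s4 : Num.sg (cy - (y0 + hy)) = -1 by rewrite ltr0_sg// subr_lt0.
rewrite /fluxK /Defs.center /= !half_box -/cx -/cy s1 s2 s3 s4 !mul1r !mulN1r.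
rewrite (elimT min_idPl (ltW c1)) (elimT max_idPr (ltW c1)) (elimT min_idPl (ltW c3)) (elimT max_idPr (ltW c3)).
by rewrite (elimT min_idPr (ltW c2)) (elimT max_idPl (ltW c2)) (elimT min_idPr (ltW c4)) (elimT max_idPl (ltW c4)).
Qed.

End Cell.

(** * The estimate on one cell *)

Section CellEstimate.
Context {R : realType}.
Local Notation leb := (@lebesgue_measure R).
Local Notation mu2 := (@mu2 R).
Local Notation pT := (measurableTypeR R * measurableTypeR R)%type.
Variables (a1 b1 a2 b2 : R) (ab1 : a1 < b1) (ab2 : a2 < b2).
Local Notation D := (Omega a1 b1 a2 b2).
Local Notation Dbar := (Omegabar a1 b1 a2 b2).
Local Notation intD := (intD a1 b1 a2 b2).

Variables (p : \bar R) (u : R * R -> R) (g : nat -> nat -> R * R -> R).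
Hypotheses (wdu : weak_derivs D 3 p u g) (ju : intD u)
  (jg : forall i j, (i + j <= 3)%N -> intD (g i j))
  (cu : {within Dbar, continuous u}) (cgx : {within Dbar, continuous (g 1%N 0%N)})
  (cgy : {within Dbar, continuous (g 0%N 1%N)}).

Variables (x0 y0 hx hy h gam H : R).
Record cell_geometry : Prop := CellGeometry {
  cg_hx : 0 < hx ; cg_hy : 0 < hy ; cg_h : 0 < h ; cg_xh : hx <= h ; cg_yh : hy <= h ;
  cg_hgx : h <= gam * hx ; cg_hgy : h <= gam * hy ; cg_hH : h <= H ; cg_gam : 1 <= gam ;
  cg_a1 : a1 <= x0 ; cg_b1 : x0 + hx <= b1 ; cg_a2 : a2 <= y0 ; cg_b2 : y0 + hy <= b2 }.
Hypothesis cg : cell_geometry.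
Local Notation K := (((x0, y0), (x0 + hx, y0 + hy)) : rect R).
Local Notation cx := (x0 + hx / 2).
Local Notation cy := (y0 + hy / 2).
Local Notation L1 := (L1K x0 y0 hx hy).
Local Notation LD := (ldata a1 b1 a2 b2 x0 y0 hx hy u g).

Let hx0 := cg_hx cg. Let hy0 := cg_hy cg. Let h0 := cg_h cg.

Lemma LD_valid : valid 3 LD.
Proof. by case: cg => *; apply: (ldata_valid _ _ _ _ _ _ _ wdu). Qed.

Definition cellG : R := \sum_(i < 4) \sum_(j < 4 | (i + j <= 3)%N) L1 (g i j).

Lemma cellG_ge (i j : nat) : (i + j <= 3)%N -> L1 (g i j) <= cellG.
Proof.
move=> ij; have i4 : (i < 4)%N by lia.
have j4 : (j < 4)%N by lia.
rewrite /cellG (bigD1 (Ordinal i4))//= (bigD1 (Ordinal j4))//= -addrA lerDl.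
by rewrite addr_ge0//; apply: sumr_ge0 => *; [exact: L1K_ge0|apply: sumr_ge0 => *; exact: L1K_ge0].
Qed.

Lemma cellG_ge0 : 0 <= cellG.
Proof. by apply: le_trans (cellG_ge (isT : (0 + 0 <= 3)%N)); exact: L1K_ge0. Qed.

(** The scaling factor [hx^i hy^j / (hx hy)] is of order h for third derivatives and of order 1 for
    second ones; the aspect ratio costs a factor [gam]. *)
Lemma bnd_le : [/\ bnd LD 3 0 <= gam * h * cellG, bnd LD 2 1 <= gam * h * cellG,
   bnd LD 1 2 <= gam * h * cellG & bnd LD 0 3 <= gam * h * cellG] /\
   bnd LD 2 0 <= gam * cellG /\ bnd LD 0 2 <= gam * cellG.
Proof.
case: cg => x_0 y_0 h_0 xh yh hgx hgy hH g1 _ _ _ _.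
have gam0 : 0 <= gam by apply: le_trans g1.
have hxy : hx <= gam * hy by apply: le_trans hgy.
have hyx : hy <= gam * hx by apply: le_trans hgx.
have hxg : hx <= gam * h by apply: (le_trans xh); rewrite ler_peMl// ltW.
have hyg : hy <= gam * h by apply: (le_trans yh); rewrite ler_peMl// ltW.
have q1 : hx / hy <= gam by rewrite ler_pdivrMr.
have q2 : hy / hx <= gam by rewrite ler_pdivrMr.
have key c i j : (i + j <= 3)%N -> hx ^+ i * hy ^+ j / (hx * hy) <= c -> bnd LD i j <= c * cellG.
  move=> ij hc; rewrite /=; apply: ler_pM => //; [|exact: L1K_ge0|exact: cellG_ge].
  by rewrite divr_ge0 ?mulr_ge0 ?exprn_ge0// ltW.
have hxn : hx != 0 by rewrite gt_eqF.
have hyn : hy != 0 by rewrite gt_eqF.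
have x00 := ltW x_0; have y00 := ltW y_0; have h00 := ltW h_0.
split; first split; first 4 last; try split; apply: key => //.
- rewrite (_ : _ / _ = hx / hy); last by field; rewrite hxn hyn.
  exact: q1.
- rewrite (_ : _ / _ = hy / hx); last by field; rewrite hxn hyn.
  exact: q2.
- rewrite (_ : _ / _ = hx / hy * hx); last by field; rewrite hxn hyn.
  by rewrite ler_pM// divr_ge0.
- by rewrite (_ : _ / _ = hx)//; field; rewrite hxn hyn.
- by rewrite (_ : _ / _ = hy)//; field; rewrite hxn hyn.
- rewrite (_ : _ / _ = hy / hx * hy); last by field; rewrite hxn hyn.
  by rewrite ler_pM// divr_ge0.
Qed.

Lemma rK (z : R * R) : x0 <= z.1 <= x0 + hx -> y0 <= z.2 <= y0 + hy -> Dbar z.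
Proof.
case: cg => _ _ _ _ _ _ _ _ _ l1 l2 l3 l4 /andP[z1 z2] /andP[z3 z4].
by split; rewrite ?(le_trans l1 z1) ?(le_trans z2 l2) ?(le_trans l3 z3) ?(le_trans z4 l4).
Qed.

Lemma U_unit (X Y : R) : val_ LD 0 0 X Y = u (x0 + hx * X, y0 + hy * Y). Proof. by []. Qed.

Lemma coord_unit (c k y : R) : 0 < k -> c + k * ((y - c) / k) = y.
Proof. by move=> k0; field; rewrite gt_eqF. Qed.

Lemma unit_bounds : [/\ 0 < hx / 2, 0 < hy / 2, cx < x0 + hx & cy < y0 + hy].
Proof.
by split; rewrite ?divr_gt0// ltrD2l ltr_pdivrMr// ltr_pMr// ltr1n.
Qed.

Lemma interp_affine_y (x : R) : exists al be, (forall y, interpK K u (x, y) = al + be * y) /\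
  (forall y, pd false (interpK K u) (x, y) = be).
Proof.
pose be := pd false (interpK K u) (x, 0).
have bE y : pd false (interpK K u) (x, y) = be.
  by apply: (mulfI (lt0r_neq0 hy0)); rewrite !pd_interp_y.
exists (interpK K u (x, 0)), be; split => // y.
apply: (mulfI (lt0r_neq0 hy0)); rewrite [RHS]mulrDr [hy * (be * y)]mulrA /be pd_interp_y //.
have ex : x0 + hx - x0 = hx by rewrite addrC addKr.
have ey : y0 + hy - y0 = hy by rewrite addrC addKr.
by rewrite /interpK /= ex ey; field; rewrite !gt_eqF.
Qed.

Lemma interp_affine_x (y : R) : exists al be, (forall x, interpK K u (x, y) = al + be * x) /\
  (forall x, pd true (interpK K u) (x, y) = be).
Proof.
pose be := pd true (interpK K u) (0, y).
have bE x : pd true (interpK K u) (x, y) = be.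
  by apply: (mulfI (lt0r_neq0 hx0)); rewrite !pd_interp_x.
exists (interpK K u (0, y)), be; split => // x.
apply: (mulfI (lt0r_neq0 hx0)); rewrite [RHS]mulrDr [hx * (be * x)]mulrA /be pd_interp_x //.
have ex : x0 + hx - x0 = hx by rewrite addrC addKr.
have ey : y0 + hy - y0 = hy by rewrite addrC addKr.
by rewrite /interpK /= ex ey; field; rewrite !gt_eqF.
Qed.

Lemma affine_continuous (c d : R) : continuous (fun t : R => c + d * t).
Proof.
by move=> t; apply: cvgD; [exact: cvg_cst|apply: cvgM; [exact: cvg_cst|exact: cvg_id]].
Qed.

Local Notation gw := (grad_err_interp u (g 1%N 0%N) (g 0%N 1%N) K).
Local Notation w := (err_interp u K).

Lemma within_continuousB (A : set R) (F f : R -> R) : {within A, continuous F} -> {within A, continuous f} ->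
  {within A, continuous (fun y => F y - f y)}.
Proof. by move=> cF cf x; apply: cvgB; [exact: cF|exact: cf]. Qed.

Lemma gw_cont_y : {within `[y0, y0 + hy], continuous (fun y => (gw (cx, y)).1)} /\
  {within `[y0, y0 + hy], continuous (fun y => (gw (cx, y)).2)}.
Proof.
have [h1 h2 h3 h4] := unit_bounds; case: (cg) => _ _ _ _ _ _ _ _ _ l1 l2 l3 l4.
have xI : a1 <= cx <= b1 by apply/andP; split; [rewrite (le_trans l1)// lerDl ltW|rewrite (le_trans (ltW h3))].
split.
- apply: within_continuousB; first exact: line_continuous_y.
  have -> : (fun y => pd true (interpK K u) (cx, y)) = (fun y => pd true (interpK K u) (cx, 0) +
      (hx * hy)^-1 * (u (x0 + hx, y0 + hy) - u (x0, y0 + hy) - (u (x0 + hx, y0) - u (x0, y0))) * y).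
    apply/funext => y; apply: (mulfI (lt0r_neq0 hx0)); rewrite [RHS]mulrDr !pd_interp_x//.
    by field; rewrite !gt_eqF.
  by apply: continuous_subspaceT; exact: affine_continuous.
- apply: within_continuousB; first exact: line_continuous_y.
  have [al [be [_ bE]]] := interp_affine_y cx.
  rewrite (_ : (fun y => pd false (interpK K u) (cx, y)) = fun=> be); last by apply/funext => y; exact: bE.
  exact: within_continuous_cst.
Qed.

Lemma gw_cont_x : {within `[x0, x0 + hx], continuous (fun x => (gw (x, cy)).1)} /\
  {within `[x0, x0 + hx], continuous (fun x => (gw (x, cy)).2)}.
Proof.
have [h1 h2 h3 h4] := unit_bounds; case: (cg) => _ _ _ _ _ _ _ _ _ l1 l2 l3 l4.
have yI : a2 <= cy <= b2 by apply/andP; split; [rewrite (le_trans l3)// lerDl ltW|rewrite (le_trans (ltW h4))].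
split.
- apply: within_continuousB; first exact: line_continuous_x.
  have [al [be [_ bE]]] := interp_affine_x cy.
  rewrite (_ : (fun x => pd true (interpK K u) (x, cy)) = fun=> be); last by apply/funext => y; exact: bE.
  exact: within_continuous_cst.
- apply: within_continuousB; first exact: line_continuous_x.
  have -> : (fun x => pd false (interpK K u) (x, cy)) = (fun x => pd false (interpK K u) (0, cy) +
      (hx * hy)^-1 * (u (x0 + hx, y0 + hy) - u (x0 + hx, y0) - (u (x0, y0 + hy) - u (x0, y0))) * x).
    apply/funext => y; apply: (mulfI (lt0r_neq0 hy0)); rewrite [RHS]mulrDr !pd_interp_y//.
    by field; rewrite !gt_eqF.
  by apply: continuous_subspaceT; exact: affine_continuous.
Qed.

(** A midline may end on the boundary of Omega, so differentiability is used on the open segment and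
    continuity up to its ends. *)
Lemma w_FTC_y al be : y0 <= al -> al < be -> be <= y0 + hy ->
  Rintegral leb `[al, be] (fun y => (gw (cx, y)).2) = w (cx, be) - w (cx, al).
Proof.
move=> y0al ab bey; have [h1 h2 h3 h4] := unit_bounds; case: (cg) => _ _ _ _ _ _ _ _ _ l1 l2 l3 l4.
have x1 : a1 < cx by rewrite (le_lt_trans l1)// ltrDl.
have x2 : cx < b1 by rewrite (lt_le_trans h3).
have xI : a1 <= cx <= b1 by rewrite !ltW.
have [c [d [iE pE]]] := interp_affine_y cx.
apply: (@Rintegral_FTC _ (fun y => (gw (cx, y)).2) (fun y => w (cx, y))) => //.
- apply: continuous_subspaceW (gw_cont_y.2).
  by move=> y; rewrite /= !in_itv /= => /andP[/(le_trans y0al)-> /le_trans->].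
- rewrite /err_interp; apply: within_continuousB.
    by apply: line_continuous_y => //; rewrite ?(le_trans l3)// (le_trans bey).
  rewrite (_ : (fun y => interpK K u (cx, y)) = fun y => c + d * y); last exact/funext.
  by apply: continuous_subspaceT; exact: affine_continuous.
- move=> t /andP[t1 t2]; rewrite /grad_err_interp pE /=.
  have Dt : D (cx, t).
    by split; rewrite /= ?x1 ?x2// (le_lt_trans l3 (le_lt_trans y0al t1)) (lt_le_trans t2 (le_trans bey l4)).
  have du := is_derive_y ab1 ab2 (isT : (1 <= 3)%N) wdu ju cu (jg (isT : (0 + 1 <= 3)%N)) cgy Dt.
  have di : is_derive t 1 (fun y => - interpK K u (cx, y)) (- d).
    have := drvZ (-1) (drvD (drv_cst c t) (drvZ d (drv_id t))).
    rewrite add0r mulr1 mulN1r (_ : (fun _ => _) = (fun y => - interpK K u (cx, y)))//.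
    by apply/funext => y; rewrite mulN1r iE.
  exact: (drvD du di).
Qed.

Lemma w_FTC_x al be : x0 <= al -> al < be -> be <= x0 + hx ->
  Rintegral leb `[al, be] (fun x => (gw (x, cy)).1) = w (be, cy) - w (al, cy).
Proof.
move=> x0al ab bex; have [h1 h2 h3 h4] := unit_bounds; case: (cg) => _ _ _ _ _ _ _ _ _ l1 l2 l3 l4.
have y1 : a2 < cy by rewrite (le_lt_trans l3)// ltrDl.
have y2 : cy < b2 by rewrite (lt_le_trans h4).
have yI : a2 <= cy <= b2 by rewrite !ltW.
have [c [d [iE pE]]] := interp_affine_x cy.
apply: (@Rintegral_FTC _ (fun x => (gw (x, cy)).1) (fun x => w (x, cy))) => //.
- apply: continuous_subspaceW (gw_cont_x.1).
  by move=> x; rewrite /= !in_itv /= => /andP[/(le_trans x0al)-> /le_trans->].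
- rewrite /err_interp; apply: within_continuousB.
    by apply: line_continuous_x => //; rewrite ?(le_trans l1)// (le_trans bex).
  rewrite (_ : (fun x => interpK K u (x, cy)) = fun x => c + d * x); last exact/funext.
  by apply: continuous_subspaceT; exact: affine_continuous.
- move=> t /andP[t1 t2]; rewrite /grad_err_interp pE /=.
  have Dt : D (t, cy).
    by split; rewrite /= ?y1 ?y2// (le_lt_trans l1 (le_lt_trans x0al t1)) (lt_le_trans t2 (le_trans bex l2)).
  have du := is_derive_x ab1 ab2 (isT : (1 <= 3)%N) wdu ju cu (jg (isT : (1 + 0 <= 3)%N)) cgx Dt.
  have di : is_derive t 1 (fun x => - interpK K u (x, cy)) (- d).
    have := drvZ (-1) (drvD (drv_cst c t) (drvZ d (drv_id t))).
    rewrite add0r mulr1 mulN1r (_ : (fun _ => _) = (fun x => - interpK K u (x, cy)))//.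
    by apply/funext => x; rewrite mulN1r iE.
  exact: (drvD du di).
Qed.

Variables (A : 'I_2 -> 'I_2 -> R * R -> R) (Ainf Lip : R).
Hypotheses (cA : forall i j, {within Dbar, continuous (A i j)}) (Lip0 : 0 <= Lip)
  (Ab : forall i j z, Dbar z -> `|A i j z| <= Ainf)
  (AL : forall i j z z', Dbar z -> Dbar z' -> `|A i j z - A i j z'| <= Lip * (`|z.1 - z'.1| + `|z.2 - z'.2|)).
Local Notation i0 := (ord0 : 'I_2).
Local Notation i1 := (lift ord0 ord0 : 'I_2).
Variables (v : R * R -> R) (V : R).
Local Notation v00 := (v (x0, y0)).
Local Notation v10 := (v (x0 + hx, y0)).
Local Notation v01 := (v (x0, y0 + hy)).
Local Notation v11 := (v (x0 + hx, y0 + hy)).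
Hypotheses (vD0 : h * `|v10 - v00| <= V) (vD1 : h * `|v11 - v01| <= V)
  (vdL : h * `|v01 - v00| <= V) (vdR : h * `|v11 - v10| <= V).
Local Notation F := (fun z => matvec A z (gw z)).

Lemma mids : [/\ 0 <= (cx - x0) / hx <= 1, (cx - x0) / hx = 2^-1, (cy - y0) / hy = 2^-1,
  x0 <= cx <= x0 + hx & y0 <= cy <= y0 + hy].
Proof.
have [h1 h2 h3 h4] := unit_bounds.
have e1 : (cx - x0) / hx = 2^-1 by rewrite [cx]addrC addrK; field; rewrite gt_eqF.
have e2 : (cy - y0) / hy = 2^-1 by rewrite [cy]addrC addrK; field; rewrite gt_eqF.
by split; rewrite ?e1 ?e2 ?half01//; apply/andP; split; rewrite ?lerDl ?ltW// ltW.
Qed.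

Lemma Lip_close i j (z z' : R * R) : Dbar z -> Dbar z' -> `|z.1 - z'.1| <= h / 2 -> `|z.2 - z'.2| <= h / 2 ->
  `|A i j z - A i j z'| <= h * Lip.
Proof.
move=> Dz Dz' h1 h2; apply: (le_trans (AL i j Dz Dz')); rewrite mulrC ler_wpM2r//.
by apply: (le_trans (lerD h1 h2)); rewrite -splitr.
Qed.

Lemma cell_flux_x :
  `|(v10 - v00) * Rintegral leb `[y0, cy] (fun y => (F (cx, y)).1)
    + (v11 - v01) * Rintegral leb `[cy, y0 + hy] (fun y => (F (cx, y)).1)
    - 2^-1 * (edge_flux (A i0 i1) u v (leftE K) - edge_flux (A i0 i1) u v (rightE K))|
  <= Cflux gam H Ainf Lip * (V * cellG).
Proof.
have [hx2 hy2 cxl cyl] := unit_bounds; have [mX mXe mYe cxI cyI] := mids.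
have [[b30 b21 b12 b03] [b20 b02]] := bnd_le.
have x00 : x0 <= x0 <= x0 + hx by rewrite lexx lerDl ltW.
have x11 : x0 <= x0 + hx <= x0 + hx by rewrite lexx lerDl ltW.
have y00 : y0 <= y0 <= y0 + hy by rewrite lexx lerDl ltW.
have y11 : y0 <= y0 + hy <= y0 + hy by rewrite lexx lerDl ltW.
case: (cg) => _ _ _ xh yh hgx hgy hH g1 l1 l2 l3 l4.
have xI : a1 <= cx <= b1 by case/andP: cxI => q1 q2; rewrite (le_trans l1 q1) (le_trans q2 l2).
have Dc y : y0 <= y <= y0 + hy -> Dbar (cx, y) by move=> yI; apply: rK.
have D0 : Dbar (x0, cy) by apply: rK.
have D1 : Dbar (x0 + hx, cy) by apply: rK.
have Dcc : Dbar (cx, cy) by apply: Dc.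
have h20 : 0 <= h / 2 by rewrite divr_ge0// ltW.
have ex : x0 + hx - x0 = hx by rewrite addrC addKr.
have ey : y0 + hy - y0 = hy by rewrite addrC addKr.
have mE0 : edge_mid (leftE K) = (x0, cy) by rewrite /edge_mid /= half_box; congr pair; field.
have mE1 : edge_mid (rightE K) = (x0 + hx, cy) by rewrite /edge_mid /= half_box; congr pair; field.
have cl (f : R * R -> R) : {within Dbar, continuous f} -> {within `[y0, y0 + hy], continuous (fun y => f (cx, y))}.
  by move=> cf; apply: line_continuous_y.
have := @flux_dir R LD hx hy h gam H cellG V Ainf Lip y0 (fun y => A i0 i0 (cx, y)) (fun y => A i0 i1 (cx, y))
  (fun y => (gw (cx, y)).1) (fun y => (gw (cx, y)).2) (fun y => w (cx, y))
  (v10 - v00) (v11 - v01) (v01 - v00) (v11 - v10) (A i0 i1 (x0, cy)) (A i0 i1 (x0 + hx, cy)) (A i0 i1 (cx, cy))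
  LD_valid hx0 hy0 h0 yh hgx hgy hH g1 cellG_ge0 (le_trans (normr_ge0 _) (Ab i0 i0 Dcc)) Lip0 b30 b21 b12 b02.
rewrite /= !mulr0 !mulr1 !addr0 => k.
rewrite /edge_flux mE0 mE1 /=.
apply: k => //.
- by move=> y yI; rewrite coord_unit// mulrBr pd_interp_x// opprD addrA.
- by move=> y yI; rewrite coord_unit// mulrBr pd_interp_y// mXe (_ : 1 - 2^-1 = 2^-1 :> R); [rewrite opprD addrA|field].
- by rewrite /err_interp /interpK /= ex ey mXe subrr mul0r; field.
- by rewrite /err_interp /interpK /= ex ey mXe divff ?gt_eqF//; field.
- by rewrite /err_interp /interpK /= ex ey mXe mYe; field.
- exact: cl.
- exact: cl.
- exact: gw_cont_y.1.
- exact: gw_cont_y.2.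
- by apply: w_FTC_y => //; rewrite ?ltrDl// ltW.
- by apply: w_FTC_y => //; rewrite ?lerDl// ltW.
- by move=> y yI; apply: Ab; exact: Dc.
- move=> y yI; apply: Lip_close => //; rewrite /= ?subrr ?normr0//; first exact: Dc.
  by move: yI => /andP[q1 q2]; rewrite ler_norml; move: yh; lra.
- exact: Ab.
- apply: Lip_close => //=; last by rewrite subrr normr0.
  by rewrite [cx]addrC addrK ger0_norm ?(ltW hx2)// ler_pM2r.
- apply: Lip_close => //=; last by rewrite subrr normr0.
  rewrite (_ : cx - (x0 + hx) = - (hx / 2)); last by field.
  by rewrite normrN ger0_norm ?(ltW hx2)// ler_pM2r.
- by ring.
Qed.

Lemma cell_flux_y :
  `|(v01 - v00) * Rintegral leb `[x0, cx] (fun x => (F (x, cy)).2)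
    + (v11 - v10) * Rintegral leb `[cx, x0 + hx] (fun x => (F (x, cy)).2)
    - 2^-1 * (edge_flux (A i1 i0) u v (bottomE K) - edge_flux (A i1 i0) u v (topE K))|
  <= Cflux gam H Ainf Lip * (V * cellG).
Proof.
(* The summands are exchanged so that the diagonal coefficient comes first, as [flux_dir] expects
   after [swapl]. *)
have sw al be : Rintegral leb `[al, be] (fun x => (F (x, cy)).2)
    = Rintegral leb `[al, be] (fun x => A i1 i1 (x, cy) * (gw (x, cy)).2 + A i1 i0 (x, cy) * (gw (x, cy)).1).
  by apply: eq_Rintegral => x _; exact: addrC.
rewrite (sw x0 cx) (sw cx (x0 + hx)) {sw}.
have [hx2 hy2 cxl cyl] := unit_bounds; have [mX mXe mYe cxI cyI] := mids.
have [[b30 b21 b12 b03] [b20 b02]] := bnd_le.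
have x00 : x0 <= x0 <= x0 + hx by rewrite lexx lerDl ltW.
have x11 : x0 <= x0 + hx <= x0 + hx by rewrite lexx lerDl ltW.
have y00 : y0 <= y0 <= y0 + hy by rewrite lexx lerDl ltW.
have y11 : y0 <= y0 + hy <= y0 + hy by rewrite lexx lerDl ltW.
case: (cg) => _ _ _ xh yh hgx hgy hH g1 l1 l2 l3 l4.
have yI : a2 <= cy <= b2 by case/andP: cyI => q1 q2; rewrite (le_trans l3 q1) (le_trans q2 l4).
have Dc x : x0 <= x <= x0 + hx -> Dbar (x, cy) by move=> xI; apply: rK.
have D0 : Dbar (cx, y0) by apply: rK.
have D1 : Dbar (cx, y0 + hy) by apply: rK.
have Dcc : Dbar (cx, cy) by apply: Dc.
have h20 : 0 <= h / 2 by rewrite divr_ge0// ltW.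
have ex : x0 + hx - x0 = hx by rewrite addrC addKr.
have ey : y0 + hy - y0 = hy by rewrite addrC addKr.
have mE0 : edge_mid (bottomE K) = (cx, y0) by rewrite /edge_mid /= half_box; congr pair; field.
have mE1 : edge_mid (topE K) = (cx, y0 + hy) by rewrite /edge_mid /= half_box; congr pair; field.
have cl (f : R * R -> R) : {within Dbar, continuous f} -> {within `[x0, x0 + hx], continuous (fun x => f (x, cy))}.
  by move=> cf; apply: line_continuous_x.
have := @flux_dir R (swapl LD) hy hx h gam H cellG V Ainf Lip x0 (fun x => A i1 i1 (x, cy)) (fun x => A i1 i0 (x, cy))
  (fun x => (gw (x, cy)).2) (fun x => (gw (x, cy)).1) (fun x => w (x, cy))
  (v01 - v00) (v11 - v10) (v10 - v00) (v11 - v01) (A i1 i0 (cx, y0)) (A i1 i0 (cx, y0 + hy)) (A i1 i0 (cx, cy))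
  (valid_swap LD_valid) hy0 hx0 h0 xh hgy hgx hH g1 cellG_ge0 (le_trans (normr_ge0 _) (Ab i0 i0 Dcc)) Lip0 b03 b12 b21 b20.
rewrite /= !mulr0 !mulr1 !addr0 => k.
rewrite /edge_flux mE0 mE1 /=.
apply: k => //.
- by move=> x xI; rewrite coord_unit// mulrBr pd_interp_y// opprD addrA.
- by move=> x xI; rewrite coord_unit// mulrBr pd_interp_x// mYe (_ : 1 - 2^-1 = 2^-1 :> R); [rewrite opprD addrA|field].
- by rewrite /err_interp /interpK /= ex ey mYe subrr mul0r; field.
- by rewrite /err_interp /interpK /= ex ey mYe divff ?gt_eqF//; field.
- by rewrite /err_interp /interpK /= ex ey mXe mYe; field.
- exact: cl.
- exact: cl.
- exact: gw_cont_x.2.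
- exact: gw_cont_x.1.
- by apply: w_FTC_x => //; rewrite ?ltrDl// ltW.
- by apply: w_FTC_x => //; rewrite ?lerDl// ltW.
- by move=> x xI; apply: Ab; exact: Dc.
- move=> x xI; apply: Lip_close => //; rewrite /= ?subrr ?normr0//; first exact: Dc.
  by move: xI => /andP[q1 q2]; rewrite ler_norml; move: xh; lra.
- exact: Ab.
- apply: Lip_close => //=; first by rewrite subrr normr0.
  by rewrite [cy]addrC addrK ger0_norm ?(ltW hy2)// ler_pM2r.
- apply: Lip_close => //=; first by rewrite subrr normr0.
  rewrite (_ : cy - (y0 + hy) = - (hy / 2)); last by field.
  by rewrite normrN ger0_norm ?(ltW hy2)// ler_pM2r.
- by ring.
Qed.

Variables (c : R * R -> R) (Cc : R).
Hypotheses (Cc0 : 0 <= Cc) (jc : intD c) (cb : {ae mu2, forall z : pT, D z -> `|c z| <= Cc}).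

(** No power of h is gained here; the area factor in [quarter_le] supplies what is needed. *)
Lemma w_le z : x0 <= z.1 <= x0 + hx -> y0 <= z.2 <= y0 + hy ->
  `|w z| <= 2 * Kunit * gam * (1 + H) * cellG.
Proof.
move=> zx zy; have [X01 eX] := unit_coord hx0 zx; have [Y01 eY] := unit_coord hy0 zy.
have := interp_err_le LD_valid X01 Y01; rewrite U_unit eX eY.
have -> : bilin LD ((z.1 - x0) / hx) ((z.2 - y0) / hy) = interpK K u z.
  rewrite /bilin !U_unit /interpK /= !mulr0 !mulr1 !addr0.
  have -> : x0 + hx - x0 = hx by rewrite addrC addKr.
  have -> : y0 + hy - y0 = hy by rewrite addrC addKr.
  by ring.
rewrite -surjective_pairing => k; apply: (le_trans k).
have [[_ b21 b12 _] [b20 b02]] := bnd_le; have [_ _ h0' _ _ _ _ hH g1 _ _ _ _] := cg.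
have K0 := @Kunit_ge0 R; have G0 := cellG_ge0.
have gG : 0 <= gam * cellG by rewrite mulr_ge0// (le_trans ler01).
have {}b21 : bnd LD 2 1 <= H * (gam * cellG).
  by apply: (le_trans b21); rewrite -mulrA mulrCA ler_wpM2r.
have {}b12 : bnd LD 1 2 <= H * (gam * cellG).
  by apply: (le_trans b12); rewrite -mulrA mulrCA ler_wpM2r.
rewrite (_ : 2 * _ * _ * _ * _ = Kunit * (gam * cellG + H * (gam * cellG) + gam * cellG + H * (gam * cellG))); last by ring.
by rewrite ler_wpM2l// !lerD.
Qed.

Lemma w_continuous : {within Dbar, continuous w}.
Proof.
rewrite /err_interp => z; apply: cvgB; first exact: cu.
apply: continuous_subspaceT => {}z; rewrite /interpK.
have c1 : (fun z : R * R => (z.1 - K.1.1) / (K.2.1 - K.1.1)) z' @[z' --> z] --> (z.1 - K.1.1) / (K.2.1 - K.1.1).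
  by apply: cvgM; [apply: cvgB; [exact: cvg_fst|exact: cvg_cst]|exact: cvg_cst].
have c2 : (fun z : R * R => (z.2 - K.1.2) / (K.2.2 - K.1.2)) z' @[z' --> z] --> (z.2 - K.1.2) / (K.2.2 - K.1.2).
  by apply: cvgM; [apply: cvgB; [exact: cvg_snd|exact: cvg_cst]|exact: cvg_cst].
have c1' := cvgB (cvg_cst (1 : R)) c1; have c2' := cvgB (cvg_cst (1 : R)) c2.
apply: cvgD; last by apply: cvgM; [apply: cvgM; [exact: cvg_cst|exact: c1]|exact: c2].
apply: cvgD; last by apply: cvgM; [apply: cvgM; [exact: cvg_cst|exact: c1']|exact: c2].
apply: cvgD; last by apply: cvgM; [apply: cvgM; [exact: cvg_cst|exact: c1]|exact: c2'].
by apply: cvgM; [apply: cvgM; [exact: cvg_cst|exact: c1']|exact: c2'].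
Qed.

Lemma w_measurable : measurable_fun (D : set pT) w.
Proof.
have [mu _ _] := wdu; rewrite /err_interp /interpK.
have m1 : measurable_fun (D : set pT) (fun z => (z.1 - K.1.1) / (K.2.1 - K.1.1)).
  apply: measurable_funM => //; apply: measurable_funB => //.
  exact: measurable_funS measurable_fst.
have m2 : measurable_fun (D : set pT) (fun z => (z.2 - K.1.2) / (K.2.2 - K.1.2)).
  apply: measurable_funM => //; apply: measurable_funB => //.
  exact: measurable_funS measurable_snd.
have n1 : measurable_fun (D : set pT) (fun z => 1 - (z.1 - K.1.1) / (K.2.1 - K.1.1)) by exact: measurable_funB.
have n2 : measurable_fun (D : set pT) (fun z => 1 - (z.2 - K.1.2) / (K.2.2 - K.1.2)) by exact: measurable_funB.
apply: measurable_funB; first exact: mu.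
have m3 (e f : R * R -> R) (k : R) : measurable_fun (D : set pT) e -> measurable_fun (D : set pT) f ->
    measurable_fun (D : set pT) (fun z => k * e z * f z).
  by move=> me mf; apply: measurable_funM => //; apply: measurable_funM.
apply: measurable_funD; last exact: m3.
apply: measurable_funD; last exact: m3.
by apply: measurable_funD; exact: m3.
Qed.

Lemma center_K : Defs.center K = (cx, cy).
Proof. by rewrite /Defs.center /= !half_box. Qed.

(** The quarter at an interior vertex lies in the open Omega, where the almost everywhere bound on c
    holds; at a boundary vertex the term will vanish with v. The area is estimated crudely by
    [hx * hy]. *)
Lemma quarter_le P : P \in verts K -> D P ->
  `|Rintegral mu2 (quarter K P : set pT) (fun z => c z * w z)| <=
    Cc * (2 * Kunit * gam * (1 + H) * cellG) * (hx * hy).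
Proof.
move=> PK DP; set E := 2 * _ * _ * _ * _.
have [hx2 hy2 cxl cyl] := unit_bounds.
have [_ _ _ _ _ _ _ hH g1 l1 l2 l3 l4] := cg.
have E0 : 0 <= E.
  have gam0 : 0 <= gam by exact: le_trans ler01 g1.
  have H0 : 0 <= H := le_trans (ltW h0) hH.
  apply: mulr_ge0; last exact: cellG_ge0.
  apply: mulr_ge0; last by rewrite addr_ge0.
  by apply: mulr_ge0 => //; apply: mulr_ge0 => //; exact: Kunit_ge0.
have [[Px Py] Pd] : (x0 <= P.1 <= x0 + hx /\ y0 <= P.2 <= y0 + hy) /\
    (`|P.1 - cx| <= hx /\ `|P.2 - cy| <= hy).
  have q1 : x0 <= x0 + hx by rewrite lerDl ltW.
  have q2 : y0 <= y0 + hy by rewrite lerDl ltW.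
  have r1 : `|x0 - cx| <= hx.
    by rewrite opprD addrA subrr sub0r normrN gtr0_norm// ler_pdivrMr// ler_pMr// ler1n.
  have r2 : `|y0 - cy| <= hy.
    by rewrite opprD addrA subrr sub0r normrN gtr0_norm// ler_pdivrMr// ler_pMr// ler1n.
  have r3 : `|x0 + hx - cx| <= hx.
    rewrite (_ : _ - _ = hx / 2); last by field.
    by rewrite gtr0_norm// ler_pdivrMr// ler_pMr// ler1n.
  have r4 : `|y0 + hy - cy| <= hy.
    rewrite (_ : _ - _ = hy / 2); last by field.
    by rewrite gtr0_norm// ler_pdivrMr// ler_pMr// ler1n.
  by move: PK; rewrite !inE => /or4P[] /eqP -> /=; rewrite ?lexx ?q1 ?q2.
pose Q : set pT := Omegabar (Num.min P.1 cx) (Num.max P.1 cx) (Num.min P.2 cy) (Num.max P.2 cy).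
have QE : quarter K P = Q by rewrite /quarter center_K.
have mQ : measurable Q by exact: measurable_Omegabar.
have [_ _ _ /andP[cx1 cx2] /andP[cy1 cy2]] := mids.
have QK z : Q z -> x0 <= z.1 <= x0 + hx /\ y0 <= z.2 <= y0 + hy.
  move: Px Py => /andP[p1 p2] /andP[p3 p4] [/andP[q1 q2] /andP[q3 q4]]; split; apply/andP; split.
  - by apply: le_trans q1; rewrite le_min p1.
  - by apply: (le_trans q2); rewrite ge_max p2.
  - by apply: le_trans q3; rewrite le_min p3.
  - by apply: (le_trans q4); rewrite ge_max p4.
have QD : Q `<=` D.
  move=> z; move: DP => [/andP[p1 p2] /andP[p3 p4]] [/andP[q1 q2] /andP[q3 q4]].
  split; apply/andP; split.
  - by apply: lt_le_trans q1; rewrite lt_min p1 (le_lt_trans l1)// ltrDl.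
  - by apply: (le_lt_trans q2); rewrite gt_max p2 (lt_le_trans cxl).
  - by apply: lt_le_trans q3; rewrite lt_min p3 (le_lt_trans l3)// ltrDl.
  - by apply: (le_lt_trans q4); rewrite gt_max p4 (lt_le_trans cyl).
have mD := @measurable_Omega R a1 b1 a2 b2.
have [M _ HM] := continuous_bounded_Omegabar w_continuous.
have jcw : intD (fun z => c z * w z).
  by apply: (@intD_mul _ _ _ _ _ _ _ M jc w_measurable) => z Dz; apply: HM; exact: Omega_sub.
have jQ : mu2.-integrable Q (EFin \o (fun z => c z * w z)) by exact: integrableS jcw.
rewrite QE -lee_fin EFin_normr_Rintegral//.
have mQcw : measurable_fun Q (EFin \o (fun z => c z * w z)) by exact: measurable_int jQ.
apply: (le_trans (le_abse_integral _ mQ mQcw)).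
apply: (@le_trans _ _ (\int[mu2]_(z in Q) (cst (Cc * E)%:E z))%E).
  apply: ae_ge0_le_integral => //.
  - exact: measurableT_comp.
  - by move=> z _; rewrite lee_fin mulr_ge0.
  apply: filterS cb => z hz Qz /=; rewrite lee_fin normrM ler_pM//.
    by apply: hz; exact: QD.
  by have [zx zy] := QK z Qz; exact: w_le.
rewrite integral_cst// [leRHS]EFinM.
apply: lee_wpmul2l; first by rewrite lee_fin mulr_ge0.
have mm (s t : R) : Num.min s t <= Num.max s t by rewrite ge_min le_max lexx.
have md (s t k : R) : `|s - t| <= k -> Num.max s t - Num.min s t <= k.
  by have [st|ts] := leP s t; rewrite ler_norml => /andP[? ?]; lra.
have mQE : (mu2 Q <= ((Num.max P.1 cx - Num.min P.1 cx) * (Num.max P.2 cy - Num.min P.2 cy))%:E)%E.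
  by rewrite (mu2_Omegabar (mm _ _) (mm _ _)).
apply: (le_trans mQE).
rewrite lee_fin ler_pM ?subr_ge0//; apply: md.
  by have [] := Pd.
by have [] := Pd.
Qed.

Hypotheses (vb : forall P, P \in verts K -> hx * hy * `|v P| <= V)
  (vint : forall P, P \in verts K -> v P != 0 -> D P).

(** Summation by parts: the four nodal contributions are regrouped by half midlines. *)
Lemma combine_cell (s00 s10 s01 s11 Qb Qt Ql Qr r00 r10 r01 r11 X Y C1 C2 G : R) :
  `|(s10 - s00) * Qb + (s11 - s01) * Qt - 2^-1 * X| <= C1 * G ->
  `|(s01 - s00) * Ql + (s11 - s10) * Qr - 2^-1 * Y| <= C1 * G ->
  `|s00 * r00| <= C2 * G -> `|s10 * r10| <= C2 * G -> `|s01 * r01| <= C2 * G -> `|s11 * r11| <= C2 * G ->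
  `|s00 * (- (Qb + Ql) + r00) + (s10 * (- (- Qb + Qr) + r10) + (s01 * (- (Qt - Ql) + r01)
     + s11 * (- (- Qt - Qr) + r11))) - 2^-1 * X - 2^-1 * Y| <= (2 * C1 + 4 * C2) * G.
Proof.
move=> hX hY h1 h2 h3 h4.
rewrite (_ : _ - _ - _ = ((s10 - s00) * Qb + (s11 - s01) * Qt - 2^-1 * X)
  + ((s01 - s00) * Ql + (s11 - s10) * Qr - 2^-1 * Y)
  + (s00 * r00 + s10 * r10) + (s01 * r01 + s11 * r11)); last by ring.
rewrite (_ : (2 * C1 + 4 * C2) * G = C1 * G + C1 * G + (C2 * G + C2 * G) + (C2 * G + C2 * G)); last by ring.
by do ![apply: (le_trans (ler_normD _ _)); apply: lerD => //].
Qed.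

(** Two flux directions and four quarters. *)
Definition Ccell : R := 2 * Cflux gam H Ainf Lip + 4 * (Cc * (2 * Kunit * gam * (1 + H))).

(** The two edge differences are what frozen off-diagonal coefficients leave behind; the rest
    carries no power of h, because [V] already contains h times the jumps of v. *)
Lemma cell_le :
  `|\sum_(P <- verts K) v P * (- fluxK K P F + Rintegral mu2 (quarter K P : set pT) (fun z => c z * w z))
    - 2^-1 * (edge_flux (A i0 i1) u v (leftE K) - edge_flux (A i0 i1) u v (rightE K))
    - 2^-1 * (edge_flux (A i1 i0) u v (bottomE K) - edge_flux (A i1 i0) u v (topE K))|
  <= Ccell * (V * cellG).
Proof.
have fx := cell_flux_x; have fy := cell_flux_y.
have qb P : P \in verts K -> `|v P * Rintegral mu2 (quarter K P : set pT) (fun z => c z * w z)|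
    <= Cc * (2 * Kunit * gam * (1 + H)) * (V * cellG).
  move=> PK; have V0 : 0 <= V by apply: le_trans vD0; rewrite mulr_ge0// ltW.
  have g0 : 0 <= Cc * (2 * Kunit * gam * (1 + H)).
    have [_ _ _ _ _ _ _ hH g1 _ _ _ _] := cg.
    have gam0 : 0 <= gam by exact: le_trans ler01 g1.
    have H0 : 0 <= H := le_trans (ltW h0) hH.
    apply: mulr_ge0 => //; apply: mulr_ge0; last by rewrite addr_ge0.
    by apply: mulr_ge0 => //; apply: mulr_ge0 => //; exact: Kunit_ge0.
  have [->|vP] := eqVneq (v P) 0; first by rewrite mul0r normr0 mulr_ge0// mulr_ge0// cellG_ge0.
  rewrite normrM; apply: (le_trans (ler_wpM2l (normr_ge0 _) (quarter_le PK (vint PK vP)))).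
  rewrite [leLHS](_ : _ = Cc * (2 * Kunit * gam * (1 + H)) * (hx * hy * `|v P| * cellG)); last by ring.
  by rewrite ler_wpM2l// ler_wpM2r ?cellG_ge0//; exact: vb.
have q1 := qb (x0, y0); have q2 := qb (x0 + hx, y0).
have q3 := qb (x0, y0 + hy); have q4 := qb (x0 + hx, y0 + hy).
have [f1 f2 f3 f4] := fluxK_verts x0 y0 hx0 hy0 F.
rewrite /verts !big_cons big_nil addr0 f1 f2 f3 f4.
apply: (combine_cell fx fy).
- by apply: q1; rewrite !inE eqxx.
- by apply: q2; rewrite !inE eqxx !orbT.
- by apply: q3; rewrite !inE eqxx !orbT.
- by apply: q4; rewrite !inE eqxx !orbT.
Qed.

End CellEstimate.

(** * A Hoelder inequality for products of cell integrals *)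

Section CellHoelder.
Context {R : realType}.
Local Notation mu2 := (@mu2 R).
Local Notation pT := (measurableTypeR R * measurableTypeR R)%type.
Variables (a1 b1 a2 b2 : R) (ab1 : a1 < b1) (ab2 : a2 < b2).
Local Notation D := (Omega a1 b1 a2 b2).
Local Notation intD := (intD a1 b1 a2 b2).
Implicit Types (f : R * R -> R).

(** Open cells, so that distinct ones are disjoint and all lie in the open Omega. *)
Definition Ro (K : rect R) : set pT := Omega K.1.1 K.2.1 K.1.2 K.2.2.
Definition area (K : rect R) : R := (K.2.1 - K.1.1) * (K.2.2 - K.1.2).
Definition RoInt (K : rect R) f : R := Rintegral mu2 (Ro K) f.

Lemma mRo K : measurable (Ro K). Proof. exact: measurable_Omega. Qed.

Lemma mu2_Ro K : rect_ok K -> mu2 (Ro K) = (area K)%:E.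
Proof. by move=> [k1 k2]; apply: mu2_Omega; exact: ltW. Qed.

Lemma intD_Ro K f : Ro K `<=` D -> intD f -> mu2.-integrable (Ro K) (EFin \o f).
Proof. by move=> KD jf; exact: (integrableS (@measurable_Omega R a1 b1 a2 b2) (mRo K) KD jf). Qed.

Lemma intD_norm f : intD f -> intD (fun z => `|f z|).
Proof. exact: integrable_norm. Qed.

Lemma integrable_lin (A : set pT) (c d : R) f f' : measurable A ->
  mu2.-integrable A (EFin \o f) -> mu2.-integrable A (EFin \o f') ->
  mu2.-integrable A (EFin \o (fun z => c * f z + d * f' z)).
Proof.
move=> mA jf jf'; rewrite (_ : EFin \o _ = (fun z => c%:E * (f z)%:E + d%:E * (f' z)%:E)%E).
  by apply: integrableD => //; exact: integrableZl.
by apply/funext => z /=; rewrite EFinD !EFinM.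
Qed.

Lemma integrable_scale (A : set pT) (c : R) f : measurable A ->
  mu2.-integrable A (EFin \o f) -> mu2.-integrable A (EFin \o (fun z => c * f z)).
Proof.
move=> mA jf; rewrite (_ : EFin \o _ = (fun z => c%:E * (f z)%:E)%E); first exact: integrableZl.
by apply/funext => z /=; rewrite EFinM.
Qed.

(** Young's inequality for [|f x| |f' y|], integrated over K x K one variable at a time. *)
Lemma young_cell K f f' (r s : R) : rect_ok K -> 0 < r -> 0 < s -> r^-1 + s^-1 = 1 ->
  mu2.-integrable (Ro K) (EFin \o (fun z => `|f z|)) -> mu2.-integrable (Ro K) (EFin \o (fun z => `|f' z|)) ->
  mu2.-integrable (Ro K) (EFin \o (fun z => `|f z| `^ r)) ->
  mu2.-integrable (Ro K) (EFin \o (fun z => `|f' z| `^ s)) ->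
  RoInt K (fun z => `|f z|) * RoInt K (fun z => `|f' z|) <=
  area K * (r^-1 * RoInt K (fun z => `|f z| `^ r) + s^-1 * RoInt K (fun z => `|f' z| `^ s)).
Proof.
move=> okK r0 s0 rs jf jf' jfr jfs; have mK := mRo K.
have jc (c : R) : mu2.-integrable (Ro K) (EFin \o (fun=> c)).
  have fin : (mu2 (Ro K) < +oo)%E by rewrite mu2_Ro// ltry.
  apply: measurable_bounded_integrable => //.
  exact: (@bounded_near_ex _ _ (fun=> c) `|c|).
have mass1 : Rintegral mu2 (Ro K) (fun=> 1) = area K.
  have e : fine (mu2 (Ro K)) = area K by rewrite mu2_Ro.
  by rewrite Rintegral_cst// mul1r; exact: e.
have step1 c : 0 <= c -> c * RoInt K (fun z => `|f z|) <=
    r^-1 * RoInt K (fun z => `|f z| `^ r) + s^-1 * c `^ s * area K.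
  move=> c0; rewrite /RoInt -mass1 -!RintegralZl//.
  rewrite -RintegralD; [|exact: mK|exact: integrable_scale|exact: integrable_scale].
  apply: le_Rintegral => //.
  - exact: integrable_scale.
  - exact: integrable_lin.
  move=> z _; have := conjugate_powR (normr_ge0 (f z)) c0 r0 s0 rs.
  by rewrite mulr1 mulrC [_ / r]mulrC [_ / s]mulrC.
set If := RoInt K (fun z => `|f z|).
have -> : area K * (r^-1 * RoInt K (fun z => `|f z| `^ r) + s^-1 * RoInt K (fun z => `|f' z| `^ s)) =
   RoInt K (fun z => (r^-1 * RoInt K (fun z => `|f z| `^ r)) * 1 + (s^-1 * area K) * (`|f' z| `^ s)).
  rewrite {3}/RoInt RintegralD; [|exact: mK|exact: integrable_scale|exact: integrable_scale].
  have distr (k x y z w : R) : k * (x * z + y * w) = x * z * k + y * k * w by ring.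
  by rewrite !RintegralZl// mass1 distr.
rewrite /RoInt -RintegralZl//; apply: le_Rintegral => //.
- exact: integrable_scale.
- exact: integrable_lin.
move=> z _; rewrite mulrC; have := step1 _ (normr_ge0 (f' z)).
by rewrite mulr1 [s^-1 * _ * area K]mulrAC.
Qed.

Variable T : seq (rect R).
Hypotheses (uT : uniq T) (okT : forall K, K \in T -> rect_ok K)
  (TD : forall K, K \in T -> Ro K `<=` D)
  (disT : forall K K', K \in T -> K' \in T -> K != K' -> Ro K `&` Ro K' = set0).

Lemma sum_RoInt_le f : intD f -> (forall z, 0 <= f z) ->
  \sum_(K <- T) RoInt K f <= Rintegral mu2 (D : set pT) f.
Proof.
move=> jf f0; have mD := @measurable_Omega R a1 b1 a2 b2.
have tr : trivIset [set` T] Ro.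
  by move=> K K' KT K'T /set0P KK; apply/eqP; apply: contraT => nK; rewrite disT// eqxx in KK.
have UD : \big[setU/set0]_(K <- T) Ro K `<=` D.
  rewrite -bigcup_seq => z [K KT]; exact: TD.
have mU : measurable (\big[setU/set0]_(K <- T) Ro K) by apply: bigsetU_measurable => K _; exact: mRo.
have mf : measurable_fun (D : set pT) (EFin \o f) by exact: measurable_int jf.
have fin K : K \in T -> (\int[mu2]_(z in Ro K) (f z)%:E)%E \is a fin_num.
  by move=> KT; apply: integrable_fin_num => //; [exact: mRo|apply: intD_Ro => //; exact: TD].
have finD : (\int[mu2]_(z in (D : set pT)) (f z)%:E)%E \is a fin_num by exact: integrable_fin_num.
rewrite -lee_fin -sumEFin.
rewrite (_ : (\sum_(K <- T) _)%E = (\sum_(K <- T) \int[mu2]_(z in Ro K) (f z)%:E)%E); last first.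
  by apply: eq_big_seq => K KT; rewrite /RoInt /Rintegral fineK//; exact: fin.
rewrite -(@ge0_integral_bigsetU _ _ _ mu2 _ Ro (EFin \o f) T mRo uT tr); last 2 first.
- exact: measurable_funS mf.
- by move=> z _ /=; rewrite lee_fin.
rewrite /Rintegral fineK//; apply: ge0_subset_integral => //.
by move=> z _ /=; rewrite lee_fin.
Qed.

(** For normalised functions the cellwise Young inequalities sum to [1/r + 1/s = 1]. The norms may
    vanish, so they are enlarged by [e > 0] before dividing, and [e] tends to 0 at the end. *)
Lemma hoelder_cells f f' (r s : R) : 0 < r -> 0 < s -> r^-1 + s^-1 = 1 ->
  measurable_fun (D : set pT) f -> measurable_fun (D : set pT) f' -> intD f -> intD f' ->
  (LpnormD D r%:E f < +oo)%E -> (LpnormD D s%:E f' < +oo)%E ->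
  \sum_(K <- T) (area K)^-1 * (RoInt K (fun z => `|f z|) * RoInt K (fun z => `|f' z|)) <=
  fine (LpnormD D r%:E f) * fine (LpnormD D s%:E f').
Proof.
move=> r0 s0 rs mf mf' jf jf' lf lf'; have mD := @measurable_Omega R a1 b1 a2 b2.
have jpow h (t : R) : 0 < t -> measurable_fun (D : set pT) h -> (LpnormD D t%:E h < +oo)%E ->
    intD (fun z => `|h z| `^ t) /\ Rintegral mu2 (D : set pT) (fun z => `|h z| `^ t) = fine (LpnormD D t%:E h) `^ t.
  move=> t0 mh lh; have e := Lp_pow (a1 := a1) (b1 := b1) (a2 := a2) (b2 := b2) t0 mh.
  split; last by rewrite /Rintegral -e fine_poweR.
  have mt : measurable_fun (D : set pT) (fun z => `|h z| `^ t).
    by apply: (measurableT_comp (measurable_powR t)); apply: measurableT_comp.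
  apply/integrableP; split; first exact/measurable_EFinP.
  rewrite (_ : (\int[_]_(_ in _) _)%E = (LpnormD D t%:E h `^ t)%E); first exact: poweR_lty.
  by rewrite e; apply: eq_integral => z _ /=; rewrite ger0_norm// powR_ge0.
have [jr er] := jpow f r r0 mf lf; have [js es] := jpow f' s s0 mf' lf'.
set a := fine (LpnormD D r%:E f) in er *; set b := fine (LpnormD D s%:E f') in es *.
have a0 : 0 <= a by rewrite /a fine_ge0//; exact: Lnorm_ge0.
have b0 : 0 <= b by rewrite /b fine_ge0//; exact: Lnorm_ge0.
set X := \sum_(K <- T) _.
suff h e : 0 < e -> X <= (a + e) * (b + e).
  have ce : (fun e : R => (a + e) * (b + e)) e @[e --> 0^'+] --> (a + 0) * (b + 0).
    by apply: cvgM; (apply: cvgD; [exact: cvg_cst|exact: cvg_at_right_filter cvg_id]).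
  rewrite !addr0 in ce; apply: (cvgr_to_ge ce); near=> e; exact: h.
move=> e0; have N0 : 0 < a + e by rewrite ltr_wpDl.
have N0' : 0 < b + e by rewrite ltr_wpDl.
pose F z := f z / (a + e); pose F' z := f' z / (b + e).
have scale h (t N : R) z : 0 < N -> `|h z / N| `^ t = N `^ (- t) * `|h z| `^ t.
  move=> N1; rewrite normrM normfV (gtr0_norm N1) powRM// ?invr_ge0 ?(ltW N1)//.
  by rewrite mulrC -powR_inv1 ?(ltW N1)// -powRrM mulN1r.
have jZ (c : R) h : intD h -> intD (fun z => c * h z).
  exact: integrable_scale.
have jF : intD (fun z => `|F z| `^ r).
  by rewrite (_ : (fun _ => _) = (fun z => (a + e) `^ (- r) * `|f z| `^ r)); [exact: jZ|apply/funext => z; exact: scale].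
have jF' : intD (fun z => `|F' z| `^ s).
  by rewrite (_ : (fun _ => _) = (fun z => (b + e) `^ (- s) * `|f' z| `^ s)); [exact: jZ|apply/funext => z; exact: scale].
have one h (t N c : R) : 0 < t -> 0 < N -> 0 <= c -> c <= N -> intD (fun z => `|h z| `^ t) ->
    Rintegral mu2 (D : set pT) (fun z => `|h z| `^ t) = c `^ t ->
    Rintegral mu2 (D : set pT) (fun z => `|h z / N| `^ t) <= 1.
  move=> t0 N1 c0 cN jh hE.
  rewrite (_ : Rintegral _ _ _ = Rintegral mu2 (D : set pT) (fun z => N `^ (- t) * `|h z| `^ t)); last first.
    by apply: eq_Rintegral => z _; exact: scale.
  rewrite RintegralZl// hE powRN mulrC ler_pdivrMr ?powR_gt0// mul1r.
  by apply: ge0_ler_powR => //; rewrite ?nnegrE// ltW.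
have ae_ : a <= a + e by rewrite lerDl ltW.
have be_ : b <= b + e by rewrite lerDl ltW.
have o1 := one f r (a + e) a r0 N0 a0 ae_ jr er.
have o2 := one f' s (b + e) b s0 N0' b0 be_ js es.
have nrm h (N : R) z : 0 < N -> `|h z| = N * `|h z / N|.
  by move=> N1; rewrite normrM normfV (gtr0_norm N1) mulrC divfK// gt_eqF.
apply: (@le_trans _ _ (\sum_(K <- T) (a + e) * (b + e) *
   (r^-1 * RoInt K (fun z => `|F z| `^ r) + s^-1 * RoInt K (fun z => `|F' z| `^ s)))).
  rewrite /X !big_seq; apply: ler_sum => K KT.
  have ok := okT KT; have ar0 : 0 < area K by case: ok => k1 k2; rewrite mulr_gt0// subr_gt0.
  have KD := TD KT.
  have jFn : intD (fun z => `|F z|).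
    apply: intD_norm; rewrite (_ : F = fun z => (a + e)^-1 * f z); first exact: jZ.
    by apply/funext => z; rewrite mulrC.
  have jFn' : intD (fun z => `|F' z|).
    apply: intD_norm; rewrite (_ : F' = fun z => (b + e)^-1 * f' z); first exact: jZ.
    by apply/funext => z; rewrite mulrC.
  have y := young_cell ok r0 s0 rs (intD_Ro KD jFn) (intD_Ro KD jFn') (intD_Ro KD jF) (intD_Ro KD jF').
  have -> : RoInt K (fun z => `|f z|) = (a + e) * RoInt K (fun z => `|F z|).
    rewrite /RoInt -RintegralZl//; [|exact: mRo|exact: intD_Ro].
    by apply: eq_Rintegral => z _; exact: nrm.
  have -> : RoInt K (fun z => `|f' z|) = (b + e) * RoInt K (fun z => `|F' z|).
    rewrite /RoInt -RintegralZl//; [|exact: mRo|exact: intD_Ro].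
    by apply: eq_Rintegral => z _; exact: nrm.
  rewrite mulrC ler_pdivrMr// [leLHS]mulrACA -[leRHS]mulrA.
  by apply: ler_wpM2l; [rewrite mulr_ge0// ltW|rewrite [leRHS]mulrC].
rewrite -mulr_sumr big_split -[X in _ * (X + _)]mulr_sumr -[X in _ * (_ + X)]mulr_sumr.
apply: ler_piMr; first by apply: mulr_ge0; exact: ltW.
have s1 := sum_RoInt_le jF (fun z => powR_ge0 _ _).
have s2 := sum_RoInt_le jF' (fun z => powR_ge0 _ _).
rewrite -rs lerD// ler_piMr ?invr_ge0 ?(ltW r0) ?(ltW s0)//.
  exact: le_trans s1 o1.
exact: le_trans s2 o2.
Unshelve. all: by end_near. Qed.

(** At this endpoint the inverse area cancels against the integral over K of the essential bound of
    [f]. *)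
Lemma hoelder_cells_oo f f' :
  measurable_fun (D : set pT) f -> measurable_fun (D : set pT) f' -> intD f -> intD f' ->
  (LpnormD D +oo f < +oo)%E -> (LpnormD D 1 f' < +oo)%E ->
  \sum_(K <- T) (area K)^-1 * (RoInt K (fun z => `|f z|) * RoInt K (fun z => `|f' z|)) <=
  fine (LpnormD D +oo f) * fine (LpnormD D 1 f').
Proof.
move=> mf mf' jf jf' lf lf'.
have N0 : 0 <= fine (LpnormD D +oo f) by rewrite fine_ge0//; exact: Lnorm_ge0.
have e1 : Rintegral mu2 (D : set pT) (fun z => `|f' z|) = fine (LpnormD D 1 f').
  have := Lp_pow (a1 := a1) (b1 := b1) (a2 := a2) (b2 := b2) (@ltr01 R) mf'.
  rewrite poweRe1; last exact: Lnorm_ge0.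
  by move=> ->; rewrite /Rintegral; congr fine; apply: eq_integral => z _; rewrite powRr1.
rewrite -e1; apply: (le_trans _ (ler_wpM2l N0 (sum_RoInt_le (intD_norm jf') (fun z => normr_ge0 _)))).
rewrite mulr_sumr !big_seq; apply: ler_sum => K KT.
have ok := okT KT; have ar0 : 0 < area K by case: ok => k1 k2; rewrite mulr_gt0// subr_gt0.
rewrite mulrA ler_wpM2r//; first exact: Rintegral_ge0.
rewrite mulrC ler_pdivrMr// -lee_fin EFinM -mu2_Ro//.
have jfK := intD_Ro (TD KT) (intD_norm jf).
rewrite /RoInt /Rintegral fineK; last by apply: integrable_fin_num => //; exact: mRo.
have := Loo_ae ab1 ab2 lf => hae.
apply: (@le_trans _ _ (\int[mu2]_(z in Ro K) (cst (fine (LpnormD D +oo f))%:E z))%E); last first.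
  by rewrite integral_cst//; exact: mRo.
apply: ae_ge0_le_integral => //.
- exact: mRo.
- exact: measurable_int jfK.
- apply: filterS hae => z hz Kz; rewrite lee_fin; apply: hz; exact: (TD KT).
Qed.

End CellHoelder.

(** * Neighbours, shared edges and telescoping in a conforming mesh *)

Section Mesh.
Context {R : realType}.
Local Notation pt := (R * R)%type.
Local Notation mu2 := (@mu2 R).
Local Notation pT := (measurableTypeR R * measurableTypeR R)%type.
Variables (a1 b1 a2 b2 : R) (T : seq (rect R)).
Local Notation D := (Omega a1 b1 a2 b2).
Local Notation Dbar := (Omegabar a1 b1 a2 b2).

Lemma mid_step_pos (x e : R) : 0 < e -> ~ (x + x) / 2 + e * 1 <= x. Proof. lra. Qed.

Lemma mid_step_neg (x e : R) : 0 < e -> ~ x <= (x + x) / 2 + e * - 1. Proof. lra. Qed.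

Lemma boxE (P Q z : pt) : P.1 <= Q.1 -> P.2 <= Q.2 ->
  box P Q z <-> P.1 <= z.1 <= Q.1 /\ P.2 <= z.2 <= Q.2.
Proof.
by move=> h1 h2; rewrite /box /= (elimT min_idPl h1) (elimT max_idPr h1) (elimT min_idPl h2) (elimT max_idPr h2).
Qed.

Lemma rsetE (K : rect R) z : rect_ok K -> rset K z <-> K.1.1 <= z.1 <= K.2.1 /\ K.1.2 <= z.2 <= K.2.2.
Proof. by move=> [k1 k2]; apply: boxE; exact: ltW. Qed.

Lemma edge_ordered (K : rect R) E : rect_ok K -> E \in edges K -> E.1.1 <= E.2.1 /\ E.1.2 <= E.2.2.
Proof.
by move=> [k1 k2]; rewrite !inE => /or4P[] /eqP -> /=; split => //; exact: ltW.
Qed.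

Lemma edge_mid_not_vert (K : rect R) E : rect_ok K -> E \in edges K -> edge_mid E \notin verts K.
Proof.
move=> [k1 k2]; rewrite /edge_mid !inE => /or4P[] /eqP -> /=; apply/negP => /or4P[] /eqP[]; lra.
Qed.

Lemma edge_mid_unique (K : rect R) E E' : rect_ok K -> E \in edges K -> E' \in edges K ->
  box E'.1 E'.2 (edge_mid E) -> E' = E.
Proof.
move=> okK EK E'K; have [p1 p2] := edge_ordered okK E'K; move/(boxE _ p1 p2).
move: EK E'K; case: okK => k1 k2; rewrite !inE => /or4P[] /eqP -> /or4P[] /eqP -> //=;
  move=> [/andP[h1 h2] /andP[h3 h4]]; exfalso; lra.
Qed.

Lemma edge_mid_rset (K : rect R) E : rect_ok K -> E \in edges K -> rset K (edge_mid E).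
Proof.
move=> okK EK; apply/(rsetE _ okK); case: okK => k1 k2.
by move: EK; rewrite /edge_mid !inE => /or4P[] /eqP -> /=; split; apply/andP; split; lra.
Qed.

Lemma vert_rset (K : rect R) P : rect_ok K -> P \in verts K -> rset K P.
Proof.
move=> okK PK; apply/(rsetE _ okK); case: okK => k1 k2.
by move: PK; rewrite !inE => /or4P[] /eqP -> /=; rewrite ?lexx ?(ltW k1) ?(ltW k2).
Qed.

Hypothesis cT : conforming_partition a1 b1 a2 b2 T.

Lemma T_ok K : K \in T -> rect_ok K. Proof. by case: cT => _ h _ _; exact: h. Qed.

Lemma rset_Dbar K z : K \in T -> rset K z -> Dbar z.
Proof. by case: cT => _ _ h _ KT Kz; rewrite -h; exists K. Qed.

Lemma cell_in_Dbar K : K \in T -> [/\ a1 <= K.1.1, K.2.1 <= b1, a2 <= K.1.2 & K.2.2 <= b2].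
Proof.
move=> KT; have ok := T_ok KT.
have v1 : (K.1.1, K.1.2) \in verts K by rewrite !inE eqxx.
have v2 : (K.2.1, K.2.2) \in verts K by rewrite !inE eqxx !orbT.
have [/= /andP[? _] /andP[? _]] := rset_Dbar KT (vert_rset ok v1).
by have [/= /andP[_ ?] /andP[_ ?]] := rset_Dbar KT (vert_rset ok v2).
Qed.

Lemma Ro_sub K : K \in T -> Ro K `<=` D.
Proof.
move=> KT; have [h1 h2 h3 h4] := cell_in_Dbar KT.
move=> z [/andP[z1 z2] /andP[z3 z4]].
by split; rewrite ?(le_lt_trans h1 z1) ?(lt_le_trans z2 h2) ?(le_lt_trans h3 z3) ?(lt_le_trans z4 h4).
Qed.

(** The midpoint of an edge is no vertex and lies on no other edge of its cell, so of the three
    cases of conformity only a common edge equal to [E] survives. *)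
Lemma shared_edge K K' E : K \in T -> K' \in T -> K != K' -> E \in edges K -> rset K' (edge_mid E) ->
  E \in edges K' /\ rset K `&` rset K' = box E.1 E.2.
Proof.
move=> KT K'T KK EK mK'; have okK := T_ok KT; have mK := edge_mid_rset okK EK.
case: cT => _ _ _ /(_ K K' KT K'T KK)[e0|[[P [PK PK' eP]]|[E' [E'K E'K' eE]]]].
- by exfalso; have : (rset K `&` rset K') (edge_mid E) by []; rewrite e0.
- exfalso; have : (rset K `&` rset K') (edge_mid E) by [].
  by rewrite eP /= => e; move: (edge_mid_not_vert okK EK); rewrite e PK.
- have : (rset K `&` rset K') (edge_mid E) by [].
  by rewrite eE => /(edge_mid_unique okK EK E'K) EE; rewrite -EE.
Qed.

Lemma Ro_disjoint K K' : K \in T -> K' \in T -> K != K' -> Ro K `&` Ro K' = set0.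
Proof.
move=> KT K'T KK; apply/seteqP; split => // z [Kz K'z].
have okK := T_ok KT; have okK' := T_ok K'T.
have sub (Q : rect R) : rect_ok Q -> Ro Q z -> rset Q z.
  by move=> okQ [/andP[? ?] /andP[? ?]]; apply/(rsetE _ okQ); rewrite !ltW.
have zz : (rset K `&` rset K') z by split; exact: sub.
move: Kz => [/andP[z1 z2] /andP[z3 z4]].
case: cT => _ _ _ /(_ K K' KT K'T KK)[e0|[[P [PK PK' eP]]|[E [EK EK' eE]]]].
- by rewrite e0 in zz.
- rewrite eP /= in zz; move: PK; rewrite -zz !inE => /or4P[] /eqP e; move: z1 z2 z3 z4; rewrite e /= ?ltxx//.
- rewrite eE in zz; have [p1 p2] := edge_ordered okK EK; move: zz => /(boxE _ p1 p2).
  by move: EK; rewrite !inE => /or4P[] /eqP -> /= [/andP[? ?] /andP[? ?]]; lra.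
Qed.

(* A short enough step from m meets only cells that already contain m. *)
Lemma small_step (m d : pt) (e0 : R) (s : seq (rect R)) : (forall K, K \in s -> rect_ok K) ->
  `|d.1| <= 1 -> `|d.2| <= 1 -> 0 < e0 ->
  exists e, [/\ 0 < e, e <= e0 & forall K, K \in s -> rset K (m.1 + e * d.1, m.2 + e * d.2) -> rset K m].
Proof.
move=> oks d1 d2 e00.
have gap K : rect_ok K -> exists2 k, 0 < k & forall e, 0 < e -> e < k ->
    rset K (m.1 + e * d.1, m.2 + e * d.2) -> rset K m.
  move=> ok; have [|nK] := pselect (rset K m); first by exists 1.
  have bd (x e : R) : `|x| <= 1 -> 0 < e -> - e <= e * x <= e.
    by move=> x1 e1; rewrite -ler_norml normrM (gtr0_norm e1) ler_piMr// ltW.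
  have nK' : ~ (K.1.1 <= m.1 <= K.2.1 /\ K.1.2 <= m.2 <= K.2.2) by move=> h; apply: nK; apply/rsetE.
  have [h|h] := ltP m.1 K.1.1.
    exists (K.1.1 - m.1); first by rewrite subr_gt0.
    move=> e e1 ek /(rsetE _ ok)[/= /andP[h1 _] _]; have /andP[_ b] := bd _ _ d1 e1; exfalso; lra.
  have [h'|h'] := ltP K.2.1 m.1.
    exists (m.1 - K.2.1); first by rewrite subr_gt0.
    move=> e e1 ek /(rsetE _ ok)[/= /andP[_ h1] _]; have /andP[b _] := bd _ _ d1 e1; exfalso; lra.
  have [k|k] := ltP m.2 K.1.2.
    exists (K.1.2 - m.2); first by rewrite subr_gt0.
    move=> e e1 ek /(rsetE _ ok)[/= _ /andP[h1 _]]; have /andP[_ b] := bd _ _ d2 e1; exfalso; lra.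
  have [k'|k'] := ltP K.2.2 m.2.
    exists (m.2 - K.2.2); first by rewrite subr_gt0.
    move=> e e1 ek /(rsetE _ ok)[/= _ /andP[_ h1]]; have /andP[b _] := bd _ _ d2 e1; exfalso; lra.
  by exfalso; apply: nK'; rewrite h h' k k'.
have : exists2 k, 0 < k & forall K, K \in s -> forall e, 0 < e -> e < k ->
    rset K (m.1 + e * d.1, m.2 + e * d.2) -> rset K m.
  elim: s oks => [|Q s ih] oks; first by exists 1.
  have [k k0 hk] := ih (fun K Ks => oks K (@mem_behead _ (Q :: s) K Ks)).
  have [k' k'0 hk'] := gap Q (oks Q (mem_head _ _)).
  exists (Num.min k k'); first by rewrite lt_min k0.
  move=> K; rewrite inE => /orP[/eqP ->|Ks] e e1; rewrite lt_min => /andP[ek ek'].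
    exact: hk'.
  exact: hk.
move=> [k k0 hk]; exists (Num.min (k / 2) e0); split.
- by rewrite lt_min divr_gt0.
- by rewrite ge_min lexx orbT.
- move=> K Ks; apply: hk => //; first by rewrite lt_min divr_gt0.
  by rewrite gt_min ltr_pdivrMr// ltr_pMr// ltr1n.
Qed.

(** A step from the midpoint along [d] stays in the closed domain but leaves K, hence lands in
    another cell; for a short step that cell contains the midpoint, and [shared_edge] applies. *)
Lemma neighbour K E (d : pt) (e0 : R) : K \in T -> E \in edges K -> `|d.1| <= 1 -> `|d.2| <= 1 -> 0 < e0 ->
  (forall e, 0 < e -> e <= e0 -> Dbar ((edge_mid E).1 + e * d.1, (edge_mid E).2 + e * d.2)) ->
  (forall e, 0 < e -> ~ rset K ((edge_mid E).1 + e * d.1, (edge_mid E).2 + e * d.2)) ->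
  exists K' e, [/\ K' \in T, E \in edges K', 0 < e &
    rset K' ((edge_mid E).1 + e * d.1, (edge_mid E).2 + e * d.2)].
Proof.
move=> KT EK d1 d2 e00 inD outK.
have [e [e1 ee0 he]] := small_step (edge_mid E) T_ok d1 d2 e00.
have := inD e e1 ee0; case: (cT) => _ _ <- _ [K' K'T K'e].
have KK : K != K' by apply/negP => /eqP KK; apply: (outK e e1); rewrite KK.
have [EK' _] := shared_edge KT K'T KK EK (he K' K'T K'e).
by exists K', e.
Qed.

Lemma right_neighbour K : K \in T -> K.2.1 < b1 -> exists2 K', K' \in T & leftE K' = rightE K.
Proof.
move=> KT Kb; have ok := T_ok KT; have [k1 k2] := ok; have [h1 h2 h3 h4] := cell_in_Dbar KT.
have EK : rightE K \in edges K by rewrite !inE eqxx !orbT.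
have [|||||K' [e [K'T EK' e0 K'e]]] := @neighbour K (rightE K) (1, 0) (b1 - K.2.1) KT EK.
- by rewrite normr1.
- by rewrite normr0.
- by rewrite subr_gt0.
- by move=> e e0 eb; rewrite /edge_mid /=; split => /=; apply/andP; split; lra.
- by move=> e e0 /(rsetE _ ok); rewrite /edge_mid /= => -[/andP[_ ?] _]; lra.
exists K' => //; have ok' := T_ok K'T; have [k1' k2'] := ok'.
move: K'e => /(rsetE _ ok'); rewrite /edge_mid /= => -[/andP[q1 q2] _].
(* The common edge is one of the four edges of K'. Its direction excludes the horizontal ones, and
   the step to the right excludes the right one. *)
move: EK'; rewrite !inE => /or4P[] /eqP [e1 e2 e3 e4].
- by move: k2; rewrite e2 e4 ltxx.
- by move: k2; rewrite e2 e4 ltxx.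
- by rewrite /leftE /rightE e1 e2 e4.
- by exfalso; rewrite -e1 in q2; exact: (mid_step_pos e0 q2).
Qed.

Lemma left_neighbour K : K \in T -> a1 < K.1.1 -> exists2 K', K' \in T & rightE K' = leftE K.
Proof.
move=> KT Kb; have ok := T_ok KT; have [k1 k2] := ok; have [h1 h2 h3 h4] := cell_in_Dbar KT.
have EK : leftE K \in edges K by rewrite !inE eqxx !orbT.
have [|||||K' [e [K'T EK' e0 K'e]]] := @neighbour K (leftE K) (- 1, 0) (K.1.1 - a1) KT EK.
- by rewrite normrN1.
- by rewrite normr0.
- by rewrite subr_gt0.
- by move=> e e0 eb; rewrite /edge_mid /=; split => /=; apply/andP; split; lra.
- by move=> e e0 /(rsetE _ ok); rewrite /edge_mid /= => -[/andP[? _] _]; lra.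
exists K' => //; have ok' := T_ok K'T; have [k1' k2'] := ok'.
move: K'e => /(rsetE _ ok'); rewrite /edge_mid /= => -[/andP[q1 q2] _].
move: EK'; rewrite !inE => /or4P[] /eqP [e1 e2 e3 e4].
- by move: k2; rewrite e2 e4 ltxx.
- by move: k2; rewrite e2 e4 ltxx.
- by exfalso; rewrite -e1 in q1; exact: (mid_step_neg e0 q1).
- by rewrite /leftE /rightE e1 e2 e4.
Qed.

Lemma top_neighbour K : K \in T -> K.2.2 < b2 -> exists2 K', K' \in T & bottomE K' = topE K.
Proof.
move=> KT Kb; have ok := T_ok KT; have [k1 k2] := ok; have [h1 h2 h3 h4] := cell_in_Dbar KT.
have EK : topE K \in edges K by rewrite !inE eqxx !orbT.
have [|||||K' [e [K'T EK' e0 K'e]]] := @neighbour K (topE K) (0, 1) (b2 - K.2.2) KT EK.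
- by rewrite normr0.
- by rewrite normr1.
- by rewrite subr_gt0.
- by move=> e e0 eb; rewrite /edge_mid /=; split => /=; apply/andP; split; lra.
- by move=> e e0 /(rsetE _ ok); rewrite /edge_mid /= => -[_ /andP[_ ?]]; lra.
exists K' => //; have ok' := T_ok K'T; have [k1' k2'] := ok'.
move: K'e => /(rsetE _ ok'); rewrite /edge_mid /= => -[_ /andP[q1 q2]].
move: EK'; rewrite !inE => /or4P[] /eqP [e1 e2 e3 e4].
- by rewrite /bottomE /topE e1 e2 e3.
- by exfalso; rewrite -e2 in q2; exact: (mid_step_pos e0 q2).
- by move: k1; rewrite e1 e3 ltxx.
- by move: k1; rewrite e1 e3 ltxx.
Qed.

Lemma bottom_neighbour K : K \in T -> a2 < K.1.2 -> exists2 K', K' \in T & topE K' = bottomE K.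
Proof.
move=> KT Kb; have ok := T_ok KT; have [k1 k2] := ok; have [h1 h2 h3 h4] := cell_in_Dbar KT.
have EK : bottomE K \in edges K by rewrite !inE eqxx ?orbT.
have [|||||K' [e [K'T EK' e0 K'e]]] := @neighbour K (bottomE K) (0, - 1) (K.1.2 - a2) KT EK.
- by rewrite normr0.
- by rewrite normrN1.
- by rewrite subr_gt0.
- by move=> e e0 eb; rewrite /edge_mid /=; split => /=; apply/andP; split; lra.
- by move=> e e0 /(rsetE _ ok); rewrite /edge_mid /= => -[_ /andP[? _]]; lra.
exists K' => //; have ok' := T_ok K'T; have [k1' k2'] := ok'.
move: K'e => /(rsetE _ ok'); rewrite /edge_mid /= => -[_ /andP[q1 q2]].
move: EK'; rewrite !inE => /or4P[] /eqP [e1 e2 e3 e4].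
- by exfalso; rewrite -e2 in q1; exact: (mid_step_neg e0 q1).
- by rewrite /bottomE /topE e1 e2 e3.
- by move: k1; rewrite e1 e3 ltxx.
- by move: k1; rewrite e1 e3 ltxx.
Qed.

Lemma Ro_inj K K' z : K \in T -> K' \in T -> Ro K z -> Ro K' z -> K = K'.
Proof.
move=> KT K'T Kz K'z; have [//|KK] := eqVneq K K'.
have : (Ro K `&` Ro K') z by [].
by rewrite Ro_disjoint.
Qed.

(** Two cells on the same side of the same edge overlap near its middle, hence coincide. *)
Lemma edges_inj : [/\ {in T &, injective (@leftE R)}, {in T &, injective (@rightE R)},
  {in T &, injective (@bottomE R)} & {in T &, injective (@topE R)}].
Proof.
have mid (x x' y y' : R) : x < x' -> y < y' -> exists t, [/\ 0 < t, t < x' - x & t < y' - y].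
  rewrite -(subr_gt0 x) -(subr_gt0 y); move: (x' - x) (y' - y) => {}x {}y x0 y0.
  exists (Num.min x y / 2); have m0 : 0 < Num.min x y by rewrite lt_min x0.
  have m1 : Num.min x y <= x by rewrite ge_min lexx.
  have m2 : Num.min x y <= y by rewrite ge_min lexx orbT.
  by split; lra.
have in_mid (x y : R) : x < y -> x < (x + y) / 2 < y by move=> xy; apply/andP; split; lra.
have from_left (x y t : R) : 0 < t -> t < y - x -> x < x + t < y.
  by move=> t0 tx; apply/andP; split; lra.
have from_right (x y t : R) : 0 < t -> t < y - x -> x < y - t < y.
  by move=> t0 tx; apply/andP; split; lra.
split=> -[[x0 y0] [x1 y1]] [[x0' y0'] [x1' y1']] KT + eE.
- case: eE => <- <- _ <- K'T; have [/= k1 k2] := T_ok KT; have [/= k1' _] := T_ok K'T.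
  have [t [t0 t1 t2]] := mid _ _ _ _ k1 k1'.
  by apply: (Ro_inj KT K'T (z := (x0 + t, (y0 + y1) / 2))); (split; [exact: from_left|exact: in_mid]).
- case: eE => <- <- _ <- K'T; have [/= k1 k2] := T_ok KT; have [/= k1' _] := T_ok K'T.
  have [t [t0 t1 t2]] := mid _ _ _ _ k1 k1'.
  by apply: (Ro_inj KT K'T (z := (x1 - t, (y0 + y1) / 2))); (split; [exact: from_right|exact: in_mid]).
- case: eE => <- <- <- _ K'T; have [/= k1 k2] := T_ok KT; have [/= _ k2'] := T_ok K'T.
  have [t [t0 t1 t2]] := mid _ _ _ _ k2 k2'.
  by apply: (Ro_inj KT K'T (z := ((x0 + x1) / 2, y0 + t))); (split; [exact: in_mid|exact: from_left]).
- case: eE => <- <- <- _ K'T; have [/= k1 k2] := T_ok KT; have [/= _ k2'] := T_ok K'T.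
  have [t [t0 t1 t2]] := mid _ _ _ _ k2 k2'.
  by apply: (Ro_inj KT K'T (z := ((x0 + x1) / 2, y1 - t))); (split; [exact: in_mid|exact: from_right]).
Qed.

(** On the edges where [phi] is nonzero, [f] and [f'] have the same image, each edge being attained
    once; the two sums run over permuted lists. *)
Lemma telescope (f f' : rect R -> pt * pt) (phi : pt * pt -> R) :
  {in T &, injective f} -> {in T &, injective f'} ->
  (forall K, K \in T -> phi (f K) = 0 \/ exists2 K', K' \in T & f' K' = f K) ->
  (forall K, K \in T -> phi (f' K) = 0 \/ exists2 K', K' \in T & f K' = f' K) ->
  \sum_(K <- T) phi (f K) = \sum_(K <- T) phi (f' K).
Proof.
case: (cT) => uT _ _ _ If If' ff' f'f.
rewrite -(big_map f predT phi) -(big_map f' predT phi).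
have supp (s : seq (pt * pt)) : \sum_(E <- s) phi E = \sum_(E <- [seq E <- s | phi E != 0]) phi E.
  rewrite big_filter (bigID (fun E => phi E != 0)) /= [X in _ + X]big1 ?addr0// => E.
  by rewrite negbK => /eqP.
rewrite supp [RHS]supp; apply: perm_big; apply: uniq_perm.
- by rewrite filter_uniq// map_inj_in_uniq.
- by rewrite filter_uniq// map_inj_in_uniq.
move=> E; rewrite !mem_filter; have [//|pE] := eqVneq (phi E) 0; rewrite /=.
apply/mapP/mapP => -[K KT EK].
  by have [e|[K' K'T e]] := ff' K KT; [rewrite EK e eqxx in pE|exists K' => //; rewrite e].
by have [e|[K' K'T e]] := f'f K KT; [rewrite EK e eqxx in pE|exists K' => //; rewrite e].
Qed.

(** On a boundary edge v vanishes at both ends and the flux with it; across every other edge there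
    is a neighbour, for which it is the opposite side. *)
Lemma telescope_edge_flux a u v : (forall z, bdOmega a1 b1 a2 b2 z -> v z = 0) ->
  \sum_(K <- T) edge_flux a u v (leftE K) = \sum_(K <- T) edge_flux a u v (rightE K) /\
  \sum_(K <- T) edge_flux a u v (bottomE K) = \sum_(K <- T) edge_flux a u v (topE K).
Proof.
move=> v0; have [i1 i2 i3 i4] := edges_inj.
have bd K E : K \in T -> E \in edges K -> ~ D E.1 -> ~ D E.2 -> edge_flux a u v E = 0.
  move=> KT EK n1 n2; have ok := T_ok KT.
  have b P : P \in verts K -> ~ D P -> v P = 0.
    by move=> PK nP; apply: v0; split => //; apply: (rset_Dbar KT); exact: vert_rset.
  have [p1 p2] : E.1 \in verts K /\ E.2 \in verts K.
    by move: EK; rewrite !inE => /or4P[] /eqP -> /=; rewrite !eqxx ?orbT.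
  by rewrite /edge_flux (b _ p1 n1) (b _ p2 n2) subrr mul0r.
split; apply: telescope => // K KT; have [h1 h2 h3 h4] := cell_in_Dbar KT.
- have [/(left_neighbour KT)|k] := ltP a1 K.1.1; first by right.
  by left; apply: (bd K); rewrite // ?inE ?eqxx ?orbT// => -[/= /andP[]]; lra.
- have [/(right_neighbour KT)|k] := ltP K.2.1 b1; first by right.
  by left; apply: (bd K); rewrite // ?inE ?eqxx ?orbT// => -[/= /andP[]]; lra.
- have [/(bottom_neighbour KT)|k] := ltP a2 K.1.2; first by right.
  by left; apply: (bd K); rewrite // ?inE ?eqxx ?orbT// => -[/= _ /andP[]]; lra.
- have [/(top_neighbour KT)|k] := ltP K.2.2 b2; first by right.
  by left; apply: (bd K); rewrite // ?inE ?eqxx ?orbT// => -[/= _ /andP[]]; lra.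
Qed.

(** Exchange of the two summations; boundary nodes can be added because v vanishes there. *)
Lemma ah_cellwise A c wK gwK v : (forall z, bdOmega a1 b1 a2 b2 z -> v z = 0) ->
  ah a1 b1 a2 b2 T A c wK gwK (Pistar v) =
  \sum_(K <- T) \sum_(P <- verts K) v P * (- fluxK K P (fun x => matvec A x (gwK K x))
                + Rintegral mu2 (quarter K P : set pT) (fun x => c x * wK K x)).
Proof.
move=> v0; rewrite /ah /Pistar.
under eq_bigr do rewrite mulr_sumr.
rewrite big_mkcond /=.
under eq_bigr => P _ do rewrite (big_mkcond (fun K => P \in verts K)).
transitivity (\sum_(P <- nodes T) \sum_(K <- T) (if P \in verts K then
   v P * (- fluxK K P (fun x => matvec A x (gwK K x))
                + Rintegral mu2 (quarter K P : set pT) (fun x => c x * wK K x)) else 0)).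
  apply: eq_big_seq => P; rewrite mem_undup => /flattenP[s /mapP[K KT ->] PK].
  case: ifPn => // nP; rewrite big1// => K' _; case: ifP => // _.
  rewrite v0 ?mul0r//; split; first exact: (rset_Dbar KT (vert_rset (T_ok KT) PK)).
  by move=> [e1 e2]; move: nP; rewrite /interior_node e1 e2.
rewrite exchange_big /=; apply: eq_big_seq => K KT.
rewrite -big_mkcond /= -big_filter; apply: perm_big; apply: uniq_perm.
- by rewrite filter_uniq// undup_uniq.
- have [k1 k2] := T_ok KT; rewrite /= !inE !xpair_eqE !eqxx /= !andbT (lt_eqF k1) (lt_eqF k2) /=.
  by rewrite ?andbF ?eq_sym ?(gt_eqF k1) ?(lt_eqF k1) ?(gt_eqF k2).
move=> P; rewrite mem_filter; case PK : (P \in verts K) => //=.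
by rewrite mem_undup; apply/flattenP; exists (verts K) => //; exact: map_f.
Qed.

End Mesh.

(** * Nodal values and jumps of v on a cell of the mesh *)

Section CellNodalBounds.
Context {R : realType}.
Variables (a1 b1 a2 b2 x0 y0 hx hy h gam H : R).
Hypothesis cg : cell_geometry a1 b1 a2 b2 x0 y0 hx hy h gam H.
Local Notation D := (Omega a1 b1 a2 b2).
Local Notation intD := (intD a1 b1 a2 b2).
Local Notation K := (((x0, y0), (x0 + hx, y0 + hy)) : rect R).
Local Notation L1 := (L1K x0 y0 hx hy).
Variables (q : \bar R) (v : R * R -> R) (gv : nat -> nat -> R * R -> R).
Hypotheses (wdv : weak_derivs D 1 q v gv) (jv : intD v)
  (jgv : forall i j, (i + j <= 1)%N -> intD (gv i j)).
Variables (al be ga de : R).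
Hypothesis vE : forall z, rset K z -> v z = al + be * z.1 + ga * z.2 + de * z.1 * z.2.

Definition cellW : R := L1 (gv 0 0) + L1 (gv 1 0) + L1 (gv 0 1).
(** 25 and 64 are those of [nodal_bounds]; the jumps have 5 in place of 25 but pick up [h / hy] or
    [h / hx], at most [gam]. *)
Definition Cnode : R := 25 * (64 * tpM ^+ 2) * gam.

Lemma prod_le (k k' t s s' l l' : R) : 0 <= k -> k <= k' -> 0 <= t -> 0 <= s -> s <= s' -> 0 <= l -> l <= l' ->
  k * t * s * l <= k' * t * s' * l'.
Proof.
move=> k0 kk t0 s0 ss l0 ll; apply: ler_pM => //; first by rewrite !mulr_ge0.
by apply: ler_pM => //; [rewrite mulr_ge0|rewrite ler_wpM2r].
Qed.

Lemma le_sum3 (x y z : R) : 0 <= x -> 0 <= y -> 0 <= z -> [/\ x <= x + y + z, y <= x + y + z & z <= x + y + z].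
Proof. by move=> *; split; lra. Qed.

Lemma nodal_le : let V := Cnode * cellW in
  [/\ h * `|v (x0 + hx, y0) - v (x0, y0)| <= V,
      h * `|v (x0 + hx, y0 + hy) - v (x0, y0 + hy)| <= V,
      h * `|v (x0, y0 + hy) - v (x0, y0)| <= V,
      h * `|v (x0 + hx, y0 + hy) - v (x0 + hx, y0)| <= V &
      forall P, P \in verts K -> hx * hy * `|v P| <= V].
Proof.
move=> V; have [hx0 hy0 h0 xh yh hgx hgy hH g1 l1 l2 l3 l4] := cg.
have ok : rect_ok K by split; rewrite /= ltrDl.
(* Coefficients of v in the unit coordinates of the cell. *)
pose al' := al + be * x0 + ga * y0 + de * x0 * y0.
pose be' := hx * (be + de * y0); pose ga' := hy * (ga + de * x0); pose de' := hx * hy * de.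
have vE' z : rset K z -> v z = al' + be' * ((z.1 - x0) / hx) + ga' * ((z.2 - y0) / hy)
   + de' * ((z.1 - x0) / hx) * ((z.2 - y0) / hy).
  by move=> Kz; rewrite vE// /al' /be' /ga' /de'; field; rewrite !gt_eqF.
have vO z : Omega x0 (x0 + hx) y0 (y0 + hy) z -> v z = al' + be' * ((z.1 - x0) / hx)
   + ga' * ((z.2 - y0) / hy) + de' * ((z.1 - x0) / hx) * ((z.2 - y0) / hy).
  by move=> [/andP[? ?] /andP[? ?]]; apply: vE'; apply/(rsetE _ ok); rewrite !ltW.
have nb := nodal_bounds hx0 hy0 l1 l2 l3 l4 wdv jv jgv vO.
have vv X Y : 0 <= X <= 1 -> 0 <= Y <= 1 ->
   v (x0 + hx * X, y0 + hy * Y) = al' + be' * X + ga' * Y + de' * X * Y.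
  move=> /andP[X0 X1] /andP[Y0 Y1]; rewrite vE' /=.
    by field; rewrite !gt_eqF.
  apply/(rsetE _ ok); rewrite /= !lerDl !lerD2l !mulr_ge0 ?(ltW hx0) ?(ltW hy0)//.
  by rewrite !ger_pMr.
have z01 := @zero01 R; have o01 := @one01 R.
have v00 : v (x0, y0) = al' by have := vv 0 0 z01 z01; rewrite !mulr0 !addr0.
have v10 : v (x0 + hx, y0) = al' + be' by have := vv 1 0 o01 z01; rewrite !mulr0 !addr0 !mulr1.
have v01 : v (x0, y0 + hy) = al' + ga' by have := vv 0 1 z01 o01; rewrite !mulr0 !mul0r !addr0 !mulr1.
have v11 : v (x0 + hx, y0 + hy) = al' + be' + ga' + de' by have := vv 1 1 o01 o01; rewrite !mulr1.
have W0 : [/\ 0 <= L1 (gv 0 0), 0 <= L1 (gv 1 0) & 0 <= L1 (gv 0 1)] by split; exact: L1K_ge0.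
have W1 : [/\ L1 (gv 0 0) <= cellW, L1 (gv 1 0) <= cellW & L1 (gv 0 1) <= cellW].
  by case: W0 => *; exact: le_sum3.
case: W0 W1 => w00 w10 w01 [W00 W10 W01].
have t0 : 0 <= 64 * (tpM : R) ^+ 2 by rewrite mulr_ge0// tpM2_ge0.
have stepx d : `|d| <= 5 * (hx * (64 * tpM ^+ 2 / (hx * hy) * L1 (gv 1 0))) -> h * `|d| <= V.
  move=> hd; apply: (le_trans (ler_wpM2l (ltW h0) hd)).
  rewrite [leLHS](_ : _ = 5 * (64 * tpM ^+ 2) * (h / hy) * L1 (gv 1 0)); last by field; rewrite !gt_eqF.
  apply: (prod_le (ler0n _ _) _ t0 (divr_ge0 (ltW h0) (ltW hy0)) _ w10 W10); last by rewrite ler_pdivrMr.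
  by rewrite ler_nat.
have stepy d : `|d| <= 5 * (hy * (64 * tpM ^+ 2 / (hx * hy) * L1 (gv 0 1))) -> h * `|d| <= V.
  move=> hd; apply: (le_trans (ler_wpM2l (ltW h0) hd)).
  rewrite [leLHS](_ : _ = 5 * (64 * tpM ^+ 2) * (h / hx) * L1 (gv 0 1)); last by field; rewrite !gt_eqF.
  apply: (prod_le (ler0n _ _) _ t0 (divr_ge0 (ltW h0) (ltW hx0)) _ w01 W01); last by rewrite ler_pdivrMr.
  by rewrite ler_nat.
have stepv d : `|d| <= 25 * (64 * tpM ^+ 2 / (hx * hy) * L1 (gv 0 0)) -> hx * hy * `|d| <= V.
  move=> hd; have hh0 : 0 <= hx * hy by rewrite mulr_ge0 ?(ltW hx0) ?(ltW hy0).
  apply: (le_trans (ler_wpM2l hh0 hd)).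
  rewrite [leLHS](_ : _ = 25 * (64 * tpM ^+ 2) * 1 * L1 (gv 0 0)); last by field; rewrite !gt_eqF.
  exact: (prod_le (ler0n _ _) (lexx _) t0 ler01 g1 w00 W00).
split.
- apply: stepx; have [_ + _] := nb 0 0 z01 z01; congr (_ <= _); congr (`|_|).
  by rewrite v10 v00; ring.
- apply: stepx; have [_ + _] := nb 0 1 z01 o01; congr (_ <= _); congr (`|_|).
  by rewrite v11 v01; ring.
- apply: stepy; have [_ _] := nb 0 0 z01 z01; congr (_ <= _); congr (`|_|).
  by rewrite v01 v00; ring.
- apply: stepy; have [_ _] := nb 1 0 o01 z01; congr (_ <= _); congr (`|_|).
  by rewrite v11 v10; ring.
- move=> P; rewrite !inE => /or4P[] /eqP -> /=; apply: stepv.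
  + by rewrite v00; have [+ _ _] := nb 0 0 z01 z01; rewrite !mulr0 !addr0.
  + by rewrite v10; have [+ _ _] := nb 1 0 o01 z01; rewrite !mulr0 !addr0 !mulr1.
  + by rewrite v01; have [+ _ _] := nb 0 1 z01 o01; rewrite !mulr0 !mul0r !addr0 !mulr1.
  + by rewrite v11; have [+ _ _] := nb 1 1 o01 o01; rewrite !mulr1.
Qed.

End CellNodalBounds.

(** * From cells to Sobolev norms *)

Section Assembly.
Context {R : realType}.
Local Notation pT := (measurableTypeR R * measurableTypeR R)%type.
Variables (a1 b1 a2 b2 : R) (ab1 : a1 < b1) (ab2 : a2 < b2).
Local Notation D := (Omega a1 b1 a2 b2).
Local Notation intD := (intD a1 b1 a2 b2).

Lemma conj_exp_ge1 (p q : \bar R) : (2%:E <= p)%E -> conj_exp p q -> (1 <= p)%E /\ (1 <= q)%E.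
Proof.
move=> p2 pq; split; first by apply: le_trans p2; rewrite lee_fin ler1n.
case: pq => [[_ ->]//|[[_ ->]|[r [s [_ -> r0 s0 rs]]]]]; first exact: leey.
rewrite lee_fin -[s]invrK invf_ge1 ?invr_gt0// -rs lerDr invr_ge0; exact: ltW.
Qed.

Lemma weak_derivs_intD (m : nat) (p : \bar R) u (g : nat -> nat -> R * R -> R) i j : (1 <= p)%E ->
  weak_derivs D m p u g -> (i + j <= m)%N -> intD (g i j).
Proof. by move=> p1 [_ _ h] /h[mg lg _]; exact: (Lp_intD ab1 ab2 mg p1 lg). Qed.

Lemma sobnormE (m : nat) (p : \bar R) u (g : nat -> nat -> R * R -> R) : weak_derivs D m p u g ->
  sobnorm D m p g =
  (\sum_(i < m.+1) \sum_(j < m.+1 | (i + j <= m)%N) fine (LpnormD D p (g i j)))%:E.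
Proof.
move=> [_ _ h]; rewrite /sobnorm -sumEFin; apply: eq_bigr => i _; rewrite -sumEFin.
apply: eq_bigr => j ij; have [_ lg _] := h _ _ ij; rewrite fineK//.
by rewrite ge0_fin_numE//; exact: Lnorm_ge0.
Qed.

Lemma diam_bounds (K : rect R) : rect_ok K ->
  [/\ K.2.1 - K.1.1 <= diam K, K.2.2 - K.1.2 <= diam K, 0 < diam K,
      diam K <= (K.2.1 - K.1.1) + (K.2.2 - K.1.2) & rho K <= diam K].
Proof.
move=> [k1 k2]; rewrite /diam /rho.
have : 0 < K.2.1 - K.1.1 by rewrite subr_gt0.
have : 0 < K.2.2 - K.1.2 by rewrite subr_gt0.
move: (K.2.1 - _) (K.2.2 - _) => x y y0 x0.
have sx : x <= Num.sqrt (x ^+ 2 + y ^+ 2).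
  by rewrite -{1}(ger0_norm (ltW x0)) -sqrtr_sqr ler_sqrt ?lerDl ?sqr_ge0 ?addr_ge0 ?sqr_ge0.
have sy : y <= Num.sqrt (x ^+ 2 + y ^+ 2).
  by rewrite -{1}(ger0_norm (ltW y0)) -sqrtr_sqr ler_sqrt ?lerDr ?sqr_ge0 ?addr_ge0 ?sqr_ge0.
split=> //; first exact: lt_le_trans sx.
- rewrite -[leRHS]ger0_norm; last by rewrite addr_ge0 ?ltW.
  rewrite -sqrtr_sqr ler_wsqrtr// sqrrD lerD2r lerDl mulrn_wge0// mulr_ge0 ?ltW//.
- by rewrite ge_min sx.
Qed.

Section Partition.
Variables (T : seq (rect R)) (gamma : R).
Hypotheses (cT : conforming_partition a1 b1 a2 b2 T) (rT : regular gamma T).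

Lemma diam_hmax K : K \in T -> diam K <= hmax T.
Proof. by move=> KT; exact: (le_bigmax_seq 0 K predT (@diam R) KT isT). Qed.

Lemma area_hmax K : K \in T -> 0 < area K /\ area K <= hmax T ^+ 2.
Proof.
move=> KT; have ok := T_ok cT KT; have [k1 k2] := ok; have [dx dy d0 _ _] := diam_bounds ok.
have x0 : 0 < K.2.1 - K.1.1 by rewrite subr_gt0.
have y0 : 0 < K.2.2 - K.1.2 by rewrite subr_gt0.
split; first by rewrite mulr_gt0.
have dh := diam_hmax KT.
by rewrite /area expr2 ler_pM ?(ltW x0) ?(ltW y0) ?(le_trans _ dh).
Qed.

(** The ratio is replaced by its maximum with 1 because the cell estimates use [1 <= gam]; the last
    argument, half the perimeter of Omega, bounds every diameter. *)
Lemma geometryT x0 y0 hx hy : ((x0, y0), (x0 + hx, y0 + hy)) \in T ->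
  cell_geometry a1 b1 a2 b2 x0 y0 hx hy (diam ((x0, y0), (x0 + hx, y0 + hy)))
    (Num.max 1 gamma) ((b1 - a1) + (b2 - a2)).
Proof.
move=> KT; have ok := T_ok cT KT; have [dx dy d0 dxy rd] := diam_bounds ok.
have [l1 l2 l3 l4] := cell_in_Dbar cT KT; have [/= k1 k2] := ok.
rewrite /= in l1 l2 l3 l4.
rewrite /= ![_ + hx - _]addrAC ![_ + hy - _]addrAC !subrr !add0r in dx dy dxy.
set d := diam _ in dx dy d0 dxy rd *.
have hx0 : 0 < hx by move: k1; rewrite ltrDl.
have hy0 : 0 < hy by move: k2; rewrite ltrDl.
have rE : rho ((x0, y0), (x0 + hx, y0 + hy)) = Num.min hx hy.
  by rewrite /rho /= ![_ + hx - _]addrAC ![_ + hy - _]addrAC !subrr !add0r.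
have r0 : 0 < Num.min hx hy by rewrite lt_min hx0.
have dr : d <= Num.max 1 gamma * Num.min hx hy.
  rewrite -ler_pdivrMr// le_max; apply/orP; right.
  by have := rT KT; rewrite rE.
have g0 : 0 <= Num.max 1 gamma by rewrite le_max ler01.
split=> //.
- by apply: (le_trans dr); rewrite ler_wpM2l// ge_min lexx.
- by apply: (le_trans dr); rewrite ler_wpM2l// ge_min lexx orbT.
- by apply: (le_trans dxy); lra.
- by rewrite le_max lexx.
Qed.

Lemma hoelder_conj (p q : \bar R) f f' : (2%:E <= p)%E -> conj_exp p q ->
  measurable_fun (D : set pT) f -> measurable_fun (D : set pT) f' ->
  (LpnormD D p f < +oo)%E -> (LpnormD D q f' < +oo)%E ->
  \sum_(K <- T) (area K)^-1 * (RoInt K (fun z => `|f z|) * RoInt K (fun z => `|f' z|)) <=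
  fine (LpnormD D p f) * fine (LpnormD D q f').
Proof.
move=> p2 pq mf mf' lf lf'; have [p1 q1] := conj_exp_ge1 p2 pq.
have jf := Lp_intD ab1 ab2 mf p1 lf; have jf' := Lp_intD ab1 ab2 mf' q1 lf'.
have uT : uniq T by case: cT.
case: pq => [[pE qE]|[[pE _]|[r [s [pE qE r0 s0 rs]]]]].
- rewrite pE qE in lf lf' *.
  exact: (hoelder_cells_oo ab1 ab2 uT (T_ok cT) (Ro_sub cT) (Ro_disjoint cT)).
- by exfalso; move: p2; rewrite pE lee_fin; lra.
- rewrite pE qE in lf lf' *.
  exact: (hoelder_cells uT (T_ok cT) (Ro_sub cT) (Ro_disjoint cT)).
Qed.

Definition RoG (g : nat -> nat -> R * R -> R) K : R :=
  \sum_(i < 4) \sum_(j < 4 | (i + j <= 3)%N) RoInt K (fun z => `|g i j z|).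
Definition RoW (gv : nat -> nat -> R * R -> R) K : R :=
  RoInt K (fun z => `|gv 0%N 0%N z|) + RoInt K (fun z => `|gv 1%N 0%N z|) + RoInt K (fun z => `|gv 0%N 1%N z|).

(** The product of the two sums is expanded, and each pair of one derivative of u and one of v is
    treated by [hoelder_conj]. *)
Lemma hoelder_sobnorm (p q : \bar R) u v g gv : (2%:E <= p)%E -> conj_exp p q ->
  weak_derivs D 3 p u g -> weak_derivs D 1 q v gv ->
  ((\sum_(K <- T) (area K)^-1 * (RoG g K * RoW gv K))%:E <= sobnorm D 3 p g * sobnorm D 1 q gv)%E.
Proof.
move=> p2 pq wdu wdv; rewrite (sobnormE wdu) (sobnormE wdv) -EFinM lee_fin.
have [_ _ hu] := wdu; have [_ _ hv] := wdv.
set N := \sum_(i < 4) _.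
pose n i j := fine (LpnormD D q (gv i j)).
rewrite (_ : \sum_(i < 2) _ = n 0%N 0%N + n 1%N 0%N + n 0%N 1%N); last first.
  rewrite (eq_bigr (fun i : 'I_2 => \sum_(j < 2) (if (i + j <= 1)%N then n i j else 0))); last first.
    by move=> i _; rewrite big_mkcond.
  by rewrite !big_ord_recl !big_ord0 /= !addr0 addrAC.
have one i j : (i + j <= 1)%N ->
    \sum_(K <- T) (area K)^-1 * (RoG g K * RoInt K (fun z => `|gv i j z|)) <= N * n i j.
  move=> ij; have [mv lv _] := hv _ _ ij.
  rewrite /RoG /N.
  under eq_bigr => K _ do [rewrite mulr_suml mulr_sumr].
  rewrite exchange_big mulr_suml /=; apply: ler_sum => k _.
  under eq_bigr => K _ do [rewrite mulr_suml mulr_sumr].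
  rewrite exchange_big mulr_suml /=; apply: ler_sum => l kl.
  have [mu lu _] := hu _ _ kl.
  exact: hoelder_conj.
rewrite !mulrDr; apply: le_trans (lerD (lerD (one 0%N 0%N isT) (one 1%N 0%N isT)) (one 0%N 1%N isT)).
by rewrite -!big_split /=; apply: ler_sum => K _; rewrite /RoW !mulrDr.
Qed.

End Partition.

End Assembly.

(** * Uniform constants and the global estimate *)

Lemma finite_bound {R : realType} (P : 'I_2 -> 'I_2 -> R -> Prop) :
  (forall i j M N, M <= N -> P i j M -> P i j N) -> (forall i j, exists2 M, 0 <= M & P i j M) ->
  exists2 M, 0 <= M & forall i j, P i j M.
Proof.
move=> mono ex; pose f i j := sval (cid2 (ex i j)).
have f0 i j : 0 <= f i j by rewrite /f; case: cid2.
have fP i j : P i j (f i j) by rewrite /f; case: cid2.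
exists (\sum_i \sum_j f i j); first by do 2![apply: sumr_ge0 => ? _].
move=> i j; apply: mono (fP i j).
rewrite (bigD1 i)//= (bigD1 j)//= -addrA lerDl addr_ge0//; first exact: sumr_ge0.
by do 2![apply: sumr_ge0 => ? _].
Qed.

Lemma Ccell_ge0 {R : realType} (gam H Ainf Lip Cc : R) : 0 <= gam -> 0 <= H -> 0 <= Ainf -> 0 <= Lip -> 0 <= Cc ->
  0 <= Ccell gam H Ainf Lip Cc.
Proof.
move=> g0 H0 A0 L0 C0; have K0 := @Kunit_ge0 R; have g2 := exprn_ge0 2 g0.
by rewrite /Ccell /Cflux; do ![assumption | exact: ler01 | exact: ler0n | apply: addr_ge0 | apply: mulr_ge0].
Qed.

(** The origin of the h^2: a cell of area [a] satisfies [1 <= h2 / a]. *)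
Lemma absorb_area {R : realType} (k l a h2 x y : R) : 0 <= k -> 0 <= l -> 0 < a -> a <= h2 -> 0 <= x -> 0 <= y ->
  k * (l * y * x) <= k * l * h2 * (a^-1 * (x * y)).
Proof.
move=> k0 l0 a0 ah x0 y0; rewrite -!mulrA; apply: ler_wpM2l => //; apply: ler_wpM2l => //.
by rewrite [h2 * _]mulrCA ler_pdivlMl// [y * _]mulrC ler_wpM2r// mulr_ge0.
Qed.

Lemma Cnode_ge0 {R : realType} (gam : R) : 0 <= gam -> 0 <= Cnode gam.
Proof. by move=> g0; exact: mulr_ge0 (mulr_ge0 (ler0n _ 25) (mulr_ge0 (ler0n _ 64) (sqr_ge0 _))) g0. Qed.

Theorem theorem3p1 (R : realType) (a1 b1 a2 b2 : R)
    (A : 'I_2 -> 'I_2 -> R * R -> R)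
    (gA : 'I_2 -> 'I_2 -> nat -> nat -> R * R -> R)
    (c : R * R -> R) (C1 C2 gamma : R) (p q : \bar R) :
  a1 < b1 -> a2 < b2 ->
  (* A in [W^{1,oo}(Omega)]^{2x2}, given by its continuous representative *)
  (forall i j, weak_derivs (Omega a1 b1 a2 b2) 1 +oo%E (A i j) (gA i j)) ->
  (forall i j, {within Omegabar a1 b1 a2 b2, continuous (A i j)}) ->
  (* uniform ellipticity *)
  0 < C1 -> 0 < C2 ->
  (forall z, Omega a1 b1 a2 b2 z -> forall xi1 xi2 : R,
     let Q := xi1 * (A ord0 ord0 z * xi1 + A ord0 (lift ord0 ord0) z * xi2)
            + xi2 * (A (lift ord0 ord0) ord0 z * xi1
                     + A (lift ord0 ord0) (lift ord0 ord0) z * xi2) in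
     C1 * (xi1 ^+ 2 + xi2 ^+ 2) <= Q /\ Q <= C2 * (xi1 ^+ 2 + xi2 ^+ 2)) ->
  (* c in L^oo(Omega), c >= 0 *)
  measurable_fun (Omega a1 b1 a2 b2) c ->
  (LpnormD (Omega a1 b1 a2 b2) +oo%E c < +oo)%E ->
  (forall z, Omega a1 b1 a2 b2 z -> 0 <= c z) ->
  (* 2 <= p <= oo, 1/p + 1/q = 1 *)
  (2%:E <= p)%E -> conj_exp p q ->
  exists C : R, forall T : seq ((R * R) * (R * R)),
    conforming_partition a1 b1 a2 b2 T -> regular gamma T ->
    forall (u : R * R -> R) (g : nat -> nat -> R * R -> R),
      (* u in W^{3,p}(Omega), continuous representatives of u and grad u *)
      weak_derivs (Omega a1 b1 a2 b2) 3 p u g ->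
      {within Omegabar a1 b1 a2 b2, continuous u} ->
      {within Omegabar a1 b1 a2 b2, continuous (g 1%N 0%N)} ->
      {within Omegabar a1 b1 a2 b2, continuous (g 0%N 1%N)} ->
    forall (v : R * R -> R) (gv : nat -> nat -> R * R -> R),
      in_Uh a1 b1 a2 b2 T v ->
      weak_derivs (Omega a1 b1 a2 b2) 1 q v gv ->
      (`| ah a1 b1 a2 b2 T A c (err_interp u)
            (grad_err_interp u (g 1%N 0%N) (g 0%N 1%N)) (Pistar v) |%:E
       <= (C * hmax T ^+ 2)%:E
          * sobnorm (Omega a1 b1 a2 b2) 3 p g
          * sobnorm (Omega a1 b1 a2 b2) 1 q gv)%E.
Proof.
move=> ab1 ab2 wdA cA _ _ _ mc lc _ p2 pq.
have [p1 q1] := conj_exp_ge1 p2 pq.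
have [Ainf Ainf0 Ab] := finite_bound (P := fun i j M => forall z, Omegabar a1 b1 a2 b2 z -> `|A i j z| <= M)
  (fun i j M N MN h z Dz => le_trans (h z Dz) MN) (fun i j => continuous_bounded_Omegabar (cA i j)).
have [Lip Lip0 AL] := finite_bound
  (P := fun i j L => forall z z', Omegabar a1 b1 a2 b2 z -> Omegabar a1 b1 a2 b2 z' ->
     `|A i j z - A i j z'| <= L * (`|z.1 - z'.1| + `|z.2 - z'.2|))
  (fun i j M N MN h z z' Dz Dz' => le_trans (h z z' Dz Dz')
     (ler_wpM2r (addr_ge0 (normr_ge0 _) (normr_ge0 _)) MN))
  (fun i j => lipschitz_W1oo ab1 ab2 (wdA i j) (cA i j)).
have jc := Lp_intD ab1 ab2 mc (leey _) lc.
have cb := Loo_ae ab1 ab2 lc.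
set Cc := fine _ in cb; have Cc0 : 0 <= Cc by rewrite fine_ge0//; exact: Lnorm_ge0.
pose gam := Num.max 1 gamma; pose H := (b1 - a1) + (b2 - a2).
have g0 : 0 <= gam by rewrite le_max ler01.
have H0 : 0 <= H by rewrite addr_ge0// subr_ge0 ltW.
have CC0 : 0 <= Ccell gam H Ainf Lip Cc by exact: Ccell_ge0.
have Cn0 := Cnode_ge0 g0.
exists (Ccell gam H Ainf Lip Cc * Cnode gam) => T cT rT u g wdu cu cgx cgy v gv [cv vK v0] wdv.
have [mu _ _] := wdu; have [mv _ _] := wdv.
have ju := cont_intD mu cu; have jv := cont_intD mv cv.
have jg i j (ij : (i + j <= 3)%N) := weak_derivs_intD ab1 ab2 p1 wdu ij.
have jgv i j (ij : (i + j <= 1)%N) := weak_derivs_intD ab1 ab2 q1 wdv ij.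
pose loc K := \sum_(P <- verts K) v P *
  (- fluxK K P (fun x => matvec A x (grad_err_interp u (g 1%N 0%N) (g 0%N 1%N) K x))
   + Rintegral (@mu2 R) (quarter K P) (fun x => c x * err_interp u K x)).
have -> : ah a1 b1 a2 b2 T A c (err_interp u) (grad_err_interp u (g 1%N 0%N) (g 0%N 1%N)) (Pistar v) =
  \sum_(K <- T) loc K by exact: ah_cellwise.
pose i0 := (ord0 : 'I_2); pose i1 := (lift ord0 ord0 : 'I_2).
have [tx ty] : _ /\ _ := conj (telescope_edge_flux cT (A i0 i1) u v0).1 (telescope_edge_flux cT (A i1 i0) u v0).2.
pose dx K := edge_flux (A i0 i1) u v (leftE K) - edge_flux (A i0 i1) u v (rightE K).
pose dy K := edge_flux (A i1 i0) u v (bottomE K) - edge_flux (A i1 i0) u v (topE K).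
have cell K : K \in T -> `|loc K - 2^-1 * dx K - 2^-1 * dy K| <=
    Ccell gam H Ainf Lip Cc * Cnode gam * hmax T ^+ 2 * ((area K)^-1 * (RoG g K * RoW gv K)).
  move=> KT; have [ar0 arh] := area_hmax cT KT.
  have G0 : 0 <= RoG g K by do 2![apply: sumr_ge0 => ? _]; exact: Rintegral_ge0.
  have W0 : 0 <= RoW gv K by rewrite !addr_ge0//; exact: Rintegral_ge0.
  apply: (@le_trans _ _ (Ccell gam H Ainf Lip Cc * (Cnode gam * RoW gv K * RoG g K))); last first.
    exact: absorb_area.
  have [al [be [ga [de vE]]]] := vK K KT.
  have int P : P \in verts K -> v P != 0 -> Omega a1 b1 a2 b2 P.
    move=> PK /eqP vP; apply: contrapT => nP; apply: vP; apply: v0; split => //.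
    exact: (rset_Dbar cT KT (vert_rset (T_ok cT KT) PK)).
  move: KT {ar0 arh G0 W0} vE int; case: K => [[x0 y0] [x1 y1]].
  (* The cell is rewritten by one corner and its side lengths, the form of the cell estimates. *)
  rewrite -(subrKC x0 x1) -(subrKC y0 y1); move: (x1 - x0) (y1 - y0) => hx hy KT vE int.
  have cg := geometryT cT rT KT.
  have [V1 V2 V3 V4 V5] := nodal_le cg wdv jv jgv vE.
  exact: (cell_le ab1 ab2 wdu ju jg cu cgx cgy cg cA Lip0 Ab AL V1 V2 V3 V4 Cc0 jc cb V5 int).
have hE := hoelder_sobnorm ab1 ab2 cT p2 pq wdu wdv.
(* The edge terms subtracted on each cell add up to zero over the mesh. *)
have -> : \sum_(K <- T) loc K = \sum_(K <- T) (loc K - 2^-1 * dx K - 2^-1 * dy K).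
  rewrite !sumrB -!mulr_sumr !sumrB tx ty !subrr !mulr0 !subr0//.
rewrite -muleA; apply: le_trans (lee_wpmul2l _ hE).
  rewrite -EFinM lee_fin mulr_sumr; apply: (le_trans (ler_norm_sum _ _ _)).
  by rewrite !big_seq; apply: ler_sum => K KT; exact: cell.
by rewrite lee_fin; exact: mulr_ge0 (mulr_ge0 CC0 Cn0) (sqr_ge0 _).
Qed.
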